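(* Let $\mathcal{K}$ be a finite simplicial complex and let $\alpha=\{\alpha_1,\dots,\alpha_k\}$ be a partition of the vertex set of $\mathcal{K}$. Then there is a homotopy equivalence $$\mathbf{\Sigma}\big(X(\mathcal{K},\lambda_\alpha)\big)\;\simeq\;\bigvee_{\mathrm{L}\subset[k]}\mathbf{\Sigma}^{|\mathrm{L}|+2}(\mathcal{K}_{\alpha,\mathrm{L}}),$$ where $\mathbf{\Sigma}$ denotes the reduced suspension.
   Context: Simplicial complexes are abstract: $\mathcal{K}$ is a collection of subsets (simplices) of a finite vertex set $V(\mathcal{K})$, closed under taking subsets and containing the empty simplex; every vertex is a simplex. $V(\sigma)$ denotes the set of vertices of $\sigma\in\mathcal{K}$. A partition $\alpha=\{\alpha_1,\dots,\alpha_k\}$ of $V(\mathcal{K})$ consists of disjoint nonempty subsets $\alpha_i$ with $\alpha_1\cup\dots\cup\alpha_k=V(\mathcal{K})$. Put $[k]=\{1,\dots,k\}$. For $\sigma\in\mathcal{K}$ let $\mathrm{I}_{\alpha}(\sigma)=\{i\in[k] : V(\sigma)\cap\alpha_i\ne\varnothing\}$. For $\mathrm{L}\subset[k]$ let $\mathcal{K}_{\alpha,\mathrm{L}}$ be the subcomplex $\{\sigma\in\mathcal{K} : \mathrm{I}_{\alpha}(\sigma)\subset\mathrm{L}\}$ of $\mathcal{K}$; on the right-hand side of the equivalence it stands for its geometric realization (with a vertex as base-point). For $\mathrm{L}=\varnothing$ the realization of $\mathcal{K}_{\alpha,\varnothing}$ is empty, and the corresponding wedge summand is understood to be trivial (a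 point). The space $X(\mathcal{K},\lambda_{\alpha})$: let $P_{\mathcal{K}}$ be the cone on the barycentric subdivision $\mathcal{K}'$ of $\mathcal{K}$, i.e. the geometric realization of the order complex of the poset of all simplices of $\mathcal{K}$ (including the empty simplex, which corresponds to the cone point) ordered by inclusion. For $\sigma\in\mathcal{K}$ let $F_\sigma\subset P_{\mathcal{K}}$ be the geometric realization of the order complex of $\mathcal{K}_{\ge\sigma}=\{\tau\in\mathcal{K} : \sigma\subseteq\tau\}$. Let $\{\tilde e_1,\dots,\tilde e_k\}$ be a basis of $\mathbb{Z}^k$ and let $\lambda_{\alpha}:V(\mathcal{K})\to\mathbb{Z}^k$ send every vertex of $\alpha_i$ to $\tilde e_i$. For $\sigma\in\mathcal{K}$ let $G_{\lambda_\alpha}(\sigma)$ be the subtorus of $T^k=(S^1)^k$ corresponding to the subgroup of $\mathbb{Z}^k$ generated by $\{\lambda_\alpha(v): v\in V(\sigma)\}$ (in the coordinates of $T^k$ given by the basis $\tilde e_i$, it is the product of the coordinate circles with index $i\in\mathrm{I}_\alpha(\sigma)$). Then $$X(\mathcal{K},\lambda_\alpha)=P_{\mathcal{K}}\times T^k/\sim,$$ where $(p,g)\sim(p',g')$ whenever $p=p'\in F_\sigma$ and $g'g^{-1}\in G_{\lambda_\alpha}(\sigma)$ for some $\sigma\in\mathcal{K}$. *)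

(* Defs.v *)
From HB Require Import structures.
From Stdlib Require Import Relation_Operators.
From mathcomp Require Import all_boot all_order all_algebra complex.
From mathcomp Require Import all_classical all_reals topology normedtype homotopy.

Set Implicit Arguments.
Unset Strict Implicit.
Unset Printing Implicit Defensive.

Import Order.TTheory GRing.Theory Num.Theory numFieldNormedType.Exports.

Local Open Scope classical_set_scope.
Local Open Scope ring_scope.
Local Open Scope quotient_scope.

Section generated_quotient.
Context (Y : topologicalType) (r : Y -> Y -> Prop).

Definition gen_rel : rel Y := fun x y => `[< clos_refl_sym_trans Y r x y >].

Lemma gen_rel_refl : reflexive gen_rel.
Proof. by move=> x; apply/asboolP; exact: rst_refl. Qed.

Lemma gen_rel_sym : symmetric gen_rel.
Proof.
by move=> x y; apply/idP/idP => /asboolP rxy; apply/asboolP; exact: rst_sym.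
Qed.

Lemma gen_rel_trans : transitive gen_rel.
Proof.
by move=> y x z /asboolP xy /asboolP yz; apply/asboolP; apply: rst_trans yz.
Qed.

Definition gen_equiv := EquivRel gen_rel gen_rel_refl gen_rel_sym gen_rel_trans.

Definition gen_quot : Type := quotient_topology {eq_quot gen_equiv}.

HB.instance Definition _ := Topological.on gen_quot.
HB.instance Definition _ := Quotient.on gen_quot.

End generated_quotient.

Definition pointed_at (Y : topologicalType) (y0 : Y) : Type := Y.

HB.instance Definition _ (Y : topologicalType) (y0 : Y) :=
  Topological.copy (pointed_at y0) Y.
HB.instance Definition _ (Y : topologicalType) (y0 : Y) :=
  isPointed.Build (pointed_at y0) y0.

Definition one_point : ptopologicalType :=
  pointed_at (tt : discrete_topology unit).

Definition unit_interval (R : realType) : topologicalType :=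
  set_type `[0 : R, 1]%classic.

Lemma itv_zeroP (R : realType) : (0 : R) \in `[0 : R, 1]%classic.
Proof. by apply/mem_set; rewrite /= in_itv /= lexx ler01. Qed.

Definition itv_zero (R : realType) : unit_interval R := SigSub (itv_zeroP R).

Section homotopy.
Context (R : realType).

Definition homotopic (Y Z : topologicalType) (f g : Y -> Z) : Prop :=
  exists2 H : Y * unit_interval R -> Z, continuous H &
    forall y t, (\val t = 0 -> H (y, t) = f y) /\ (\val t = 1 -> H (y, t) = g y).

Definition homotopy_equivalent (Y Z : topologicalType) : Prop :=
  exists (f : Y -> Z) (g : Z -> Y),
    [/\ continuous f, continuous g, homotopic (g \o f) id
      & homotopic (f \o g) id].

End homotopy.

Section suspension.
Context (R : realType).

Definition susp_collapsed (Y : ptopologicalType) : set (Y * unit_interval R) :=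
  [set p | [\/ \val p.2 = 0, \val p.2 = 1 | p.1 = point]].

Definition reduced_susp_space (Y : ptopologicalType) : Type :=
  gen_quot
    (fun p q : Y * unit_interval R => susp_collapsed p /\ susp_collapsed q).

HB.instance Definition _ (Y : ptopologicalType) :=
  Topological.on (reduced_susp_space Y).
HB.instance Definition _ (Y : ptopologicalType) := isPointed.Build
  (reduced_susp_space Y) (\pi_(reduced_susp_space Y) (point, itv_zero R)).

Definition reduced_susp (Y : ptopologicalType) : ptopologicalType :=
  reduced_susp_space Y.

End suspension.

Section complexes.
Context (T : finType).
Implicit Types (K : {set {set T}}) (s : {set T}).

Definition simplicial_complex K : Prop :=
  finset.set0 \in K /\ forall s t : {set T}, s \in K -> t \subset s -> t \in K.

(* [T] is only an ambient type: its elements need not be vertices of [K]. *)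
Definition vertices K : {set T} := [set v | [set v]%SET \in K]%SET.

Definition order_complex K : {set {set {set T}}} :=
  [set c : {set {set T}} | (c \subset K) &&
     [forall s in c, forall t in c, (s \subset t) || (t \subset s)]]%SET.

Definition up_set K s : {set {set T}} := [set t in K | s \subset t]%SET.

(* Barycentric coordinates; the empty simplex is the support of no point. *)
Definition realization_set (R : realType) K : set {ptws T -> R} :=
  [set x | [/\ forall v, 0 <= x v, \sum_v x v = 1
             & [set v | x v != 0]%SET \in K]].
Arguments realization_set R K : clear implicits.

Definition realization (R : realType) K : topologicalType :=
  set_type (realization_set R K).

End complexes.
Arguments realization_set {T} R K _.

Section vertex_point.
Context (R : realType) (T : finType) (K : {set {set T}}).
Variable v : {v : T | v \in vertices K}.

Definition vertex_coord : {ptws T -> R} := fun w => (w == \val v)%:R.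

Lemma vertex_coordP : vertex_coord \in realization_set R K.
Proof.
apply/mem_set; split=> [w|| ]; first exact: ler0n.
- rewrite (bigD1 (\val v)) //= /vertex_coord eqxx big1 ?addr0 // => w.
  by move=> /negPf ->.
- suff -> : [set w | vertex_coord w != 0]%SET = [set \val v]%SET.
    by have := valP v; rewrite inE.
  by apply/setP => w; rewrite !inE /vertex_coord; case: (w == _);
    rewrite ?oner_eq0 ?eqxx.
Qed.

Definition vertex_point : realization R K := SigSub vertex_coordP.

End vertex_point.

Definition circle (R : realType) : topologicalType :=
  set_type [set z : R[i]^o | `|z| = 1].

Definition torus (R : realType) (k : nat) : topologicalType :=
  {ptws 'I_k -> circle R}.

Definition torus_div (R : realType) (k : nat) (g' g : torus R k) : 'I_k -> R[i] :=
  fun j => (\val (g' j) : R[i]) / (\val (g j) : R[i]).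

(* The subtorus of [(S^1)^k] corresponding to the subgroup of [Z^k] generated by
   the vectors [lam v], [v \in s]: the product of the images of the
   one-parameter subgroups [z |-> (z ^ lam v 0 0, ..., z ^ lam v 0 (k - 1))]. *)
Definition subtorus (R : realType) (T : finType) (k : nat)
    (lam : T -> 'rV[int]_k) (s : {set T}) : set ('I_k -> R[i]) :=
  [set g | exists z : T -> circle R,
     forall j, g j = \prod_(v in s) (\val (z v) : R[i]) ^ lam v 0 j].
Arguments subtorus R {T k} lam s _.

Section X_space.
Context (R : realType) (T : finType) (K : {set {set T}}) (k : nat).
Context (lam : T -> 'rV[int]_k).

(* The cone on the barycentric subdivision of [K]; the cone point is the vertex
   given by the empty simplex. *)
Definition P_space : topologicalType := realization R (order_complex K).

Definition face (s : {set T}) : set P_space :=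
  [set p | realization_set R (order_complex (up_set K s)) (\val p)].

(* An equivalence relation as soon as [K] is a simplicial complex, since for
   [face] only the least simplex in the support of [a.1] matters; [gen_quot]
   saves carrying that proof around. *)
Definition X_rel (a b : P_space * torus R k) : Prop :=
  exists s : {set T}, [/\ s \in K, a.1 = b.1, face s a.1
    & subtorus R lam s (torus_div b.2 a.2)].

Definition X_space : topologicalType := gen_quot X_rel.

End X_space.

Section partition.
Context (T : finType) (K : {set {set T}}) (k : nat) (alpha : 'I_k -> {set T}).

Definition partition_of_vertices : Prop :=
  injective alpha /\
  finset.partition [set alpha i | i : 'I_k]%SET (vertices K).

(* [row i e] is the [i]-th vector of the basis of [Z^k]. *)
Definition lambda_alpha (e : 'M[int]_k) (v : T) : 'rV[int]_k :=
  \sum_(i | v \in alpha i) row i e.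

Definition blocks (s : {set T}) : {set 'I_k} :=
  [set i | s :&: alpha i != finset.set0]%SET.

Definition subcomplex (L : {set 'I_k}) : {set {set T}} :=
  [set s in K | blocks s \subset L]%SET.

(* The summand [Sigma^(|L| + 2) (K_(alpha, L))] with base vertex [b L]; it is a
   point for [L] empty, where [K_(alpha, L)] has no vertex. *)
Definition summand (R : realType)
    (b : forall L : {set 'I_k}, L != finset.set0 ->
           {v : T | v \in vertices (subcomplex L)})
    (L : {set 'I_k}) : ptopologicalType :=
  match @idP (L != finset.set0) with
  | ReflectT nzL =>
      iter (#|L| + 2)%N (reduced_susp R) (pointed_at (vertex_point R (b L nzL)))
  | ReflectF _ => one_point
  end.

End partition.

(* Main.v *)
Require Import Defs.
From Stdlib Require Import Relation_Operators.
From mathcomp Require Import all_boot all_order all_algebra complex.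
From mathcomp Require Import all_classical all_reals topology normedtype homotopy.
From mathcomp Require Import realfun.
From mathcomp Require Import lra ring.

Set Implicit Arguments.
Unset Strict Implicit.
Unset Printing Implicit Defensive.

Import Order.TTheory GRing.Theory Num.Theory numFieldNormedType.Exports.

Local Open Scope classical_set_scope.
Local Open Scope ring_scope.

(** Why the theorem is true. In the torus coordinates given by the basis, [X] is the
    product of the cone on the subdivision of [K] with [T^k], where the coordinate [i]
    is forgotten over the union [F_i] of the faces of the vertices of the block [i].
    For a set [L] of blocks let [X_L] be the smash piece of [L]: the quotient of
    the cone times [T^L] in which all points with a trivial coordinate, or over a face
    [F_i] with [i] in [L], are one point.

    The points with trivial [i]-th coordinate form a retract of [X], and the quotient
    by it is [X] with the coordinate [i] smashed. After a suspension a retract that is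
    a neighbourhood retract splits off ([suspension_split]): the identity is the sum of
    the retraction and of their difference, and the difference factors through the
    quotient. Doing this one coordinate after the other exhibits the suspension of
    [X] as the wedge of the suspensions of all [X_L] ([partial_smash_hcoprod]). Wedges
    are recognised by their universal property up to homotopy ([hcoprod]), which makes
    the bookkeeping formal.

    A smashed circle coordinate is a suspension coordinate, so [X_L] is the [#|L|]-fold
    suspension of the cone modulo the union of the [F_i] with [i] in [L]
    ([circle_coordinates_susp]). That quotient is a suspension of the subcomplex of
    [L] ([cone_quotient_is_suspension]). For [L] empty the piece is the cone, which is
    contractible.

    All maps and homotopies are explicit formulas. They are easy to give in the cubical
    model of the cone ([cubes]), where [F_i] is the set of points with some coordinate
    [1] in the block [i], and where scaling and truncating moves neighbourhoods of all
    the faces into them at the same time. As the base points of [X] and of the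
    subcomplexes are arbitrary, reduced suspensions are compared with unreduced ones
    ([susp_ususp]), for which base points do not matter. *)

(** * Continuity *)

Section continuity.
Context {W : topologicalType}.

Lemma cts_cst (Z : topologicalType) (z : Z) : continuous (fun _ : W => z).
Proof. by move=> w; apply: cvg_cst; exact: nbhs_filter. Qed.

Lemma cts_id : continuous (fun w : W => w).
Proof. by move=> w; exact: cvg_id. Qed.

Lemma cts_comp (Y Z : topologicalType) (F : Y -> Z) (f : W -> Y) :
  continuous F -> continuous f -> continuous (fun w => F (f w)).
Proof.
by move=> cF cf w; apply: (continuous_comp (cf w)); exact: cF.
Qed.

Lemma cts_pair (Y Z : topologicalType) (f : W -> Y) (g : W -> Z) :
  continuous f -> continuous g -> continuous (fun w => (f w, g w)).
Proof. by move=> cf cg w; apply: cvg_pair; [exact: cf|exact: cg]. Qed.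

Lemma cts_fst (Y Z : topologicalType) (f : W -> Y * Z) :
  continuous f -> continuous (fun w => (f w).1).
Proof. by move=> cf; apply: (cts_comp _ cf) => p; exact: cvg_fst. Qed.

Lemma cts_snd (Y Z : topologicalType) (f : W -> Y * Z) :
  continuous f -> continuous (fun w => (f w).2).
Proof. by move=> cf; apply: (cts_comp _ cf) => p; exact: cvg_snd. Qed.

Lemma cts_fst0 (Y Z : topologicalType) : continuous (@fst Y Z).
Proof. by move=> p; exact: cvg_fst. Qed.

Lemma cts_snd0 (Y Z : topologicalType) : continuous (@snd Y Z).
Proof. by move=> p; exact: cvg_snd. Qed.

Lemma cts_proj (I : eqType) (Z : topologicalType) (f : W -> {ptws I -> Z}) i :
  continuous f -> continuous (fun w => f w i).
Proof.
move=> cf; apply: (cts_comp (F := fun g : {ptws I -> Z} => g i) _ cf).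
exact: (@proj_continuous _ (fun=> Z) i).
Qed.

Lemma cts_ptws (I : Type) (Z : topologicalType) (f : W -> {ptws I -> Z}) :
  (forall i, continuous (fun w => f w i)) -> continuous f.
Proof.
move=> cf w; apply/cvg_sup => i.
have ci := cf i w; move=> A; rewrite {1}nbhsE /= => -[B [oB Bx] BA].
case: oB => V oV VB; have Vw : V (f w i) by move: Bx; rewrite -VB.
have Vn : nbhs w ((fun v => f v i) @^-1` V).
  exact: ci _ (open_nbhs_nbhs (conj oV Vw)).
by apply: filterS Vn => v Vv; apply: BA; rewrite -VB.
Qed.

Lemma cts_sub (Y : topologicalType) (A : set Y) (f : W -> set_type A) :
  continuous (fun w => \val (f w)) -> continuous f.
Proof. exact: continuous_comp_initial. Qed.

Lemma cts_val (Y : topologicalType) (A : set Y) (f : W -> set_type A) :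
  continuous f -> continuous (fun w => \val (f w)).
Proof. by move=> cf; apply: (cts_comp _ cf); exact: initial_continuous. Qed.

Lemma cts_itv (R : realType) (f : W -> unit_interval R) :
  continuous f -> continuous (fun w => \val (f w)).
Proof. exact: cts_val. Qed.

Context {R : realType}.
Implicit Types f g h : W -> R.

Lemma cts_add f g : continuous f -> continuous g -> continuous (fun w => f w + g w).
Proof. by move=> cf cg w; apply: continuousD; [exact: cf|exact: cg]. Qed.

Lemma cts_opp f : continuous f -> continuous (fun w => - f w).
Proof. by move=> cf w; apply: continuousN; exact: cf. Qed.

Lemma cts_mul f g : continuous f -> continuous g -> continuous (fun w => f w * g w).
Proof. by move=> cf cg w; apply: continuousM; [exact: cf|exact: cg]. Qed.

Lemma cts_inv f : continuous f -> (forall w, f w != 0) ->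
  continuous (fun w => (f w)^-1).
Proof. by move=> cf f0 w; apply: continuousV => //; exact: cf. Qed.

Lemma cts_min f g : continuous f -> continuous g ->
  continuous (fun w => Num.min (f w) (g w)).
Proof. by move=> cf cg w; apply: continuous_min; [exact: cf|exact: cg]. Qed.

Lemma cts_max f g : continuous f -> continuous g ->
  continuous (fun w => Num.max (f w) (g w)).
Proof. by move=> cf cg w; apply: continuous_max; [exact: cf|exact: cg]. Qed.

Lemma cts_sqrt f : continuous f -> continuous (fun w => Num.sqrt (f w)).
Proof. by move=> cf; apply: (cts_comp _ cf); exact: sqrt_continuous. Qed.

Lemma cts_sum (I : Type) (r : seq I) (P : pred I) (F : I -> W -> R) :
  (forall i, continuous (F i)) -> continuous (fun w => \sum_(i <- r | P i) F i w).
Proof.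
move=> cF; elim: r => [|i r IH].
  by under eq_fun do rewrite big_nil; exact: cts_cst.
under eq_fun do rewrite big_cons.
by case: (P i) => //; apply: cts_add.
Qed.

Lemma cts_prod (I : Type) (r : seq I) (P : pred I) (F : I -> W -> R) :
  (forall i, continuous (F i)) -> continuous (fun w => \prod_(i <- r | P i) F i w).
Proof.
move=> cF; elim: r => [|i r IH].
  by under eq_fun do rewrite big_nil; exact: cts_cst.
under eq_fun do rewrite big_cons.
by case: (P i) => //; apply: cts_mul.
Qed.

Lemma near_lt h g w : continuous h -> continuous g -> h w < g w ->
  \forall w' \near w, h w' < g w'.
Proof.
move=> ch cg hg; have gh0 : 0 < g w - h w by rewrite subr_gt0.
have cgh : continuous (fun w => g w - h w) by apply/cts_add/cts_opp.
have Hn := cvgr_gt (g w - h w) (cgh w) _ gh0.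
by apply: (filterS _ (Hn _)) => v /=; rewrite subr_gt0.
Qed.

(** The pasting lemma for the closed sets [h <= c] and [c <= h]. *)
Lemma cts_if (Z : topologicalType) h (c : R) (f g : W -> Z) : continuous h ->
  continuous f -> continuous g -> (forall w, h w = c -> f w = g w) ->
  continuous (fun w => if h w <= c then f w else g w).
Proof.
move=> ch cf cg fg w; have [hw|hw|hw] := ltgtP (h w) c.
- have := cf w; rewrite /continuous_at /= (ltW hw); apply: cvg_trans.
  apply: near_eq_cvg; apply: filterS (near_lt ch (@cts_cst _ c) hw) => v hv.
  by rewrite (ltW hv).
- have := cg w; rewrite /continuous_at /= leNgt hw; apply: cvg_trans.
  apply: near_eq_cvg; apply: filterS (near_lt (@cts_cst _ c) ch hw) => v hv.
  by rewrite leNgt hv.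
- move=> U /=; rewrite hw lexx => Uw; have A : nbhs w (f @^-1` U) by exact: cf w U Uw.
  have B : nbhs w (g @^-1` U) by apply: (cg w U); rewrite -fg.
  by apply: filterS (filterI A B) => v [fv gv] /=; case: ifP.
Qed.

End continuity.

(** Decomposes a continuity goal along the head symbol of the function, using the
    continuity facts in the context for the symbols that it does not know. *)
Ltac cts_step :=
  first [ assumption
  | lazymatch goal with
    | |- forall x, continuous_at x ?F =>
      lazymatch F with
      | (fun w => w) => exact: cts_id
      | fst => exact: cts_fst0
      | snd => exact: cts_snd0
      | (fun w => (@?a w, @?b w)) => apply: cts_pair
      | (fun w => fst (@?a w)) => apply: cts_fst
      | (fun w => snd (@?a w)) => apply: cts_snd
      | (fun w => GRing.add (@?a w) (@?b w)) => apply: cts_add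
      | (fun w => GRing.opp (@?a w)) => apply: cts_opp
      | (fun w => GRing.mul (@?a w) (@?b w)) => apply: cts_mul
      | GRing.add _ => exact: (cts_add (@cts_cst _ _ _) (@cts_id _))
      | GRing.mul _ => exact: (cts_mul (@cts_cst _ _ _) (@cts_id _))
      | (fun w => Order.min (@?a w) (@?b w)) => apply: cts_min
      | (fun w => Order.max (@?a w) (@?b w)) => apply: cts_max
      | (fun w => ?G (@?a w)) =>
        first [ match goal with H : forall x, continuous_at x G |- _ =>
                  apply: (cts_comp H) end
              | exact: cts_cst | apply: cts_itv
              | match goal with H : _ |- _ => apply: (cts_comp H) end ]
      | _ => exact: cts_cst
      end
    end ].
Ltac cts := repeat cts_step.

(** * Quotient maps and homotopies *)

Section quotient_maps.

(** The universal property is taken as the definition because it is inherited by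
    products with [R], where a description by open sets would not be. *)
Definition quot_map (X Y : topologicalType) (q : X -> Y) :=
  [/\ continuous q, forall y, exists x, q x = y
    & forall (Z : topologicalType) (f : Y -> Z),
        continuous (fun x => f (q x)) -> continuous f].

Lemma quot_lift (X Y Z : topologicalType) (q : X -> Y) (f : X -> Z) :
  quot_map q -> continuous f -> (forall x x', q x = q x' -> f x = f x') ->
  exists2 g : Y -> Z, continuous g & forall x, g (q x) = f x.
Proof.
move=> [cq sq Q] cf ff.
have [s sK] := choice sq.
have gq x : f (s (q x)) = f x by apply: ff.
exists (fun y => f (s y)) => //; apply: Q.
by under eq_fun do rewrite gq.
Qed.

(** Homotopies on a quotient are to be built from homotopies upstairs. As [R] is
    locally compact, a map out of [Y * R] is continuous as soon as its curried form,
    a map from [Y] to the functions on [R] with the compact-open topology, is; and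
    that can be tested along [q]. *)
Lemma quot_mapR (R : realType) (X Y : topologicalType) (q : X -> Y) :
  quot_map q -> quot_map (fun p : X * R => (q p.1, p.2)).
Proof.
move=> [cq sq Q]; split; first by cts.
  by case=> y t; have [x <-] := sq y; exists (x, t).
move=> Z f cf.
have fy y : continuous (fun t : R => f (y, t)).
  have [x <-] := sq y.
  by apply: (cts_comp (F := fun p : X * R => f (q p.1, p.2)) (f := fun t => (x, t)));
    cts.
pose F : Y -> {compact-open, R -> Z} := curry f.
have cF : continuous F.
  apply: Q; exact: (continuous_curry_fun cf).
have -> : f = uncurry F by apply/funext => -[].
apply: continuous_uncurry => //; first exact: locally_compactR.
Qed.

Lemma gen_quot_map (Y : topologicalType) (r : Y -> Y -> Prop) :
  quot_map (\pi_(gen_quot r) : Y -> gen_quot r)%qT.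
Proof.
split; first exact: pi_continuous.
- by move=> y; exists (repr y); rewrite reprK.
- by move=> Z f cf; apply/quotient_continuous.
Qed.

Lemma gen_quotP (Y : topologicalType) (r : Y -> Y -> Prop) (x y : Y) :
  (\pi_(gen_quot r) x = \pi_(gen_quot r) y)%qT <-> clos_refl_sym_trans Y r x y.
Proof.
by split=> [/eqmodP/asboolP //|h]; apply/eqmodP/asboolP.
Qed.

Lemma gen_quot_rel (Y : topologicalType) (r : Y -> Y -> Prop) (x y : Y) :
  r x y -> (\pi_(gen_quot r) x = \pi_(gen_quot r) y)%qT.
Proof. by move=> h; apply/gen_quotP; exact: rst_step. Qed.

Lemma gen_quot_ind (Y : topologicalType) (r : Y -> Y -> Prop)
    (Z : Type) (f : Y -> Z) :
  (forall x y, r x y -> f x = f y) ->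
  forall x y, (\pi_(gen_quot r) x = \pi_(gen_quot r) y)%qT -> f x = f y.
Proof.
move=> fr x y /gen_quotP; elim=> [||? ? _ ->|? ? ? _ -> _ ->] //; exact: fr.
Qed.

Lemma gen_quot_lift (Y Z : topologicalType) (r : Y -> Y -> Prop) (f : Y -> Z) :
  continuous f -> (forall x y, r x y -> f x = f y) ->
  exists2 g : gen_quot r -> Z, continuous g &
    forall x, g (\pi_(gen_quot r) x)%qT = f x.
Proof.
move=> cf fr; apply: quot_lift => //; first exact: gen_quot_map.
exact: gen_quot_ind.
Qed.

End quotient_maps.

(** * Pointed homotopies and wedges up to homotopy *)

Section pointed_homotopy.
Context (R : realType).

Lemma half_lt1 : (1 <= 2^-1 :> R) = false.
Proof. by apply/negbTE; rewrite -ltNge; lra. Qed.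

Definition clamp (t : R) : R := Num.max 0 (Num.min 1 t).

Lemma clamp_ge0 t : 0 <= clamp t.
Proof. by rewrite /clamp le_max lexx. Qed.

Lemma clamp_le1 t : clamp t <= 1.
Proof. by rewrite /clamp ge_max ler01 ge_min lexx. Qed.

Lemma clamp_id t : 0 <= t <= 1 -> clamp t = t.
Proof. by case/andP => t0 t1; rewrite /clamp (min_idPr t1) (max_idPr t0). Qed.

Lemma clamp0 : clamp 0 = 0. Proof. by rewrite clamp_id // lexx ler01. Qed.
Lemma clamp1 : clamp 1 = 1. Proof. by rewrite clamp_id // lexx ler01. Qed.

Lemma clamp_le0 t : t <= 0 -> clamp t = 0.
Proof.
by move=> t0; apply/max_idPl; rewrite ge_min t0 orbT.
Qed.

Lemma clamp_ge1 t : 1 <= t -> clamp t = 1.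
Proof. by move=> t1; rewrite /clamp (min_idPl t1) (max_idPr _). Qed.

Lemma cts_clamp (W : topologicalType) (f : W -> R) :
  continuous f -> continuous (fun w => clamp (f w)).
Proof. by move=> cf; rewrite /clamp; cts. Qed.

(** Runs through [H] and then through [K]. *)
Definition splice (W Z : Type) (H K : W * R -> Z) (w : W * R) : Z :=
  if w.2 <= 2^-1 then H (w.1, 2 * w.2) else K (w.1, 2 * w.2 - 1).

Lemma cts_splice (W Z : topologicalType) (H K : W * R -> Z) :
  continuous H -> continuous K -> (forall w, H (w, 1) = K (w, 0)) ->
  continuous (splice H K).
Proof.
move=> cH cK HK; apply: cts_if; [by cts|by cts|by cts|].
by move=> [w t] /= ->; rewrite mulfV ?pnatr_eq0 // subrr.
Qed.

Lemma splice0 (W Z : Type) (H K : W * R -> Z) w : splice H K (w, 0) = H (w, 0).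
Proof. by rewrite /splice /= invr_ge0 ler0n mulr0. Qed.

Lemma splice1 (W Z : Type) (H K : W * R -> Z) w : splice H K (w, 1) = K (w, 1).
Proof.
by rewrite /splice /= half_lt1 (_ : 2 * 1 - 1 = 1) //; lra.
Qed.

Lemma splice_ind (W Z : Type) (H K : W * R -> Z) (P : Z -> Prop) w :
  (forall t : R, 0 <= t <= 1 -> P (H (w, t))) ->
  (forall t : R, 0 <= t <= 1 -> P (K (w, t))) ->
  forall t : R, 0 <= t <= 1 -> P (splice H K (w, t)).
Proof.
move=> PH PK t t01; rewrite /splice /=; case: ifPn => [t2|]; first by apply: PH; lra.
by rewrite -ltNge => t2; apply: PK; lra.
Qed.

Definition ptmap (S Z : ptopologicalType) (f : S -> Z) :=
  continuous f /\ f point = point.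

(** Homotopies are parametrised by all of [R] instead of the unit interval, so that
    reparametrisations need not be shown to stay in an interval. *)
Definition phom (S Z : ptopologicalType) (f g : S -> Z) :=
  exists2 H : S * R -> Z, continuous H &
    [/\ forall s, H (s, 0) = f s, forall s, H (s, 1) = g s
      & forall t, H (point, t) = point].

Definition pequiv (S Z : ptopologicalType) :=
  exists (f : S -> Z) (g : Z -> S),
    [/\ ptmap f, ptmap g, phom (fun s => g (f s)) id & phom (fun z => f (g z)) id].

Lemma ptmap_id (S : ptopologicalType) : ptmap (fun s : S => s).
Proof. by split=> //; exact: cts_id. Qed.

Lemma ptmap_cst (S Z : ptopologicalType) : ptmap (fun _ : S => point : Z).
Proof. by split=> //; exact: cts_cst. Qed.

Lemma ptmap_comp (S Y Z : ptopologicalType) (f : S -> Y) (g : Y -> Z) :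
  ptmap f -> ptmap g -> ptmap (fun s => g (f s)).
Proof. by move=> [cf f0] [cg g0]; split; [cts|rewrite f0]. Qed.

Lemma phomI (S Z : ptopologicalType) (f g : S -> Z) (H : S * R -> Z) :
  continuous H -> (forall s, H (s, 0) = f s) -> (forall s, H (s, 1) = g s) ->
  (forall t, 0 <= t <= 1 -> H (point, t) = point) -> phom f g.
Proof.
move=> cH H0 H1 Hp; exists (fun p => H (p.1, clamp p.2)).
  by apply: (cts_comp cH); apply: cts_pair; [cts|apply: cts_clamp; cts].
split=> [s|s|t]; rewrite /= ?clamp0 ?clamp1 //.
by apply: Hp; rewrite clamp_ge0 clamp_le1.
Qed.

Lemma phom_refl (S Z : ptopologicalType) (f : S -> Z) : ptmap f -> phom f f.
Proof. by move=> [cf f0]; exists (fun p => f p.1); [cts|split]. Qed.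

Lemma phom_sym (S Z : ptopologicalType) (f g : S -> Z) : phom f g -> phom g f.
Proof.
move=> [H cH [H0 H1 Hp]]; exists (fun p => H (p.1, 1 - p.2)); first by cts.
by split=> [s|s|t]; rewrite /= ?subr0 ?subrr.
Qed.

Lemma phom_trans (S Z : ptopologicalType) (g f h : S -> Z) :
  phom f g -> phom g h -> phom f h.
Proof.
move=> [H cH [H0 H1 Hp]] [K cK [K0 K1 Kp]].
apply: (@phomI _ _ _ _ (splice H K)) => [|s|s|].
- by apply: cts_splice => // s; rewrite H1 K0.
- by rewrite splice0 H0.
- by rewrite splice1 K1.
- by apply: (splice_ind (P := fun z => z = point)) => t _.
Qed.


Lemma phom_comp (S Y Z T : ptopologicalType) (f g : Y -> Z) (a : S -> Y)
    (b : Z -> T) :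
  ptmap a -> ptmap b -> phom f g -> phom (fun s => b (f (a s))) (fun s => b (g (a s))).
Proof.
move=> [ca a0] [cb b0] [H cH [H0 H1 Hp]].
exists (fun p => b (H (a p.1, p.2))); first by cts.
by split=> [s|s|t] /=; rewrite ?H0 ?H1 ?a0 ?Hp.
Qed.

Lemma phom_ext (S Z : ptopologicalType) (f g f' g' : S -> Z) :
  phom f g -> f =1 f' -> g =1 g' -> phom f' g'.
Proof. by move=> h /funext <- /funext <-. Qed.

Lemma pequiv_refl S : pequiv S S.
Proof.
exists id, id; split; (try exact: ptmap_id); apply: phom_refl; exact: ptmap_id.
Qed.

Lemma pequiv_sym S Z : pequiv S Z -> pequiv Z S.
Proof. by move=> [f [g [? ? ? ?]]]; exists g, f. Qed.

Lemma pequiv_trans (Y S Z : ptopologicalType) : pequiv S Y -> pequiv Y Z -> pequiv S Z.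
Proof.
move=> [f [g [cf cg gf fg]]] [h [k [ch ck kh hk]]].
exists (fun s => h (f s)), (fun z => g (k z)); split; try exact: ptmap_comp.
- exact: phom_trans (phom_comp cf cg kh) gf.
- exact: phom_trans (phom_comp ck ch fg) hk.
Qed.

Lemma pequiv_homotopy_equivalent S Z : pequiv S Z -> homotopy_equivalent R S Z.
Proof.
move=> [f [g [[cf _] [cg _] gf fg]]]; exists f, g; split => //.
- case: gf => H cH [H0 H1 _]; exists (fun p => H (p.1, \val p.2)).
    by cts.
  by move=> y t; split=> /= ->.
- case: fg => H cH [H0 H1 _]; exists (fun p => H (p.1, \val p.2)).
    by cts.
  by move=> y t; split=> /= ->.
Qed.

End pointed_homotopy.

Section coproducts.
Context (R : realType).
Implicit Types S Z : ptopologicalType.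
Local Notation "f '~*' g" := (phom R f g) (at level 70).

(** A wedge up to homotopy: [S] has the universal property of the coproduct of the
    [F j], for [j] in [P], in the category of pointed spaces and homotopy classes of
    pointed maps. Wedges can be assembled and compared by this property alone,
    without ever constructing the intermediate ones. *)
Definition hcoprod (J : Type) (P : pred J) (F : J -> ptopologicalType)
    S (inj : forall j, F j -> S) :=
  [/\ forall j, P j -> ptmap (inj j),
      forall Z (h : forall j, F j -> Z), (forall j, P j -> ptmap (h j)) ->
        exists2 k : S -> Z, ptmap k &
          forall j, P j -> (fun x => k (inj j x)) ~* h j
    & forall Z (k k' : S -> Z), ptmap k -> ptmap k' ->
        (forall j, P j -> (fun x => k (inj j x)) ~* (fun x => k' (inj j x))) ->
        k ~* k'].

Lemma hcoprod_unique (J : Type) (P : pred J) (F : J -> ptopologicalType)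
    S S' (inj : forall j, F j -> S) (inj' : forall j, F j -> S') :
  hcoprod P inj -> hcoprod P inj' -> pequiv R S S'.
Proof.
move=> [pI E U] [pI' E' U'].
have [f pf fE] := E _ _ pI'; have [g pg gE] := E' _ _ pI.
exists f, g; split=> //.
- apply: U => [||j Pj]; [exact: ptmap_comp|exact: ptmap_id|].
  refine (phom_trans _ (gE j Pj)).
  exact: (phom_comp (ptmap_id _) pg (fE j Pj)).
- apply: U' => [||j Pj]; [exact: ptmap_comp|exact: ptmap_id|].
  refine (phom_trans _ (fE j Pj)).
  exact: (phom_comp (ptmap_id _) pf (gE j Pj)).
Qed.

Lemma hcoprod_pequiv (J : Type) (P : pred J) (F G : J -> ptopologicalType)
    S (inj : forall j, F j -> S) :
  hcoprod P inj -> (forall j, P j -> pequiv R (F j) (G j)) ->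
  exists inj' : forall j, G j -> S, hcoprod P inj'.
Proof.
move=> [pI E U] FG.
have mk j : exists fg : (F j -> G j) * (G j -> F j), P j ->
    [/\ ptmap fg.1, ptmap fg.2, (fun x => fg.2 (fg.1 x)) ~* id
      & (fun x => fg.1 (fg.2 x)) ~* id].
  have [/FG[f [g fg]]|_] := boolP (P j); first by exists (f, g).
  by exists (fun=> point, fun=> point).
pose fg j := projT1 (cid (mk j)).
have fgP j : P j -> [/\ ptmap (fg j).1, ptmap (fg j).2,
    (fun x => (fg j).2 ((fg j).1 x)) ~* id & (fun x => (fg j).1 ((fg j).2 x)) ~* id].
  exact: projT2 (cid (mk j)).
exists (fun j x => inj j ((fg j).2 x)); split=> [j Pj|Z h ph|Z k k' pk pk' kk].
- by have [_ p2 _ _] := fgP j Pj; apply: (ptmap_comp p2); exact: pI.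
- have [|k pk kE] := E Z (fun j x => h j ((fg j).1 x)).
    by move=> j Pj; have [p1 _ _ _] := fgP j Pj; apply: (ptmap_comp p1); exact: ph.
  exists k => // j Pj; have [p1 p2 _ p12] := fgP j Pj.
  apply: phom_trans (phom_comp p2 (ptmap_id _) (kE j Pj)) _.
  exact: (phom_comp (ptmap_id _) (ph j Pj) p12).
- apply: U => // j Pj; have [p1 p2 p21 _] := fgP j Pj.
  have q := phom_comp p1 (ptmap_id _) (kk j Pj).
  have c l : ptmap l -> (fun x => l (inj j ((fg j).2 ((fg j).1 x)))) ~*
                       (fun x => l (inj j x)).
    move=> pl; apply: (phom_comp (ptmap_id _) _ p21 (b := fun x => l (inj j x))).
    by apply: ptmap_comp pl; exact: pI.
  refine (phom_trans _ (c _ _ pk')); refine (phom_trans (phom_sym (c _ _ pk)) q).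
Qed.

(** The map of the summand [F j] is the identity; [pselect] only serves to give
    the maps of the other summands a type. *)
Lemma hcoprod_pred1 (J : eqType) (F : J -> ptopologicalType) (j : J) :
  exists inj : forall i, F i -> F j, hcoprod (pred1 j) inj.
Proof.
pose inj i : F i -> F j :=
  if pselect (i = j) is left e then ecast k (F i -> F k) e (fun x => x)
  else fun=> point.
have injj : inj j = (fun x => x).
  by rewrite /inj; case: pselect => // e; rewrite (eq_axiomK e).
exists inj; split=> [i /eqP ->|Z h ph|Z k k' pk pk' kk].
- by rewrite injj; exact: ptmap_id.
- exists (h j); first by apply: ph; exact: eqxx.
  move=> i /eqP ->; rewrite injj; apply: phom_refl; apply: ph; exact: eqxx.
- by have := kk j (eqxx _); rewrite injj.
Qed.

(** The binary case of [hcoprod], with two unrelated summands. *)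
Definition hsum S S1 S2 (i1 : S1 -> S) (i2 : S2 -> S) :=
  [/\ ptmap i1, ptmap i2,
      forall Z (h1 : S1 -> Z) (h2 : S2 -> Z), ptmap h1 -> ptmap h2 ->
        exists2 k : S -> Z, ptmap k &
          (fun x => k (i1 x)) ~* h1 /\ (fun x => k (i2 x)) ~* h2
    & forall Z (k k' : S -> Z), ptmap k -> ptmap k' ->
        (fun x => k (i1 x)) ~* (fun x => k' (i1 x)) ->
        (fun x => k (i2 x)) ~* (fun x => k' (i2 x)) -> k ~* k'].

Lemma hcoprod_hsum (J : Type) (P1 P2 : pred J) (F : J -> ptopologicalType)
    S S1 S2 (i1 : S1 -> S) (i2 : S2 -> S)
    (inj1 : forall j, F j -> S1) (inj2 : forall j, F j -> S2) :
  (forall j, P1 j -> ~~ P2 j) -> hsum i1 i2 ->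
  hcoprod P1 inj1 -> hcoprod P2 inj2 ->
  hcoprod (predU P1 P2)
    (fun j x => if P1 j then i1 (inj1 j x) else i2 (inj2 j x)).
Proof.
move=> P12 [pi1 pi2 E U] [pI1 E1 U1] [pI2 E2 U2].
have not1 j : P2 j -> P1 j = false.
  by move=> P2j; apply/negbTE/negP => /P12; rewrite P2j.
split=> [j|Z h ph|Z k k' pk pk' kk].
- case/orP => Pj; first by rewrite Pj; apply: ptmap_comp pi1; exact: pI1.
  by rewrite not1 //; apply: ptmap_comp pi2; exact: pI2.
- have [j Pj|k1 pk1 k1E] := E1 Z h; first by apply: ph; rewrite /= Pj.
  have [j Pj|k2 pk2 k2E] := E2 Z h; first by apply: ph; rewrite /= Pj orbT.
  have [k pk [kk1 kk2]] := E Z _ _ pk1 pk2.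
  exists k => // j /orP[] Pj.
    by rewrite Pj; apply: phom_trans (k1E j Pj); exact: (phom_comp (pI1 j Pj) (ptmap_id _) kk1).
  by rewrite not1 //; apply: phom_trans (k2E j Pj); exact: (phom_comp (pI2 j Pj) (ptmap_id _) kk2).
- apply: U => //.
    apply: U1; [exact: ptmap_comp|exact: ptmap_comp|move=> j Pj].
    by have := kk j; rewrite /= Pj; apply.
  apply: U2; [exact: ptmap_comp|exact: ptmap_comp|move=> j Pj].
  by have := kk j; rewrite /= Pj orbT not1 //; apply.
Qed.

(** Homotopies on the summands agree at the base points, and glue to a homotopy on
    the wedge after currying, which moves the parameter into the target. *)
Lemma hcoprod_wedge (J : choiceType) (F : J -> ptopologicalType) (j0 : J) :
  hcoprod predT (fun j => wedge_lift (fun j => (point : F j)) (i := j) :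
    F j -> pointed_at (wedge_lift (fun j => (point : F j)) (point : F j0))).
Proof.
have liftE j : wedge_lift (fun j => (point : F j)) (point : F j) =
    wedge_lift (fun j => (point : F j)) (point : F j0).
  exact: (wedge_liftE (fun j => (point : F j)) (point : F j0) (point : F j)).
split=> [j _|Z h ph|Z k k' pk pk' kk].
- by split; [exact: wedge_lift_continuous|exact: liftE].
- have hE i j : h i point = h j point by rewrite !(ph _ isT).2.
  exists (wedge_fun h).
    split; first by apply: wedge_fun_continuous => // j; exact: (ph j isT).1.
    rewrite [LHS](wedge_lift_funE (p0 := fun j => point) _ hE).
    exact: (ph j0 isT).2.
  move=> j _; apply: phom_ext (phom_refl _ (ph j isT)) _ _ => // x.
  by rewrite wedge_lift_funE.
- have mk j : exists H : F j * R -> Z, continuous H /\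
    [/\ forall s, H (s, 0) = k (wedge_lift _ s), forall s, H (s, 1) = k' (wedge_lift _ s)
      & forall t, H (point, t) = point].
    by have [H cH HE] := kk j isT; exists H.
  pose H j := projT1 (cid (mk j)).
  have HP j : continuous (H j) /\
    [/\ forall s, H j (s, 0) = k (wedge_lift _ s), forall s, H j (s, 1) = k' (wedge_lift _ s)
      & forall t, H j (point, t) = point] by exact: projT2 (cid (mk j)).
  pose C j : F j -> {compact-open, R -> Z} := curry (H j).
  have CE i j : C i point = C j point.
    by apply/funext => t; rewrite /C /curry; case: (HP i) => _ [_ _ ->];
      case: (HP j) => _ [_ _ ->].
  pose D : wedge (fun j => (point : F j)) -> {compact-open, R -> Z} := wedge_fun C.
  have cD : continuous D.
    apply: (wedge_fun_continuous _ CE) => j; apply: continuous_curry_fun.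
    by case: (HP j).
  have DE j (x : F j) t : D (wedge_lift _ x) t = H j (x, t).
    by rewrite /D wedge_lift_funE.
  have Dind (Q : _ -> Prop) : (forall j (x : F j), Q (wedge_lift _ x)) ->
      forall w : wedge (fun j => (point : F j)), Q w.
    move=> HQ w; have := wedgeTE (fun j => (point : F j)).
    by move=> /seteqP[_ /(_ w I)[j _ [x _ <-]]].
  exists (uncurry D).
    apply: continuous_uncurry => //; first exact: locally_compactR.
    apply: Dind => j x; have [_ cj] := continuous_curry (HP j).1.
    have -> : D (wedge_lift _ x) = curry (H j) x by apply/funext => t; rewrite DE.
    exact: cj.
  split.
  + by apply: Dind => j x; rewrite /= DE; case: (HP j) => _ [].
  + by apply: Dind => j x; rewrite /= DE; case: (HP j) => _ [].
  + by move=> t; rewrite /= [LHS]DE; case: (HP j0) => _ [].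
Qed.

End coproducts.

(** * Reduced suspensions *)

Section cylinders.
Context (R : realType).

Lemma itv_ofP (t : R) : clamp t \in `[0 : R, 1]%classic.
Proof. by apply/mem_set; rewrite /= in_itv /= clamp_ge0 clamp_le1. Qed.

Definition itv_of (t : R) : unit_interval R := SigSub (itv_ofP t).

Lemma itv_of_val (i : unit_interval R) : itv_of (\val i) = i.
Proof.
apply: val_inj; rewrite /= clamp_id //.
by have := valP i; rewrite /= inE /= in_itv.
Qed.

Lemma cts_itv_of (W : topologicalType) (f : W -> R) :
  continuous f -> continuous (fun w => itv_of (f w)).
Proof. by move=> cf; apply: cts_sub; exact: cts_clamp. Qed.

Context (Y : topologicalType) (r : Y * unit_interval R -> Y * unit_interval R -> Prop).

(** Heights outside of [0, 1] are clamped, so that heights can be computed in [R]. *)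
Definition cyl_pt (p : Y * R) : gen_quot r := (\pi_(gen_quot r) (p.1, itv_of p.2))%qT.

Lemma cts_cyl_pt : continuous cyl_pt.
Proof.
have [c _ _] := gen_quot_map r.
by apply: (cts_comp c); apply: cts_pair; [cts|apply: cts_itv_of; cts].
Qed.

Lemma cyl_ind (P : gen_quot r -> Prop) :
  (forall y (t : R), 0 <= t <= 1 -> P (cyl_pt (y, t))) -> forall z, P z.
Proof.
move=> h z; rewrite -(reprK z); case: (repr z) => y i.
rewrite -(itv_of_val i); apply: (h y); have := valP i.
by rewrite /= inE /= in_itv.
Qed.

Lemma cyl_eq y t y' t' : r (y, itv_of t) (y', itv_of t') ->
  cyl_pt (y, t) = cyl_pt (y', t').
Proof. by move=> h; apply: gen_quot_rel. Qed.

Lemma cyl_clamp y t : cyl_pt (y, clamp t) = cyl_pt (y, t).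
Proof.
rewrite /cyl_pt /=; congr (\pi_ _ (_, _))%qT; apply: val_inj => /=.
by rewrite clamp_id // clamp_ge0 clamp_le1.
Qed.

Lemma cyl_liftR (Z : topologicalType) (f : Y * R * R -> Z) :
  continuous f ->
  (forall p q s, r p q -> f (p.1, \val p.2, s) = f (q.1, \val q.2, s)) ->
  exists2 g : gen_quot r * R -> Z, continuous g &
    forall y (t s : R), 0 <= t <= 1 -> g (cyl_pt (y, t), s) = f (y, t, s).
Proof.
move=> cf fr.
pose f' (w : Y * unit_interval R * R) := f (w.1.1, \val w.1.2, w.2).
have [||g cg gE] := quot_lift (f := f') (quot_mapR R (gen_quot_map r)).
- by rewrite /f'; cts.
- case=> p s [q s'] [pq ->]; move: p q pq.
  by apply: gen_quot_ind => p q pq; apply: fr.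
exists g => // y t s t01.
by rewrite (gE (y, itv_of t, s)) /f' /= clamp_id.
Qed.

End cylinders.

Section suspension.
Context (R : realType).
Implicit Types (X Y Z : ptopologicalType).

Definition susp_pt Y (p : Y * R) : reduced_susp R Y :=
  cyl_pt (fun p q => susp_collapsed p /\ susp_collapsed q) p.

Lemma cts_susp_pt Y : continuous (@susp_pt Y).
Proof. exact: cts_cyl_pt. Qed.

Lemma susp_pointE Y : (point : reduced_susp R Y) = susp_pt (point, 0).
Proof.
rewrite /susp_pt /cyl_pt /=; congr (\pi_ _ (_, _))%qT; apply: val_inj => /=.
by rewrite clamp0.
Qed.

Lemma susp_pt_col Y (y : Y) (t : R) :
  [\/ t <= 0, 1 <= t | y = point] -> susp_pt (y, t) = point.
Proof.
move=> h; rewrite susp_pointE; apply: cyl_eq; split; rewrite /susp_collapsed /=.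
  by case: h => [/clamp_le0 ->|/clamp_ge1 ->|->]; [apply: Or31|apply: Or32|apply: Or33].
by rewrite clamp0; apply: Or31.
Qed.

Lemma susp_pt0 Y (y : Y) (t : R) : t <= 0 -> susp_pt (y, t) = point.
Proof. by move=> t0; apply: susp_pt_col; apply: Or31. Qed.

Lemma susp_pt1 Y (y : Y) (t : R) : 1 <= t -> susp_pt (y, t) = point.
Proof. by move=> t1; apply: susp_pt_col; apply: Or32. Qed.

Lemma susp_ptp Y (t : R) : susp_pt (point : Y, t) = point.
Proof. by apply: susp_pt_col; apply: Or33. Qed.

Lemma susp_ind Y (P : reduced_susp R Y -> Prop) :
  (forall y (t : R), 0 <= t <= 1 -> P (susp_pt (y, t))) -> forall z, P z.
Proof. exact: cyl_ind. Qed.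

Lemma susp_liftR (Y Z : ptopologicalType) (f : Y * R * R -> Z) :
  continuous f ->
  (forall y (s : R), 0 <= s <= 1 -> f (y, 0, s) = point) ->
  (forall y (s : R), 0 <= s <= 1 -> f (y, 1, s) = point) ->
  (forall t s : R, 0 <= t <= 1 -> 0 <= s <= 1 -> f (point, t, s) = point) ->
  exists2 g : reduced_susp R Y * R -> Z, continuous g &
    (forall y (t s : R), 0 <= t <= 1 -> 0 <= s <= 1 -> g (susp_pt (y, t), s) = f (y, t, s))
    /\ forall s, g (point, s) = point.
Proof.
move=> cf f0 f1 fp; pose f' (w : Y * R * R) := f (w.1, clamp w.2).
have c01 (s : R) : 0 <= clamp s <= 1 by rewrite clamp_ge0 clamp_le1.
have [|p q s [pc qc]|g cg gE] := cyl_liftR (f := f')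
    (r := fun p q : Y * unit_interval R => susp_collapsed p /\ susp_collapsed q).
- by apply: (cts_comp cf); apply: cts_pair; [cts|apply: cts_clamp; cts].
- have fc w : susp_collapsed w -> f' (w.1, \val w.2, s) = point.
    rewrite /f'; case: w => y i /= [/= ->|/= ->|/= ->] /=; [exact: f0|exact: f1|].
    by apply: fp => //; have := valP i; rewrite /= inE /= in_itv.
  by rewrite !fc.
exists g => //; split=> [y t s t01 s01|s].
  by rewrite /susp_pt gE // /f' /= clamp_id.
by rewrite susp_pointE /susp_pt gE ?lexx ?ler01 // /f' /= f0.
Qed.

Lemma susp_lift (Y Z : ptopologicalType) (f : Y * R -> Z) :
  continuous f -> (forall y, f (y, 0) = point) -> (forall y, f (y, 1) = point) ->
  (forall t : R, 0 <= t <= 1 -> f (point, t) = point) ->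
  exists2 g : reduced_susp R Y -> Z, ptmap g &
    forall y (t : R), 0 <= t <= 1 -> g (susp_pt (y, t)) = f (y, t).
Proof.
move=> cf f0 f1 fp.
have [|y s _|y s _|t s t01 _|g cg [gE gp]] := @susp_liftR Y Z (fun w => f w.1) => //.
- by cts.
- exact: f0.
- exact: f1.
- exact: fp.
exists (fun z => g (z, 0)); first by split; [cts|exact: gp].
by move=> y t t01; rewrite gE // lexx ler01.
Qed.

(** Pointed homotopies of maps out of a suspension, presented on the cylinder. *)
Lemma susp_phom (Y Z : ptopologicalType) (f g : reduced_susp R Y -> Z)
    (H : Y * R * R -> Z) : continuous H ->
  (forall y (s : R), 0 <= s <= 1 -> H (y, 0, s) = point) ->
  (forall y (s : R), 0 <= s <= 1 -> H (y, 1, s) = point) ->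
  (forall t s : R, 0 <= t <= 1 -> 0 <= s <= 1 -> H (point, t, s) = point) ->
  (forall y (t : R), 0 <= t <= 1 -> H (y, t, 0) = f (susp_pt (y, t))) ->
  (forall y (t : R), 0 <= t <= 1 -> H (y, t, 1) = g (susp_pt (y, t))) ->
  phom R f g.
Proof.
move=> cH H0 H1 Hp Hf Hg; have [K cK [KE Kp]] := susp_liftR cH H0 H1 Hp.
exists K => //; split=> //; apply: susp_ind => y t t01.
  by rewrite KE ?lexx ?ler01 // Hf.
by rewrite KE ?lexx ?ler01 // Hg.
Qed.

Lemma susp_map (X Y : ptopologicalType) (f : X -> Y) : ptmap f ->
  exists2 F : reduced_susp R X -> reduced_susp R Y, ptmap F &
    forall x t, F (susp_pt (x, t)) = susp_pt (f x, t).
Proof.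
move=> [cf fp].
have cS := @cts_susp_pt Y.
have [|x|x|t _|F pF FE] := @susp_lift X _ (fun w => susp_pt (f w.1, w.2)).
- by cts.
- by apply: susp_pt_col; apply: Or31.
- by apply: susp_pt_col; apply: Or32.
- by rewrite /= fp; apply: susp_pt_col; apply: Or33.
exists F => // x t; rewrite /susp_pt -cyl_clamp -[in RHS]cyl_clamp.
by rewrite [LHS]FE // clamp_ge0 clamp_le1.
Qed.

Lemma susp_pequiv (X Y : ptopologicalType) : pequiv R X Y ->
  pequiv R (reduced_susp R X) (reduced_susp R Y).
Proof.
move=> [f [g [pf pg gf fg]]].
have [F pF FE] := susp_map pf; have [G pG GE] := susp_map pg.
have aux (S T : ptopologicalType) (a : S -> T) (b : T -> S) A B :
    (forall x t, A (susp_pt (x, t)) = susp_pt (a x, t) :> reduced_susp R T) ->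
    (forall x t, B (susp_pt (x, t)) = susp_pt (b x, t) :> reduced_susp R S) ->
    phom R (fun s => b (a s)) id -> phom R (fun z => B (A z)) id.
  move=> AE BE [H cH [H0 H1 Hp]]; have cS := @cts_susp_pt S.
  apply: (@susp_phom _ _ _ _ (fun w => susp_pt (H (w.1.1, w.2), w.1.2))).
  - by cts.
  - by move=> y s _; apply: susp_pt_col; apply: Or31.
  - by move=> y s _; apply: susp_pt_col; apply: Or32.
  - by move=> t s _ _ /=; rewrite Hp; apply: susp_pt_col; apply: Or33.
  - by move=> y t _ /=; rewrite H0 AE BE.
  - by move=> y t _ /=; rewrite H1.
exists F, G; split=> //; exact: aux gf || exact: aux fg.
Qed.

Lemma susp_iter_pequiv n (X Y : ptopologicalType) : pequiv R X Y ->
  pequiv R (iter n (reduced_susp R) X) (iter n (reduced_susp R) Y).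
Proof. by move=> h; elim: n => //= n IH; exact: susp_pequiv. Qed.

End suspension.

(** * Unreduced suspensions and well-pointed spaces *)

Section thickening.
Context (R : realType) (X Z : topologicalType).
Context (Sx : X * R -> Z) (phi : X * R -> X) (r : X -> X) (u : X -> R) (S' : Z).
Hypothesis cS : continuous Sx.
Hypothesis S1 : forall x (t : R), 1 <= t -> Sx (x, t) = S'.
Hypothesis cphi : continuous phi.
Hypothesis phi0 : forall x, phi (x, 0) = x.
Hypothesis cr : continuous r.
Hypothesis cu : continuous u.
Hypothesis u01 : forall x, 0 <= u x <= 1.
Hypothesis rphi : forall x, u x < 1 -> r (phi (x, 1)) = phi (x, 1).

(** Let [phi_1 = phi (_, 1)] and let [r] be a retraction such that [phi_1] moves the
    points [x] with [u x < 1] into the image of [r]. For [w.2 = 0] this is the path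
    that climbs from the bottom to the height [u x] along [phi_1 x] and comes back
    down along [r (phi_1 x)]: at height [1] the two are joined because heights [1]
    are collapsed, and below it because [phi_1 x] and [r (phi_1 x)] are equal. So it
    is a continuous version of a path followed by the inverse of its retract, and it
    is constant where [u] vanishes. The parameter [w.2] turns the way back down
    into a way up to height [1]. *)
Definition there_and_back (w : X * R * R) : Z :=
  if w.1.2 <= 2^-1 then Sx (phi (w.1.1, 1), Num.min (2 * w.1.2) (u w.1.1))
  else Sx (r (phi (w.1.1, 1)),
    (1 - w.2) * Num.min (2 - 2 * w.1.2) (u w.1.1) +
      w.2 * Num.max (2 * w.1.2 - 1) (u w.1.1)).

Lemma cts_there_and_back : continuous there_and_back.
Proof.
apply: cts_if; [by cts|by cts|by cts|].
case=> [[x t] k] /= ->; have -> : 2 * 2^-1 = 1 :> R by rewrite mulfV ?pnatr_eq0.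
have /andP[u0 u1] := u01 x.
rewrite subrr (_ : 2 - 1 = 1); last by lra.
rewrite (min_idPr u1) (max_idPr u0) -mulrDl subrK mul1r.
have [ux|ux] := ltP (u x) 1; first by rewrite rphi.
by rewrite !S1.
Qed.

Lemma there_and_back_half x t : t <= 2^-1 -> forall k,
  there_and_back (x, t, k) = Sx (phi (x, 1), Num.min (2 * t) (u x)).
Proof. by move=> t2 k; rewrite /there_and_back /= t2. Qed.

(** The monotone path that pauses at the height [a]. *)
Definition detour (a t : R) := Num.max (Num.min (2 * t) a) (2 * t - 1).

Lemma there_and_back1 x t :
  there_and_back (x, t, 1) = Sx (phi (x, 1), detour (u x) t).
Proof.
have /andP[u0 u1] := u01 x; rewrite /there_and_back /detour /=.
case: ifPn => t2.
  rewrite (max_idPl _) // le_min; apply/andP; split; first by lra.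
  by apply: le_trans u0; lra.
rewrite -ltNge in t2; rewrite subrr mul0r add0r mul1r.
have -> : Num.min (2 * t) (u x) = u x by apply/min_idPr; lra.
rewrite maxC; have [ux|ux] := ltP (u x) 1; first by rewrite rphi.
by rewrite !S1 // le_max ux ?orbT.
Qed.

Lemma detour0 a t : 0 <= a -> t <= 0 -> detour a t <= 0.
Proof.
move=> a0 t0; rewrite /detour ge_max ge_min; apply/andP; split; last by lra.
by apply/orP; left; lra.
Qed.

Lemma detour1 a t : 1 <= t -> 1 <= detour a t.
Proof. by move=> t1; rewrite /detour le_max; apply/orP; right; lra. Qed.

(** Undoes the thickening [phi] and the pause at the same time. *)
Definition straighten (w : X * R * R) : Z :=
  Sx (phi (w.1.1, 1 - w.2), (1 - w.2) * detour (u w.1.1) w.1.2 + w.2 * w.1.2).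

Lemma cts_straighten : continuous straighten.
Proof. by rewrite /straighten /detour; cts. Qed.

Lemma straighten0 x t : straighten (x, t, 0) = there_and_back (x, t, 1).
Proof. by rewrite /straighten /= subr0 mul1r mul0r addr0 there_and_back1. Qed.

Lemma straighten1 x t : straighten (x, t, 1) = Sx (x, t).
Proof. by rewrite /straighten /= subrr phi0 mul0r add0r mul1r. Qed.

Definition unwind (w : X * R * R) : Z :=
  if w.2 <= 2^-1 then there_and_back (w.1, 2 * w.2)
  else straighten (w.1, 2 * w.2 - 1).

Lemma cts_unwind : continuous unwind.
Proof.
have cT := cts_there_and_back; have cG := cts_straighten.
apply: cts_if; [by cts|by cts|by cts|].
case=> [[x t] s] /= ->; rewrite mulfV ?pnatr_eq0 // subrr.
by rewrite straighten0.
Qed.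

Lemma unwind1 w : unwind (w, 1) = Sx w.
Proof.
case: w => x t; rewrite /unwind /=.
have -> : (1 <= 2^-1 :> R) = false by apply/negbTE; rewrite -ltNge; lra.
by rewrite (_ : 2 * 1 - 1 = 1) ?straighten1 //; lra.
Qed.

End thickening.

Section unreduced.
Context (R : realType).

Definition ususp_rel (Y : topologicalType) (p q : Y * unit_interval R) : Prop :=
  (\val p.2 = 0 /\ \val q.2 = 0) \/ (\val p.2 = 1 /\ \val q.2 = 1).

Definition ususp (Y : topologicalType) : topologicalType := gen_quot (@ususp_rel Y).

Definition ususp_pt (Y : topologicalType) (p : Y * R) : ususp Y :=
  cyl_pt (@ususp_rel Y) p.

Lemma cts_ususp_pt (Y : topologicalType) : continuous (@ususp_pt Y).
Proof. exact: cts_cyl_pt. Qed.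

Lemma ususp_pt0 (Y : topologicalType) (y y' : Y) (t t' : R) : t <= 0 -> t' <= 0 ->
  ususp_pt (y, t) = ususp_pt (y', t').
Proof. by move=> t0 t0'; apply: cyl_eq; left => /=; rewrite !clamp_le0. Qed.

Lemma ususp_pt1 (Y : topologicalType) (y y' : Y) (t t' : R) : 1 <= t -> 1 <= t' ->
  ususp_pt (y, t) = ususp_pt (y', t').
Proof. by move=> t0 t0'; apply: cyl_eq; right => /=; rewrite !clamp_ge1. Qed.

Lemma ususp_liftR (Y Z : topologicalType) (f : Y * R * R -> Z) :
  continuous f ->
  (forall y y' (s : R), 0 <= s <= 1 -> f (y, 0, s) = f (y', 0, s)) ->
  (forall y y' (s : R), 0 <= s <= 1 -> f (y, 1, s) = f (y', 1, s)) ->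
  exists2 g : ususp Y * R -> Z, continuous g &
    forall y (t s : R), 0 <= t <= 1 -> 0 <= s <= 1 ->
      g (ususp_pt (y, t), s) = f (y, t, s).
Proof.
move=> cf f0 f1; pose f' (w : Y * R * R) := f (w.1, clamp w.2).
have c01 (s : R) : 0 <= clamp s <= 1 by rewrite clamp_ge0 clamp_le1.
have [||g cg gE] := @cyl_liftR _ _ (@ususp_rel Y) _ f'.
- by apply: (cts_comp cf); apply: cts_pair; [cts|apply: cts_clamp; cts].
- by move=> [y i] [y' i'] s [] /= [-> ->]; [exact: f0|exact: f1].
by exists g => // y t s t01 s01; rewrite [LHS]gE // /f' /= clamp_id.
Qed.

Lemma ususp_lift (Y Z : topologicalType) (f : Y * R -> Z) :
  continuous f -> (forall y y', f (y, 0) = f (y', 0)) ->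
  (forall y y', f (y, 1) = f (y', 1)) ->
  exists2 g : ususp Y -> Z, continuous g &
    forall y (t : R), 0 <= t <= 1 -> g (ususp_pt (y, t)) = f (y, t).
Proof.
move=> cf f0 f1.
have [|||g cg gE] := @ususp_liftR Y Z (fun w => f w.1); first by cts.
- by move=> y y' s _; exact: f0.
- by move=> y y' s _; exact: f1.
exists (fun z => g (z, 0)); first by cts.
by move=> y t t01; rewrite gE ?lexx ?ler01.
Qed.

(** All points of height [0] are this one, whatever [y] is. *)
Definition pole (Y : topologicalType) (y : Y) : ususp Y := ususp_pt (y, 0).

(** A neighbourhood [u < 1] of [y0] can be contracted to [y0] by a homotopy that is
    defined on the whole space. *)
Definition well_pointed (Y : topologicalType) (y0 : Y) :=
  exists (phi : Y * R -> Y) (u : Y -> R),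
  [/\ continuous phi, continuous u & [/\
    forall y, phi (y, 0) = y, forall t, 0 <= t <= 1 -> phi (y0, t) = y0,
    forall y, 0 <= u y <= 1, u y0 = 0 & forall y, u y < 1 -> phi (y, 1) = y0]].

Lemma ususp_phom (Y : topologicalType) (Z : ptopologicalType) (y0 : Y)
    (f g : pointed_at (pole y0) -> Z) (H : Y * R * R -> Z) : continuous H ->
  (forall y (s : R), 0 <= s <= 1 -> H (y, 0, s) = point) ->
  (forall y y' (s : R), 0 <= s <= 1 -> H (y, 1, s) = H (y', 1, s)) ->
  (forall y (t : R), 0 <= t <= 1 -> H (y, t, 0) = f (ususp_pt (y, t))) ->
  (forall y (t : R), 0 <= t <= 1 -> H (y, t, 1) = g (ususp_pt (y, t))) ->
  phom R f g.
Proof.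
move=> cH H0 H1 Hf Hg; have [|K cK KE] := ususp_liftR cH _ H1; first by move=> y y' s s01; rewrite !H0.
apply: (@phomI R (pointed_at (pole y0)) Z f g K cK) => [||t t01].
- by apply: cyl_ind => y t t01; rewrite -Hf // [LHS]KE ?lexx ?ler01.
- by apply: cyl_ind => y t t01; rewrite -Hg // [LHS]KE ?lexx ?ler01.
- by rewrite [LHS]KE ?lexx ?ler01 // H0.
Qed.

(** The reduced suspension collapses the segment over [y0]. Inversely, a point [x] is
    sent to the loop that climbs over [x] and comes down over [y0]; near [y0], where
    this must become constant, it turns around at the height [u x] already. Both
    composites are undone by the homotopy [unwind], which turns the descent over
    [y0] into a pause. *)
Lemma susp_ususp (Y : topologicalType) (y0 : Y) : well_pointed y0 ->
  pequiv R (reduced_susp R (pointed_at y0)) (pointed_at (pole y0)).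
Proof.
move=> [phi [u [cphi cu [phi0 phip u01 up uphi]]]].
pose S := @susp_pt R (pointed_at y0); have cS : continuous S := @cts_susp_pt _ _.
pose U := @ususp_pt Y; have cU : continuous U := @cts_ususp_pt _.
pose r (_ : Y) := y0; have cr : continuous r by exact: cts_cst.
have U1 x (t : R) : 1 <= t -> U (x, t) = U (y0, 1) by move=> ?; apply: ususp_pt1.
have U0 x (t : R) : t <= 0 -> U (x, t) = U (y0, 0) by move=> ?; apply: ususp_pt0.
have rphi x : u x < 1 -> r (phi (x, 1)) = phi (x, 1) by move/uphi => ->.
pose H := unwind U phi r u.
have cH : continuous H by exact: (cts_unwind cU U1).
have H0 x (s : R) : 0 <= s <= 1 -> H (x, 0, s) = U (y0, 0).
  move: s; have /andP[u0 u1] := u01 x.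
  apply: (splice_ind (P := fun z => z = U (y0, 0))) => s s01.
    rewrite there_and_back_half ?invr_ge0 ?ler0n //; apply: U0.
    by rewrite mulr0 ge_min lexx.
  apply: U0 => /=; rewrite mulr0 addr0.
  by apply: mulr_ge0_le0; [lra|exact: detour0].
have H1 x (s : R) : 0 <= s <= 1 -> H (x, 1, s) = U (y0, Num.min 1 (2 * s)).
  move=> s01; have /andP[u0 u1] := u01 x; rewrite /H /unwind /splice /=; case: ifP => s2.
    rewrite /there_and_back /= half_lt1.
    rewrite (_ : 2 - 2 * 1 = 0); last by lra.
    rewrite (_ : 2 * 1 - 1 = 1); last by lra.
    rewrite (min_idPl u0) (max_idPl u1) mulr0 add0r mulr1.
    by rewrite (min_idPr _) //; lra.
  have /negbT := s2; rewrite -ltNge => {}s2.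
  rewrite (min_idPl _); last by lra.
  apply: U1 => /=; rewrite mulr1.
  have : (1 - (2 * s - 1)) * 1 <= (1 - (2 * s - 1)) * detour (u x) 1.
    by apply: ler_wpM2l; [lra|exact: detour1].
  lra.
have Hp (t s : R) : 0 <= t <= 1 -> 0 <= s <= 1 ->
    exists t', H (y0, t, s) = U (y0, t').
  move=> t01; move: s.
  apply: (splice_ind (P := fun z => exists t', z = U (y0, t'))) => s s01.
    rewrite /there_and_back /= phip ?lexx ?ler01 // /r.
    by case: ifP => _; eexists.
  by rewrite /straighten /= phip; [eexists|lra].
have HT x t : H (x, t, 0) = there_and_back U phi r u (x, t, 0) by exact: splice0.
have HU x t : H (x, t, 1) = U (x, t) by apply: unwind1.
have [c cc cE] : exists2 c : ususp Y -> reduced_susp R (pointed_at y0), continuous c &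
    forall y (t : R), c (U (y, t)) = S (y, t).
  have [||c cc cE] := @ususp_lift Y (reduced_susp R (pointed_at y0)) S cS.
  - by move=> y y'; rewrite /S !susp_pt_col //; apply: Or31.
  - by move=> y y'; rewrite /S !susp_pt_col //; apply: Or32.
  exists c => // y t; rewrite /U /ususp_pt -cyl_clamp [LHS]cE ?clamp_ge0 ?clamp_le1 //.
  exact: cyl_clamp.
have cp t : c (U (y0, t)) = point by rewrite cE /S susp_pt_col //; apply: Or33.
have [|y|y|t t01|d pd dE] :=
    @susp_lift R (pointed_at y0) (pointed_at (pole y0)) (fun w => H (w, 0)).
- by cts.
- by rewrite H0 ?lexx ?ler01.
- by rewrite H1 ?lexx ?ler01 // mulr0 (min_idPr ler01).
- rewrite HT /there_and_back /= phip ?lexx ?ler01 // up /r.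
  rewrite subr0 mul1r mul0r addr0; case: ifP => _; apply: U0;
  by rewrite ge_min lexx orbT.
exists d, c; split=> //; first by split; [exact: cc|exact: cp].
- apply: (@susp_phom R (pointed_at y0) (reduced_susp R (pointed_at y0)) _ _ (fun w => c (H w))).
  + by cts.
  + by move=> y s s01; rewrite H0 // cp.
  + by move=> y s s01; rewrite H1 // cp.
  + by move=> t s t01 s01; have [t' ->] := Hp t s t01 s01; rewrite cp.
  + by move=> y t t01; rewrite dE.
  + by move=> y t t01; rewrite HU cE.
- apply: (@ususp_phom Y (pointed_at (pole y0)) y0 _ _ H cH).
  + by move=> y s s01; rewrite H0.
  + by move=> y y' s s01; rewrite !H1.
  + by move=> y t t01; rewrite cE dE.
  + by move=> y t t01; rewrite HU.
Qed.

End unreduced.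

(** * Suspensions of neighbourhood retracts split *)

Section sums.
Context (R : realType) (X Z : ptopologicalType).
Implicit Types a b c : reduced_susp R X -> Z.

(** The sum of two maps for the co-H structure of a suspension: [a] on the lower half
    and [b] on the upper half. *)
Definition is_sum a b c := forall x (t : R), 0 <= t <= 1 ->
  c (susp_pt (x, t)) = if t <= 2^-1 then a (susp_pt (x, 2 * t))
                       else b (susp_pt (x, 2 * t - 1)).

Lemma sum_exists a b : ptmap a -> ptmap b -> exists2 c, ptmap c & is_sum a b c.
Proof.
move=> [ca ap] [cb bp]; have cS := @cts_susp_pt R X.
pose f (w : X * R) := if w.2 <= 2^-1 then a (susp_pt (w.1, 2 * w.2))
                      else b (susp_pt (w.1, 2 * w.2 - 1)).
have [|x|x|t t01|c pc cE] := @susp_lift R X Z f.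
- apply: cts_if; [by cts|by cts|by cts|move=> [x t] /= ->].
  by rewrite mulfV ?pnatr_eq0 // subrr susp_pt1 // susp_pt0 // ap bp.
- by rewrite /f /= invr_ge0 ler0n mulr0 susp_pt0.
- by rewrite /f /= half_lt1 susp_pt1 //; lra.
- by rewrite /f /= !susp_ptp ap bp if_same.
by exists c.
Qed.

Lemma phom_sum a b c a' b' c' : is_sum a b c -> is_sum a' b' c' ->
  phom R a a' -> phom R b b' -> phom R c c'.
Proof.
move=> cE cE' [H cH [H0 H1 Hp]] [K cK [K0 K1 Kp]]; have cS := @cts_susp_pt R X.
apply: (@susp_phom _ _ _ _ _ (fun w => if w.1.2 <= 2^-1
  then H (susp_pt (w.1.1, 2 * w.1.2), w.2)
  else K (susp_pt (w.1.1, 2 * w.1.2 - 1), w.2))).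
- apply: cts_if; [by cts|by cts|by cts|move=> [[x t] s] /= ->].
  by rewrite mulfV ?pnatr_eq0 // subrr susp_pt1 // susp_pt0 // Hp Kp.
- by move=> x s _; rewrite /= invr_ge0 ler0n mulr0 susp_pt0.
- by move=> x s _; rewrite /= half_lt1 susp_pt1 //; lra.
- by move=> t s _ _ /=; rewrite !susp_ptp Hp Kp if_same.
- by move=> x t t01; rewrite cE //= H0 K0.
- by move=> x t t01; rewrite cE' //= H1 K1.
Qed.

End sums.

Section splitting.
Context (R : realType) (X A Q : ptopologicalType).
Context (i : A -> X) (rr : X -> A) (q : X -> Q) (phi : X * R -> X) (u : X -> R).
Hypothesis pi : ptmap i.
Hypothesis pr : ptmap rr.
Hypothesis ri : forall a, rr (i a) = a.
Hypothesis quotq : quot_map q.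
Hypothesis qi : forall a, q (i a) = point.
Hypothesis qE : forall x x', q x = q x' ->
  x = x' \/ (i (rr x) = x /\ i (rr x') = x').
Hypothesis cphi : continuous phi.
Hypothesis phi0 : forall x, phi (x, 0) = x.
Hypothesis phip : forall t : R, 0 <= t <= 1 -> phi (point, t) = point.
Hypothesis phiA : forall x (t : R), 0 <= t <= 1 -> i (rr x) = x ->
  i (rr (phi (x, t))) = phi (x, t).
Hypothesis cu : continuous u.
Hypothesis u01 : forall x, 0 <= u x <= 1.
Hypothesis ui : forall a, u (i a) = 0.
Hypothesis uphi : forall x, u x < 1 -> i (rr (phi (x, 1))) = phi (x, 1).

Let S (p : X * R) : reduced_susp R X := susp_pt p.
Let cS : continuous S. Proof. exact: cts_susp_pt. Qed.
Let SQ (p : Q * R) : reduced_susp R Q := susp_pt p.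
Let cSQ : continuous SQ. Proof. exact: cts_susp_pt. Qed.
Let SA (p : A * R) : reduced_susp R A := susp_pt p.
Let cSA : continuous SA. Proof. exact: cts_susp_pt. Qed.
Let ci : continuous i := pi.1.
Let ip : i point = point := pi.2.
Let crr : continuous rr := pr.1.
Let rp : rr point = point := pr.2.
Let cq : continuous q. Proof. by case: quotq. Qed.

Let qp : q point = point. Proof. by rewrite -ip qi. Qed.
Let pq : ptmap q. Proof. by split. Qed.

Let SA0 a (t : R) : t <= 0 -> SA (a, t) = point.
Proof. exact: susp_pt0. Qed.
Let SA1 a (t : R) : 1 <= t -> SA (a, t) = point.
Proof. exact: susp_pt1. Qed.
Let S0 x (t : R) : t <= 0 -> S (x, t) = point.
Proof. exact: susp_pt0. Qed.
Let S1 x (t : R) : 1 <= t -> S (x, t) = point.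
Proof. exact: susp_pt1. Qed.
Let Sp (t : R) : S (point, t) = point.
Proof. exact: susp_ptp. Qed.
Let SQ0 x (t : R) : t <= 0 -> SQ (x, t) = point.
Proof. exact: susp_pt0. Qed.
Let SQ1 x (t : R) : 1 <= t -> SQ (x, t) = point.
Proof. exact: susp_pt1. Qed.
Let SQp (t : R) : SQ (point, t) = point.
Proof. exact: susp_ptp. Qed.

(** Maps out of the suspension of the quotient [Q] are maps out of the cylinder over
    [X] that are trivial over the image of [i]. *)
Lemma susp_quot_liftR (Z : ptopologicalType) (f : X * R * R -> Z) :
  continuous f ->
  (forall x (s : R), 0 <= s <= 1 -> f (x, 0, s) = point) ->
  (forall x (s : R), 0 <= s <= 1 -> f (x, 1, s) = point) ->
  (forall x (t s : R), 0 <= t <= 1 -> 0 <= s <= 1 -> i (rr x) = x ->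
     f (x, t, s) = point) ->
  exists2 g : reduced_susp R Q * R -> Z, continuous g &
    (forall x (t s : R), 0 <= t <= 1 -> 0 <= s <= 1 ->
       g (SQ (q x, t), s) = f (x, t, s)) /\ forall s, g (point, s) = point.
Proof.
move=> cf f0 f1 fA.
pose f' (w : X * R * R) := f (w.1.1, clamp w.1.2, clamp w.2).
have c01 (s : R) : 0 <= clamp s <= 1 by rewrite clamp_ge0 clamp_le1.
have [||g cg gE] := quot_lift (f := f') (quot_mapR R (quot_mapR R quotq)).
- apply: (cts_comp cf); apply: cts_pair; last by apply: cts_clamp; cts.
  by apply: cts_pair; [cts|apply: cts_clamp; cts].
- move=> [[x t] s] [[x' t'] s'] /= [/qE h <- <-].
  by rewrite /f' /=; case: h => [->//|[xA xA']]; rewrite !fA.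
have gE' x (t s : R) : g (q x, t, s) = f (x, clamp t, clamp s) by rewrite (gE (x, t, s)).
have [_ sq _] := quotq.
have [|||G cG [GE Gp]] := @susp_liftR R Q Z g cg.
- by move=> y s s01; have [x <-] := sq y; rewrite gE' clamp0 f0.
- by move=> y s s01; have [x <-] := sq y; rewrite gE' clamp1 f1.
- by move=> t s t01 s01; rewrite -qp gE' fA // rp ip.
by exists G => //; split=> // x t s t01 s01; rewrite GE // gE' !clamp_id.
Qed.

Lemma susp_quot_phom (Z : ptopologicalType) (f g : reduced_susp R Q -> Z)
    (H : X * R * R -> Z) : continuous H ->
  (forall x (s : R), 0 <= s <= 1 -> H (x, 0, s) = point) ->
  (forall x (s : R), 0 <= s <= 1 -> H (x, 1, s) = point) ->
  (forall x (t s : R), 0 <= t <= 1 -> 0 <= s <= 1 -> i (rr x) = x ->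
     H (x, t, s) = point) ->
  (forall x (t : R), 0 <= t <= 1 -> H (x, t, 0) = f (SQ (q x, t))) ->
  (forall x (t : R), 0 <= t <= 1 -> H (x, t, 1) = g (SQ (q x, t))) ->
  phom R f g.
Proof.
move=> cH H0 H1 HA Hf Hg; have [K cK [KE Kp]] := susp_quot_liftR cH H0 H1 HA.
have [_ sq _] := quotq.
exists K => //; split=> //; apply: susp_ind => y t t01; have [x <-] := sq y.
  by rewrite [LHS]KE ?lexx ?ler01 // Hf.
by rewrite [LHS]KE ?lexx ?ler01 // Hg.
Qed.

Let r x := i (rr x).
Let cr : continuous r. Proof. by rewrite /r; cts. Qed.
Let T := there_and_back S phi r u.
Let cT : continuous T. Proof. exact: (cts_there_and_back cS S1). Qed.

Let T0 x s : T (x, 0, s) = point.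
Proof.
rewrite /T there_and_back_half ?invr_ge0 ?ler0n //; apply: S0.
by rewrite mulr0 ge_min lexx.
Qed.

Let T1 x s : T (x, 1, s) = S (r (phi (x, 1)), s).
Proof.
have /andP[u0 u1] := u01 x; rewrite /T /there_and_back /= half_lt1.
rewrite (_ : 2 - 2 * 1 = 0); last by lra.
rewrite (_ : 2 * 1 - 1 = 1); last by lra.
by rewrite (min_idPl u0) (max_idPl u1) mulr0 add0r mulr1.
Qed.

Let rpoint : r point = point. Proof. by rewrite /r rp ip. Qed.
Let phi1p : phi (point, 1) = point. Proof. by rewrite phip ?lexx ?ler01. Qed.

Let Tp t s : T (point, t, s) = point.
Proof. by rewrite /T /there_and_back /= phi1p rpoint !Sp if_same. Qed.

(** The section of the collapse up to homotopy: the identity of the suspension of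
    [X] minus the retraction. The strict difference would be a path followed by its
    inverse over the image of [i]; [there_and_back] makes it constant there. *)
Lemma back_exists : exists2 g : reduced_susp R Q -> reduced_susp R X, ptmap g &
  forall x (t : R), 0 <= t <= 1 -> g (SQ (q x, t)) = T (x, t, 0).
Proof.
have [|x s _|x s _|x t s t01 _ xA|g cg [gE gp]] :=
  @susp_quot_liftR (reduced_susp R X) (fun w => T (w.1, 0)).
- by cts.
- exact: T0.
- by rewrite T1 S0.
- rewrite /T /there_and_back /= -xA ui subr0 mul1r mul0r addr0.
  by rewrite !S0 ?if_same // ge_min lexx orbT.
exists (fun z => g (z, 0)); first by split; [cts|exact: gp].
by move=> x t t01; rewrite gE ?lexx ?ler01.
Qed.

(** Adding the retraction to the difference of the identity and the retraction gives
    back the identity: the descent of [there_and_back] cancels against the ascent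
    of the second summand. *)
Lemma suspension_split_id
    (g : reduced_susp R Q -> reduced_susp R X)
    (Fi : reduced_susp R A -> reduced_susp R X)
    (Fr : reduced_susp R X -> reduced_susp R A)
    (Fq : reduced_susp R X -> reduced_susp R Q)
    (K : reduced_susp R X -> reduced_susp R X) :
  (forall x (t : R), 0 <= t <= 1 -> g (SQ (q x, t)) = T (x, t, 0)) ->
  (forall a (t : R), Fi (SA (a, t)) = S (i a, t)) ->
  (forall x (t : R), Fr (S (x, t)) = SA (rr x, t)) ->
  (forall x (t : R), Fq (S (x, t)) = SQ (q x, t)) ->
  is_sum (fun z => g (Fq z)) (fun z => Fi (Fr z)) K ->
  phom R K id.
Proof.
move=> gE FiE FrE FqE KE.
(* [m] first thickens the second summand, then [l] raises the turning point *)
pose l (s : R) := Num.max 0 (2 * s - 1); pose m (s : R) := Num.min 1 (2 * s).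
pose HA (w : X * R * R) : reduced_susp R X :=
  if w.1.2 <= 2^-1 then T (w.1.1, 2 * w.1.2, l w.2)
  else S (r (phi (w.1.1, m w.2)), l w.2 + (1 - l w.2) * (2 * w.1.2 - 1)).
pose HB (w : X * R * R) : reduced_susp R X :=
  S (phi (w.1.1, 1 - w.2), (1 - w.2) * detour (u w.1.1) (2 * w.1.2) + w.2 * w.1.2).
have cHA : continuous HA.
  rewrite /HA /l /m; apply: cts_if; [by cts|by cts|by cts|move=> [[x t] s] /= ->].
  rewrite mulfV ?pnatr_eq0 // subrr mulr0 addr0 T1.
  have [s2|s2] := leP (2 * s - 1) 0.
    by rewrite !S0.
  by rewrite (min_idPl _) //; lra.
have cHB : continuous HB by rewrite /HB /detour; cts.
have l0 : l 0 = 0 by apply/max_idPl; lra.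
have m0 : m 0 = 0 by rewrite /m mulr0; apply/min_idPr.
have l1 : l 1 = 1 by rewrite /l (max_idPr _); lra.
have m1 : m 1 = 1 by rewrite /m (min_idPl _); lra.
have AB w : HA (w, 1) = HB (w, 0).
  case: w => x t; rewrite /HA /HB /= l1 m1 subrr mul0r addr0 subr0 mul1r mul0r addr0.
  have -> : S (phi (x, 1), detour (u x) (2 * t)) = T (x, 2 * t, 1).
    by rewrite /T (there_and_back1 S1).
  case: ifPn => //; rewrite -ltNge => t2; rewrite S1 //.
  by rewrite /T (there_and_back1 S1) // S1 // detour1 //; lra.
apply: (@susp_phom R X (reduced_susp R X) K id (splice HA HB)).
- exact: cts_splice.
- move=> x; apply: (splice_ind (P := fun z => z = point)) => s s01.
    by rewrite /HA /= invr_ge0 ler0n mulr0 T0.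
  rewrite /HB /= S0 // !mulr0 addr0; apply: mulr_ge0_le0; first by lra.
  by apply: detour0 => //; case/andP: (u01 x).
- move=> x; apply: (splice_ind (P := fun z => z = point)) => s s01.
    by rewrite /HA /= half_lt1 S1 // (_ : 2 * 1 - 1 = 1); lra.
  rewrite /HB /= S1 // !mulr1.
  have : (1 - s) * 1 <= (1 - s) * detour (u x) 2.
    by apply: ler_wpM2l; [lra|apply: detour1; lra].
  lra.
- move=> t s t01; move: s; apply: (splice_ind (P := fun z => z = point)) => s s01.
    rewrite /HA /= Tp phip; first by rewrite rpoint Sp if_same.
    by rewrite /m le_min ge_min lexx; apply/andP; split; lra.
  by rewrite /HB /= phip ?Sp //; lra.
- move=> x t t01; rewrite splice0 KE // FqE FrE FiE /HA /= l0 m0 phi0 add0r subr0 mul1r.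
  by case: ifP => // t2; rewrite gE //; lra.
- by move=> x t t01; rewrite splice1 /HB /= subrr phi0 mul0r add0r mul1r.
Qed.

(** On the difference of the identity and the retraction, the sum of [hQ] and [hA] is
    [hQ] followed by a path and its inverse in the summand [hA]. The homotopy [HC]
    lowers the top of the latter, over the points near the image of [i] as well. *)
Lemma suspension_split_quot (Z : ptopologicalType) (hA : reduced_susp R A -> Z)
    (hQ : reduced_susp R Q -> Z)
    (g : reduced_susp R Q -> reduced_susp R X)
    (Fr : reduced_susp R X -> reduced_susp R A)
    (Fq : reduced_susp R X -> reduced_susp R Q)
    (k : reduced_susp R X -> Z) : ptmap hA -> ptmap hQ -> ptmap k ->
  (forall x (t : R), 0 <= t <= 1 -> g (SQ (q x, t)) = T (x, t, 0)) ->
  (forall x (t : R), Fr (S (x, t)) = SA (rr x, t)) ->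
  (forall x (t : R), Fq (S (x, t)) = SQ (q x, t)) ->
  is_sum (fun z => hQ (Fq z)) (fun z => hA (Fr z)) k ->
  phom R (fun z => k (g z)) hQ.
Proof.
move=> [cA Ap] [cQ Qp] [ck kp] gE FrE FqE kE.
pose hk (w : X * R * R) := if w.1.2 <= 2^-1 then hQ (SQ (q w.1.1, 2 * w.1.2))
  else hA (SA (rr w.1.1, Num.min (2 * w.1.2 - 1) (1 - w.2))).
have chk : continuous hk.
  apply: cts_if; [by cts|by cts|by cts|move=> [[x t] s] /= ->].
  rewrite mulfV ?pnatr_eq0 // subrr SQ1 // SA0 ?Ap ?Qp //.
  by rewrite ge_min lexx.
have hk_le0 x (t s : R) : t <= 0 -> hk (x, t, s) = point.
  move=> t0; rewrite /hk /= ifT; last by lra.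
  by rewrite SQ0 ?Qp //; lra.
have khk x (t : R) : k (S (x, t)) = hk (x, t, 0).
  have [t0|t0] := leP t 0; first by rewrite S0 // hk_le0.
  have [t1|t1] := leP 1 t.
    rewrite S1 // kp /hk /= ifF; last by apply/negbTE; rewrite -ltNge; lra.
    by rewrite SA1 ?Ap // le_min subr0 lexx andbT; lra.
  rewrite kE; last by lra.
  rewrite FqE FrE /hk /=; case: ifP => // _.
  by rewrite (min_idPl _) //; lra.
pose HC (w : X * R * R) :=
  if w.1.2 <= 2^-1 then hk (phi (w.1.1, 1), Num.min (2 * w.1.2) (u w.1.1), w.2)
  else hk (r (phi (w.1.1, 1)), Num.min (2 - 2 * w.1.2) (u w.1.1), w.2).
pose HD (w : X * R * R) := hQ (SQ (q (phi (w.1.1, 1 - w.2)), (4 - 3 * w.2) * w.1.2)).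
have cHC : continuous HC.
  apply: cts_if; [by cts|by cts|by cts|move=> [[x t] s] /= ->].
  have -> : 2 * 2^-1 = 1 :> R by rewrite mulfV ?pnatr_eq0.
  rewrite (_ : 2 - 1 = 1 :> R); last by lra.
  have /andP[u0 u1] := u01 x; rewrite (min_idPr u1).
  have [ux|ux] := ltP (u x) 1; first by rewrite /r uphi.
  have -> : u x = 1 by apply: le_anti; rewrite u1.
  by rewrite /hk /= half_lt1 /r ri.
have cHD : continuous HD by rewrite /HD; cts.
have qr x : q (r x) = point by rewrite /r qi.
have CD w : HC (w, 1) = HD (w, 0).
  case: w => x t; rewrite /HC /HD /= subr0 mulr0 subr0.
  have hk1 y (s : R) : hk (y, s, 1) = if s <= 2^-1 then hQ (SQ (q y, 2 * s)) else point.
    by rewrite /hk /= SA0 ?Ap // ge_min subrr lexx orbT.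
  rewrite !hk1 qr SQp Qp if_same; case: ifPn => t2; last first.
    by rewrite SQ1 ?Qp //; rewrite -ltNge in t2; lra.
  have [ux|ux] := ltP (u x) 1.
    have -> : q (phi (x, 1)) = point by rewrite -uphi // qi.
    by rewrite !SQp Qp if_same.
  rewrite (min_idPl _); last by lra.
  case: ifPn => t4; first by congr (hQ (SQ (_, _))); lra.
  by rewrite SQ1 ?Qp //; rewrite -ltNge in t4; lra.
have qA x : i (rr x) = x -> q x = point by move=> <-; rewrite qi.
apply: (@susp_quot_phom _ _ _ (splice HC HD)).
- exact: cts_splice.
- move=> x; apply: (splice_ind (P := fun z => z = point)) => s s01.
    by rewrite /HC /= invr_ge0 ler0n mulr0 hk_le0 // ge_min lexx.
  by rewrite /HD /= mulr0 SQ0.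
- move=> x; apply: (splice_ind (P := fun z => z = point)) => s s01.
    rewrite /HC /= half_lt1 hk_le0 // ge_min; apply/orP; left; lra.
  by rewrite /HD /= SQ1 //; lra.
- move=> x t s t01; move: s => + + xA.
  apply: (splice_ind (P := fun z => z = point)) => s s01.
    have ux : u x = 0 by rewrite -xA ui.
    by rewrite /HC /= ux !hk_le0 ?if_same // ge_min lexx orbT.
  rewrite /HD /= qA ?SQp // phiA //; lra.
- move=> x t t01; rewrite splice0 gE // /HC /T /there_and_back /=.
  by case: ifP => _; rewrite khk // subr0 mul1r mul0r addr0.
- move=> x t t01; rewrite splice1 /HD /= subrr phi0.
  by congr (hQ (SQ (_, _))); lra.
Qed.

Lemma suspension_split_sub (Z : ptopologicalType) (hA : reduced_susp R A -> Z)
    (hQ : reduced_susp R Q -> Z)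
    (Fi : reduced_susp R A -> reduced_susp R X)
    (Fr : reduced_susp R X -> reduced_susp R A)
    (Fq : reduced_susp R X -> reduced_susp R Q)
    (k : reduced_susp R X -> Z) : ptmap hA -> ptmap hQ ->
  (forall a (t : R), Fi (SA (a, t)) = S (i a, t)) ->
  (forall x (t : R), Fr (S (x, t)) = SA (rr x, t)) ->
  (forall x (t : R), Fq (S (x, t)) = SQ (q x, t)) ->
  is_sum (fun z => hQ (Fq z)) (fun z => hA (Fr z)) k ->
  phom R (fun z => k (Fi z)) hA.
Proof.
move=> [cA Ap] [cQ Qp] FiE FrE FqE kE.
apply: (@susp_phom _ _ _ _ _
  (fun w => hA (SA (w.1.1, (2 - w.2) * w.1.2 - (1 - w.2))))).
- by cts.
- by move=> a s s01; rewrite SA0 //=; lra.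
- by move=> a s s01; rewrite SA1 //=; lra.
- by move=> t s _ _; rewrite /SA /= susp_ptp.
- move=> a t t01 /=; rewrite FiE kE // FqE FrE qi SQp Qp ri !subr0.
  by case: ifP => // t2; rewrite SA0 ?Ap //; lra.
- by move=> a t t01 /=; congr (hA (SA (_, _))); lra.
Qed.

(** After one suspension, a well-behaved retract splits off, with the quotient as
    the complement. *)
Theorem suspension_split :
  exists (i1 : reduced_susp R A -> reduced_susp R X)
         (i2 : reduced_susp R Q -> reduced_susp R X), hsum R i1 i2.
Proof.
have [Fi pFi FiE] := susp_map R pi; have [Fr pFr FrE] := susp_map R pr.
have [Fq pFq FqE] := susp_map R pq; have [g pg gE] := back_exists.
exists Fi, g; split=> // [Z hA hQ pA pQ|Z k k' pk pk' kA kQ].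
- have [k pk kE] := sum_exists (ptmap_comp pFq pQ) (ptmap_comp pFr pA).
  exists k => //; split.
    exact: (suspension_split_sub pA pQ FiE FrE FqE kE).
  exact: (suspension_split_quot pA pQ pk gE FrE FqE kE).
have [K pK KE] := sum_exists (ptmap_comp pFq pg) (ptmap_comp pFr pFi).
have Kid := suspension_split_id gE FiE FrE FqE KE.
have kK (l : reduced_susp R X -> Z) : ptmap l -> phom R (fun z => l (K z)) l.
  by move=> pl; exact: (phom_comp (ptmap_id _) pl Kid).
apply: phom_trans (phom_sym (kK k pk)) _.
refine (phom_trans _ (kK k' pk')).
have sumK (l : reduced_susp R X -> Z) : is_sum (fun z => l (g (Fq z))) (fun z => l (Fi (Fr z))) (fun z => l (K z)).
  by move=> x t t01; rewrite KE //; case: ifP.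
apply: (phom_sum (sumK k) (sumK k')).
- exact: (phom_comp pFq (ptmap_id _) kQ).
- exact: (phom_comp pFr (ptmap_id _) kA).
Qed.

End splitting.

(** * Coordinates on the circle *)

Section circle_coordinates.
Context (R : realType).
Local Open Scope complex_scope.

Lemma cts_Re (W : topologicalType) (f : W -> R[i]^o) :
  continuous f -> continuous (fun w => complex.Re (f w) : R).
Proof.
move=> cf w; apply/cvgrPdist_lt => e e0.
have e0' : 0 < e%:C :> R[i] by rewrite (ltcR 0 e).
have /cvgrPdist_lt/(_ _ e0') := cf w; apply: filterS => v /=.
rewrite normc_def ltcR; apply: le_lt_trans.
rewrite -sqrtr_sqr; apply: ler_wsqrtr.
by case: (f w) => a b; case: (f v) => a' b' /=; rewrite lerDl sqr_ge0.
Qed.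

Lemma cts_Im (W : topologicalType) (f : W -> R[i]^o) :
  continuous f -> continuous (fun w => complex.Im (f w) : R).
Proof.
move=> cf w; apply/cvgrPdist_lt => e e0.
have e0' : 0 < e%:C :> R[i] by rewrite (ltcR 0 e).
have /cvgrPdist_lt/(_ _ e0') := cf w; apply: filterS => v /=.
rewrite normc_def ltcR; apply: le_lt_trans.
rewrite -sqrtr_sqr; apply: ler_wsqrtr.
by case: (f w) => a b; case: (f v) => a' b' /=; rewrite lerDr sqr_ge0.
Qed.

Lemma cts_complex (W : topologicalType) (a b : W -> R) :
  continuous a -> continuous b -> continuous (fun w => a w +i* b w : R[i]^o).
Proof.
move=> ca cb w; apply/cvgrPdist_lt => e; rewrite ltcE /= => /andP[/eqP e2 e1].
have h0 : 0 < complex.Re e / 2 by rewrite divr_gt0.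
have /cvgrPdist_lt/(_ _ h0) A := ca w; have /cvgrPdist_lt/(_ _ h0) B := cb w.
apply: filterS2 A B => v /= A B.
rewrite normc_def ltcE /= e2 eqxx /=.
apply: le_lt_trans (_ : `|a w - a v| + `|b w - b v| < _); last by lra.
rewrite -[leRHS]ger0_norm ?addr_ge0 // -sqrtr_sqr; apply: ler_wsqrtr.
rewrite [leRHS]sqrrD !real_normK ?num_real // addrAC lerDl.
by rewrite mulrn_wge0 // mulr_ge0.
Qed.

Definition cRe (z : circle R) : R := complex.Re (\val z : R[i]).
Definition cIm (z : circle R) : R := complex.Im (\val z : R[i]).

Lemma cts_cRe (W : topologicalType) (f : W -> circle R) :
  continuous f -> continuous (fun w => cRe (f w)).
Proof. by move=> cf; apply: cts_Re; apply: cts_val. Qed.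

Lemma cts_cIm (W : topologicalType) (f : W -> circle R) :
  continuous f -> continuous (fun w => cIm (f w)).
Proof. by move=> cf; apply: cts_Im; apply: cts_val. Qed.

Lemma circle_norm (z : circle R) : `|\val z : R[i]| = 1.
Proof. by have := valP z; rewrite inE. Qed.

Lemma circle_neq0 (z : circle R) : (\val z : R[i]) != 0.
Proof. by rewrite -normr_eq0 circle_norm oner_eq0. Qed.

Lemma cReIm (z : circle R) : cRe z ^+ 2 + cIm z ^+ 2 = 1.
Proof. by apply: (@complexI R); rewrite add_Re2_Im2 circle_norm expr1n. Qed.

Lemma circle_ext (z w : circle R) : cRe z = cRe w -> cIm z = cIm w -> z = w.
Proof.
move=> hr hi; apply: val_inj; move: hr hi; rewrite /cRe /cIm.
by case: (\val z : R[i]) (\val w : R[i]) => a b [c d] /= -> ->.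
Qed.

Lemma mkcircleP (z : R[i]) : `|z| = 1 -> (z : R[i]^o) \in [set z : R[i]^o | `|z| = 1].
Proof. by move=> h; apply/mem_set. Qed.

Definition mkcircle (z : R[i]) (h : `|z| = 1) : circle R := SigSub (mkcircleP h).

Definition circ1 : circle R := mkcircle (normr1 _).

Lemma circ_subproof (a b : R) : 0 < a ^+ 2 + b ^+ 2 ->
  `|a / Num.sqrt (a ^+ 2 + b ^+ 2) +i* (b / Num.sqrt (a ^+ 2 + b ^+ 2))| = 1.
Proof.
move=> ab; rewrite normc_def /= !exprMn -mulrDl exprVn sqr_sqrtr ?(ltW ab) //.
by rewrite mulfV ?lt0r_neq0 // sqrtr1.
Qed.

Definition circ (a b : R) : circle R :=
  if pselect (0 < a ^+ 2 + b ^+ 2) is left h then mkcircle (circ_subproof h)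
  else circ1.

Lemma cRe_circ a b : 0 < a ^+ 2 + b ^+ 2 ->
  cRe (circ a b) = a / Num.sqrt (a ^+ 2 + b ^+ 2).
Proof. by rewrite /circ; case: pselect. Qed.

Lemma cIm_circ a b : 0 < a ^+ 2 + b ^+ 2 ->
  cIm (circ a b) = b / Num.sqrt (a ^+ 2 + b ^+ 2).
Proof. by rewrite /circ; case: pselect. Qed.

Lemma circK z : circ (cRe z) (cIm z) = z.
Proof.
apply: circle_ext; rewrite ?cRe_circ ?cIm_circ cReIm ?ltr01 ?sqrtr1 ?divr1 //.
Qed.

Lemma cts_circ (W : topologicalType) (a b : W -> R) : continuous a -> continuous b ->
  (forall w, 0 < a w ^+ 2 + b w ^+ 2) -> continuous (fun w => circ (a w) (b w)).
Proof.
move=> ca cb ab; apply: cts_sub.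
have -> : (fun w => \val (circ (a w) (b w))) = (fun w =>
    a w / Num.sqrt (a w * a w + b w * b w) +i*
    (b w / Num.sqrt (a w * a w + b w * b w)) : R[i]^o).
  apply/funext => w; rewrite -!expr2 /circ.
  by case: pselect => // h; case: h; exact: ab.
by apply: cts_complex; apply: cts_mul => //; apply: cts_inv; 
  try (by apply: cts_sqrt; cts); move=> w; rewrite -!expr2 sqrtr_eq0 -ltNge ab.
Qed.

(** The cosine of the angle between two points. *)
Definition cdot (z0 z : circle R) : R := cRe z0 * cRe z + cIm z0 * cIm z.

Lemma cdotxx z : cdot z z = 1.
Proof. by rewrite /cdot -!expr2 cReIm. Qed.

Lemma cdot_le1 z0 z : cdot z0 z <= 1.
Proof.
have := cReIm z0; have := cReIm z; rewrite /cdot => h h0.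
have := sqr_ge0 (cRe z0 - cRe z); have := sqr_ge0 (cIm z0 - cIm z).
rewrite !sqrrB; lra.
Qed.

Lemma cts_cdot (W : topologicalType) z0 (f : W -> circle R) :
  continuous f -> continuous (fun w => cdot z0 (f w)).
Proof.
move=> cf; apply: cts_add; apply: cts_mul; try exact: cts_cst.
  exact: cts_cRe.
exact: cts_cIm.
Qed.

(** A straight-line push towards [z0], projected back to the circle. It leaves the
    points at an angle of at least 90 degrees alone, hence avoids the centre. *)
Definition cpush_weight z0 (w : circle R * R) := clamp w.2 * clamp (2 * cdot z0 w.1).

Definition cpush z0 (w : circle R * R) : circle R :=
  let l := cpush_weight z0 w in
  circ ((1 - l) * cRe w.1 + l * cRe z0) ((1 - l) * cIm w.1 + l * cIm z0).

Lemma cpush_gt0 z0 w (l := cpush_weight z0 w) :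
  0 < ((1 - l) * cRe w.1 + l * cRe z0) ^+ 2 + ((1 - l) * cIm w.1 + l * cIm z0) ^+ 2.
Proof.
have E k : ((1 - k) * cRe w.1 + k * cRe z0) ^+ 2 + ((1 - k) * cIm w.1 + k * cIm z0) ^+ 2
    = (1 - k) ^+ 2 + k ^+ 2 + 2 * k * (1 - k) * cdot z0 w.1.
  transitivity ((1 - k) ^+ 2 * (cRe w.1 ^+ 2 + cIm w.1 ^+ 2) +
    k ^+ 2 * (cRe z0 ^+ 2 + cIm z0 ^+ 2) + 2 * k * (1 - k) * cdot z0 w.1).
    by rewrite /cdot; ring.
  by rewrite !cReIm !mulr1.
rewrite E.
have [c0|c0] := leP (cdot z0 w.1) 0.
  have -> : l = 0 by rewrite /l /cpush_weight (clamp_le0 (_ : 2 * _ <= 0)) ?mulr0 //; lra.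
  by rewrite subr0 expr1n expr0n mulr0 !mul0r !addr0 ltr01.
have l0 : 0 <= l by rewrite mulr_ge0 // clamp_ge0.
have l1 : l <= 1.
  by rewrite -[leRHS](mulr1 1) ler_pM ?clamp_ge0 ?clamp_le1.
move: (l) l0 l1 => k k0 k1.
have p : 0 <= 2 * k * (1 - k) * cdot z0 w.1.
  by rewrite !mulr_ge0 ?subr_ge0 // ltW.
have := sqr_ge0 (1 - 2 * k); nra.
Qed.

Lemma cts_cpush z0 : continuous (cpush z0).
Proof.
have cl : continuous (cpush_weight z0).
  rewrite /cpush_weight; apply: cts_mul; apply: cts_clamp; first by cts.
  by apply: cts_mul; [cts|apply: cts_cdot; cts].
have c1 : continuous (fun w : circle R * R => cRe w.1) by apply: cts_cRe; cts.
have c2 : continuous (fun w : circle R * R => cIm w.1) by apply: cts_cIm; cts.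
by apply: cts_circ; [cts|cts|exact: cpush_gt0].
Qed.

Lemma cpush0 z0 z : cpush z0 (z, 0) = z.
Proof. by rewrite /cpush /cpush_weight /= clamp0 mul0r subr0 !mul1r !mul0r !addr0 circK. Qed.

Lemma cpushz z0 t : cpush z0 (z0, t) = z0.
Proof. by rewrite /cpush /= -!mulrDl subrK !mul1r circK. Qed.

Lemma cpush1 z0 z : 1 <= 2 * cdot z0 z -> cpush z0 (z, 1) = z0.
Proof.
move=> h; rewrite /cpush /cpush_weight /= clamp1 (clamp_ge1 h) mulr1 subrr !mul0r.
by rewrite !add0r !mul1r circK.
Qed.

Definition cosine (t : R) : R := Num.max (-1) (Num.min 1 t).

Lemma cosine_itv t : -1 <= cosine t <= 1.
Proof. by rewrite /cosine le_max lexx /= ge_max ge_min lexx andbT; lra. Qed.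

Lemma cosine_id t : -1 <= t <= 1 -> cosine t = t.
Proof. by case/andP=> h h'; rewrite /cosine (min_idPr h') (max_idPr h). Qed.

Lemma sqrt_sine_ge0 t : 0 <= 1 - cosine t ^+ 2.
Proof. have := cosine_itv t; nra. Qed.

(** The circle as [0, 1] with its ends identified, parametrised at constant speed of
    the real part, so that its inverse [angle] is given by the real part and the sign
    of the imaginary part. *)
Definition loop (t : R) : circle R :=
  if t <= 2^-1 then circ (cosine (1 - 4 * t)) (Num.sqrt (1 - cosine (1 - 4 * t) ^+ 2))
  else circ (cosine (4 * t - 3)) (- Num.sqrt (1 - cosine (4 * t - 3) ^+ 2)).

Lemma circ_sine_norm t : cosine t ^+ 2 + Num.sqrt (1 - cosine t ^+ 2) ^+ 2 = 1.
Proof. by rewrite sqr_sqrtr ?sqrt_sine_ge0 // addrC subrK. Qed.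

Lemma cts_cosine (W : topologicalType) (f : W -> R) :
  continuous f -> continuous (fun w => cosine (f w)).
Proof. by move=> cf; rewrite /cosine; cts. Qed.

Lemma cts_loop : continuous loop.
Proof.
have c1 : continuous (fun t : R => cosine (1 - 4 * t)) by apply: cts_cosine; cts.
have c2 : continuous (fun t : R => cosine (4 * t - 3)) by apply: cts_cosine; cts.
apply: cts_if.
- by cts.
- apply: cts_circ => [|w|w]; first by cts.
    by apply: cts_sqrt; rewrite /GRing.exp /=; cts.
  by rewrite circ_sine_norm ltr01.
- apply: cts_circ => [|w|w]; first by cts.
    by apply: cts_opp; apply: cts_sqrt; rewrite /GRing.exp /=; cts.
  by rewrite sqrrN circ_sine_norm ltr01.
- move=> t ->; rewrite (_ : 1 - 4 * 2^-1 = -1); last by lra.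
  rewrite (_ : 4 * 2^-1 - 3 = -1); last by lra.
  by rewrite cosine_id ?lexx; [rewrite sqrrN expr1n subrr sqrtr0 oppr0|lra].
Qed.

Lemma cRe_loop t : cRe (loop t) = if t <= 2^-1 then cosine (1 - 4 * t) else cosine (4 * t - 3).
Proof.
by rewrite /loop; case: ifP => _; rewrite cRe_circ ?sqrrN circ_sine_norm ?ltr01 // sqrtr1 divr1.
Qed.

Lemma cIm_loop t : cIm (loop t) =
  if t <= 2^-1 then Num.sqrt (1 - cosine (1 - 4 * t) ^+ 2)
  else - Num.sqrt (1 - cosine (4 * t - 3) ^+ 2).
Proof.
by rewrite /loop; case: ifP => _; rewrite cIm_circ ?sqrrN circ_sine_norm ?ltr01 // sqrtr1 divr1.
Qed.

Lemma cRe1 : cRe circ1 = 1. Proof. by []. Qed.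
Lemma cIm1 : cIm circ1 = 0. Proof. by []. Qed.

Lemma loop_end t : t <= 0 \/ 1 <= t -> loop t = circ1.
Proof.
move=> h; apply: circle_ext; rewrite ?cRe_loop ?cIm_loop ?cRe1 ?cIm1.
  case: h => h; last rewrite ifF; rewrite ?ifT; try lra.
  - by rewrite /cosine (min_idPl _) ?(max_idPr _) //; lra.
  - by rewrite /cosine (min_idPl _) ?(max_idPr _) //; lra.
have aux (s : R) : 1 <= s -> cosine s = 1.
  by move=> s1; rewrite /cosine (min_idPl _) ?(max_idPr _) //; lra.
case: h => h; first rewrite ifT; try lra.
  by rewrite aux; [rewrite expr1n subrr sqrtr0|lra].
rewrite ifF; last by apply/negbTE; rewrite -ltNge; lra.
by rewrite aux; [rewrite expr1n subrr sqrtr0 oppr0|lra].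
Qed.

Definition angle (z : circle R) : R :=
  if 0 <= cIm z then (1 - cRe z) / 4 else (3 + cRe z) / 4.

Lemma cRe_itv z : -1 <= cRe z <= 1.
Proof. have := cReIm z; have := sqr_ge0 (cIm z); nra. Qed.

Lemma angle1 : angle circ1 = 0.
Proof. by rewrite /angle cRe1 cIm1 lexx subrr mul0r. Qed.

Lemma angleK z : loop (angle z) = z.
Proof.
have zz := cReIm z; have := cRe_itv z => z1.
have s : Num.sqrt (1 - cRe z ^+ 2) = `|cIm z|.
  by rewrite -zz addrAC subrr add0r sqrtr_sqr.
rewrite /angle; have [z0|z0] := leP 0 (cIm z).
  have t2 : (1 - cRe z) / 4 <= 2^-1 by lra.
  have e : 1 - 4 * ((1 - cRe z) / 4) = cRe z by lra.
  by apply: circle_ext; rewrite ?cRe_loop ?cIm_loop t2 e cosine_id // s ger0_norm.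
have t2 : ((3 + cRe z) / 4 <= 2^-1) = false by apply/negbTE; rewrite -ltNge; nra.
have e : 4 * ((3 + cRe z) / 4) - 3 = cRe z by lra.
by apply: circle_ext; rewrite ?cRe_loop ?cIm_loop t2 e cosine_id // s ltr0_norm // opprK.
Qed.

Lemma loopK (t : R) : 0 < t < 1 -> angle (loop t) = t.
Proof.
move=> t01; rewrite /angle cRe_loop cIm_loop.
have [t2|t2] := leP t 2^-1; first by rewrite sqrtr_ge0 cosine_id; lra.
rewrite cosine_id; last by lra.
rewrite ifF; first by lra.
apply/negbTE; rewrite -ltNge oppr_lt0 sqrtr_gt0; nra.
Qed.

End circle_coordinates.

(** * The cubical model and the splitting off of one coordinate *)

Section cubes.
Context (R : realType) (T : finType) (K : {set {set T}}) (k : nat).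
Context (alpha : 'I_k -> {set T}).
Hypothesis K_complex : simplicial_complex K.

(** The cone on the barycentric subdivision of [K], as a union of cubes: the simplex
    [s] is the vertex given by the indicator function of [s], the cone point is the
    origin, and the face of a vertex [v] is given by [x v = 1]. *)
Definition in_cubes (x : T -> R) : Prop :=
  (forall v, 0 <= x v <= 1) /\ [set v | x v != 0]%SET \in K.

Definition cubes : topologicalType := set_type [set x : {ptws T -> R} | in_cubes x].

Lemma mkcubesP (x : T -> R) : in_cubes x ->
  (x : {ptws T -> R}) \in [set x : {ptws T -> R} | in_cubes x].
Proof. by move=> h; apply/mem_set. Qed.

Definition mkcubes (x : T -> R) (h : in_cubes x) : cubes := SigSub (mkcubesP h).

Definition ccoord (x : cubes) : T -> R := \val x.

Lemma coordP (x : cubes) : in_cubes (ccoord x).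
Proof. by have := valP x; rewrite inE. Qed.

Lemma coord01 (x : cubes) v : 0 <= ccoord x v <= 1.
Proof. by have [h _] := coordP x. Qed.

Lemma cubes_ext (x y : cubes) : ccoord x =1 ccoord y -> x = y.
Proof. by move=> /funext e; apply: val_inj. Qed.

Lemma in_cubes_sub (x : cubes) (y : T -> R) : (forall v, 0 <= y v <= 1) ->
  (forall v, ccoord x v = 0 -> y v = 0) -> in_cubes y.
Proof.
move=> y01 xy; split=> //; have [_ sK] := coordP x.
have [_ closed] := K_complex; apply: (closed _ _ sK).
by apply/fintype.subsetP => v; rewrite !inE; apply: contraNneq => /xy ->.
Qed.

Lemma cts_coord (W : topologicalType) (f : W -> cubes) v :
  continuous f -> continuous (fun w => ccoord (f w) v).
Proof.
move=> cf; have cv : continuous (fun w => (\val (f w) : {ptws T -> R})).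
  exact: cts_val.
exact: (cts_proj (I := T) (Z := R) (i := v) cv).
Qed.

Lemma cts_mkcubes (W : topologicalType) (f : W -> cubes) :
  (forall v, continuous (fun w => ccoord (f w) v)) -> continuous f.
Proof. by move=> cf; apply: cts_sub; apply: cts_ptws. Qed.

Lemma in_cubes0 : in_cubes (fun=> 0).
Proof.
split=> [v|]; first by rewrite lexx ler01.
suff -> : [set v : T | (0 : R) != 0]%SET = finset.set0 by case: K_complex.
by apply/setP => v; rewrite !inE eqxx.
Qed.

Definition apex : cubes := mkcubes in_cubes0.

Definition model : topologicalType := (cubes * torus R k)%type.

Definition on_face (i : 'I_k) (x : cubes) : Prop :=
  exists2 v, v \in alpha i & ccoord x v = 1.

(** The points that become the base point when the torus coordinates in [S] are
    smashed and the faces of the blocks in [M] are collapsed. *)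
Definition collapsed (S M : {set 'I_k}) (d : model) : Prop :=
  (exists2 i, i \in M & on_face i d.1) \/ (exists2 i, i \in S & d.2 i = circ1 R).

(** The torus coordinates outside of [E] are forgotten, and a coordinate in [E] is
    forgotten on the face of its block. *)
Definition model_rel (S M E : {set 'I_k}) (d d' : model) : Prop :=
  (collapsed S M d /\ collapsed S M d') \/
  (d.1 = d'.1 /\ forall i, i \in E -> on_face i d.1 \/ d.2 i = d'.2 i).

Definition model_quot (S M E : {set 'I_k}) : topologicalType :=
  gen_quot (model_rel S M E).

Definition cls (S M E : {set 'I_k}) (d : model) : model_quot S M E :=
  (\pi_(gen_quot (model_rel S M E)) d)%qT.

Lemma cts_cls S M E : continuous (cls S M E).
Proof. by have [] := gen_quot_map (model_rel S M E). Qed.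

Lemma cls_surj S M E (y : model_quot S M E) : exists d, cls S M E d = y.
Proof. by have [_ h _] := gen_quot_map (model_rel S M E); apply: h. Qed.

Lemma cls_rel S M E d d' : model_rel S M E d d' -> cls S M E d = cls S M E d'.
Proof. exact: gen_quot_rel. Qed.

Lemma cls_collapsed S M E d d' : collapsed S M d -> collapsed S M d' ->
  cls S M E d = cls S M E d'.
Proof. by move=> h h'; apply: cls_rel; left. Qed.

Lemma cls_eq S M (E : {set 'I_k}) (x : cubes) (g g' : torus R k) : (forall i, i \in E -> on_face i x \/ g i = g' i) ->
  cls S M E (x, g) = cls S M E (x, g').
Proof. by move=> h; apply: cls_rel; right. Qed.

Lemma cls_lift S M E (Z : topologicalType) (f : model -> Z) : continuous f ->
  (forall d d', model_rel S M E d d' -> f d = f d') ->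
  exists2 g : model_quot S M E -> Z, continuous g & forall d, g (cls S M E d) = f d.
Proof. exact: gen_quot_lift. Qed.

Lemma cls_liftR S M E (Z : topologicalType) (f : model * R -> Z) : continuous f ->
  (forall d d' t, model_rel S M E d d' -> f (d, t) = f (d', t)) ->
  exists2 g : model_quot S M E * R -> Z, continuous g &
    forall d t, g (cls S M E d, t) = f (d, t).
Proof.
move=> cf fr.
have [||g cg gE] := quot_lift (f := f) (quot_mapR R (gen_quot_map (model_rel S M E))).
- exact: cf.
- move=> [d t] [d' t'] /= [e <-]; move: d d' e; apply: gen_quot_ind => d d' h.
  exact: fr.
by exists g => // d t; rewrite (gE (d, t)).
Qed.

Lemma cts_torus (W : topologicalType) (f : W -> torus R k) j :
  continuous f -> continuous (fun w => f w j).
Proof. exact: (cts_proj (I := 'I_k) (Z := circle R)). Qed.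

Definition torus1 : torus R k := fun=> circ1 R.
Definition set_coord (i : 'I_k) (z : circle R) (g : torus R k) : torus R k :=
  fun j => if j == i then z else g j.

Lemma cts_set_coord (W : topologicalType) i (z : W -> circle R) (g : W -> torus R k) :
  continuous z -> continuous g -> continuous (fun w => set_coord i (z w) (g w)).
Proof.
move=> cz cg; apply: cts_ptws => j; rewrite /set_coord; case: (j == i) => //.
exact: (cts_torus (f := g)).
Qed.

(** The stages between [X] and its smash pieces: the torus coordinates in [E] are
    left, and those in [A] are smashed. The base point is collapsed as soon as [A]
    is not empty. *)
Definition partial_smash (A E : {set 'I_k}) : ptopologicalType :=
  pointed_at (cls A A E (apex, torus1)).

Lemma in_cubes_grow (w : cubes * R) :
  in_cubes (fun v => Num.min 1 ((1 + clamp w.2) * ccoord w.1 v)).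
Proof.
apply: (@in_cubes_sub w.1) => v; last by move=> ->; rewrite mulr0 (min_idPr ler01).
have /andP[x0 x1] := coord01 w.1 v; have t0 := clamp_ge0 w.2.
by rewrite le_min ler01 ge_min lexx /= andbT mulr_ge0 // addr_ge0.
Qed.

(** Scaling and truncating: points near a face move into it, and faces are kept. *)
Definition grow (w : cubes * R) : cubes := mkcubes (in_cubes_grow w).

Lemma coord_grow x t v : ccoord (grow (x, t)) v = Num.min 1 ((1 + clamp t) * ccoord x v).
Proof. by []. Qed.

Lemma cts_grow : continuous grow.
Proof.
apply: cts_mkcubes => v; rewrite /ccoord /=; apply: cts_min; first exact: cts_cst.
apply: cts_mul; last by apply: cts_coord; cts.
by apply: cts_add; [cts|apply: cts_clamp; cts].
Qed.

Lemma grow0 x : grow (x, 0) = x.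
Proof.
apply: cubes_ext => v; rewrite coord_grow clamp0 addr0 mul1r; apply/min_idPr.
by case/andP: (coord01 x v).
Qed.

Lemma grow_apex t : grow (apex, t) = apex.
Proof. by apply: cubes_ext => v; rewrite /ccoord /= mulr0 (min_idPr ler01). Qed.

Lemma grow_face i x t : on_face i x -> on_face i (grow (x, t)).
Proof.
move=> [v vi xv]; exists v => //; rewrite coord_grow xv mulr1.
by apply/min_idPl; rewrite lerDl clamp_ge0.
Qed.

(** Moves the points that are almost collapsed to collapsed ones, in all coordinates
    at once. *)
Definition spread (w : model * R) : model :=
  (grow (w.1.1, w.2), fun j => cpush (circ1 R) (w.1.2 j, w.2)).

Lemma cts_spread : continuous spread.
Proof.
apply: cts_pair; first by have c := cts_grow; cts.
apply: cts_ptws => j; apply: (cts_comp (@cts_cpush R _)).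
apply: cts_pair; [apply: (cts_torus (f := fun w : model * R => w.1.2))|]; cts.
Qed.

Lemma spread_rel S M E d d' t : model_rel S M E d d' ->
  model_rel S M E (spread (d, t)) (spread (d', t)).
Proof.
have sc e : collapsed S M e -> collapsed S M (spread (e, t)).
  case=> [[i iM fi]|[i iS gi]]; [left|right]; exists i => //.
    exact: grow_face.
  by rewrite /spread /= gi cpushz.
case=> [[c c']|[xx gg]]; first by left; split; exact: sc.
right; rewrite /spread /= xx; split=> // i /gg [fi|->]; last by right.
by left; rewrite -xx; exact: grow_face.
Qed.

Definition dist1 (t : R) : R := Num.min 1 (2 * (1 - t)).

Lemma dist1_itv t : t <= 1 -> 0 <= dist1 t <= 1.
Proof. by move=> t1; rewrite /dist1 le_min ler01 ge_min lexx andbT /=; lra. Qed.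

Lemma dist1_1 : dist1 1 = 0.
Proof. by rewrite /dist1 subrr mulr0; apply/min_idPr. Qed.

Lemma dist1_lt t : dist1 t < 1 -> 1 <= 2 * t.
Proof. by rewrite /dist1 gt_min ltxx /= => h; lra. Qed.

(** Zero exactly on the points collapsed for [A]; less than [1] only if one of the
    factors is, hence only near the collapsed points. *)
Definition gauge (A : {set 'I_k}) (d : model) : R :=
  \prod_(j in A) (dist1 (cdot (circ1 R) (d.2 j)) *
                  \prod_(v in alpha j) dist1 (ccoord d.1 v)).

Lemma cts_gauge A : continuous (gauge A).
Proof.
apply: cts_prod => j; apply: cts_mul.
  apply: cts_min; first exact: cts_cst.
  apply: cts_mul; first exact: cts_cst.
  apply: cts_add; first exact: cts_cst.
  by apply: cts_opp; apply: cts_cdot; apply: (cts_torus (f := fun w : model => w.2)); cts.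
apply: cts_prod => v; apply: cts_min; first exact: cts_cst.
apply: cts_mul; first exact: cts_cst.
apply: cts_add; first exact: cts_cst.
by apply: cts_opp; apply: cts_coord; cts.
Qed.

Lemma prod_itv01 (I : finType) (P : pred I) (F : I -> R) :
  (forall i, P i -> 0 <= F i <= 1) -> 0 <= \prod_(i | P i) F i <= 1.
Proof.
move=> h; apply: (big_ind (fun x => 0 <= x <= 1)) => //; first by rewrite ler01 lexx.
move=> x y /andP[x0 x1] /andP[y0 y1]; rewrite mulr_ge0 //=.
by rewrite -[leRHS](mulr1 1) ler_pM.
Qed.

Lemma prod_lt1 (I : finType) (P : pred I) (F : I -> R) :
  (forall i, P i -> 0 <= F i <= 1) -> \prod_(i | P i) F i < 1 ->
  exists2 i, P i & F i < 1.
Proof.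
move=> h; apply: contraPP => no; apply/negP; rewrite -leNgt.
rewrite big1 // => i Pi; apply: le_anti; have /andP[_ ->] := h i Pi.
by rewrite leNgt; apply/negP => Fi; apply: no; exists i.
Qed.

Lemma dist_coord x v : 0 <= dist1 (ccoord x v) <= 1.
Proof. by apply: dist1_itv; case/andP: (coord01 x v). Qed.

Lemma dist_circ z : 0 <= dist1 (cdot (circ1 R) z) <= 1.
Proof. by apply: dist1_itv; exact: cdot_le1. Qed.

Lemma gauge_factor_itv d j : 0 <= dist1 (cdot (circ1 R) (d.2 j)) *
   \prod_(v in alpha j) dist1 (ccoord d.1 v) <= 1.
Proof.
have /andP[a0 a1] := dist_circ (d.2 j).
have /andP[b0 b1] : 0 <= \prod_(v in alpha j) dist1 (ccoord d.1 v) <= 1.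
  by apply: prod_itv01 => v _; exact: dist_coord.
by rewrite mulr_ge0 //= -[leRHS](mulr1 1) ler_pM.
Qed.

Lemma gauge_itv A d : 0 <= gauge A d <= 1.
Proof. by apply: prod_itv01 => j _; exact: gauge_factor_itv. Qed.

Lemma gauge_collapsed A d : collapsed A A d -> gauge A d = 0.
Proof.
case=> [[i iA [v vi xv]]|[i iA gi]]; rewrite /gauge (bigD1 i) //=.
  by rewrite (bigD1 v vi) /= xv dist1_1 mul0r mulr0 mul0r.
by rewrite gi cdotxx dist1_1 !mul0r.
Qed.

Lemma gauge_rel (A E : {set 'I_k}) d d' : A \subset E -> model_rel A A E d d' ->
  gauge A d = gauge A d'.
Proof.
move=> AE [[c c']|[xx gg]]; first by rewrite !gauge_collapsed.
have [[i iA fi]|no] := pselect (exists2 i, i \in A & on_face i d.1).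
  by rewrite !gauge_collapsed //; left; exists i; rewrite // -?xx.
rewrite /gauge xx; apply: eq_bigr => j jA; congr (dist1 (cdot _ _) * _).
have [fj|//] := gg j (fintype.subsetP AE j jA).
by case: no; exists j.
Qed.

Lemma gauge_lt1 A d : gauge A d < 1 -> collapsed A A (spread (d, 1)).
Proof.
move=> /prod_lt1[j _|j jA]; first exact: gauge_factor_itv.
have /andP[a0 a1] := dist_circ (d.2 j) => h.
have [g1|g1] := ltP (dist1 (cdot (circ1 R) (d.2 j))) 1.
  by right; exists j => //; rewrite /spread /= cpush1 // dist1_lt.
left; exists j => //.
have g1' : dist1 (cdot (circ1 R) (d.2 j)) = 1 by apply: le_anti; rewrite a1.
move: h; rewrite g1' mul1r => /prod_lt1[v _|v vj xv]; first exact: dist_coord.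
exists v => //; rewrite coord_grow clamp1; apply/min_idPl.
exact: dist1_lt.
Qed.

Section split_one_coordinate.
Variables (A E : {set 'I_k}) (i : 'I_k).
Hypotheses (iA : i \notin A) (iE : i \notin E) (AE : A \subset E).
Let X := partial_smash A (i |: E)%SET.
Let B := partial_smash A E.
Let Q := partial_smash (i |: A)%SET (i |: E)%SET.

Lemma collapsed_set_coord (S M : {set 'I_k}) z d : i \notin S -> collapsed S M d ->
  collapsed S M (d.1, set_coord i z d.2).
Proof.
move=> iS [[j jM fj]|[j jS gj]]; [left|right]; exists j => //=.
by rewrite /set_coord; case: eqP => // ji; move: iS; rewrite -ji jS.
Qed.

Lemma collapsedS (S M S' M' : {set 'I_k}) d : S \subset S' -> M \subset M' ->
  collapsed S M d -> collapsed S' M' d.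
Proof.
move=> SS MM [[j jM fj]|[j jS gj]]; [left|right]; exists j => //.
  exact: (fintype.subsetP MM).
exact: (fintype.subsetP SS).
Qed.

(** The points with trivial [i]-th coordinate form a retract of the stage [(A, i + E)],
    which is the stage [(A, E)]; collapsing it smashes the coordinate [i]. The
    homotopy [spread] and the function [gauge] make it a neighbourhood retract in the
    strong sense that the splitting of suspensions asks for. *)
Theorem partial_smash_split :
  exists (i1 : reduced_susp R B -> reduced_susp R X)
         (i2 : reduced_susp R Q -> reduced_susp R X), hsum R i1 i2.
Proof.
pose clX := cls A A (i |: E)%SET; pose clB := cls A A E.
pose clQ := cls (i |: A)%SET (i |: A)%SET (i |: E)%SET.
pose trivial_i (d : model) : model := (d.1, set_coord i (circ1 R) d.2).
have ct : continuous trivial_i.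
  apply: cts_pair; first by cts.
  by apply: cts_set_coord; cts.
have clXi d : collapsed (i |: A)%SET (i |: A)%SET d -> clX (trivial_i d) = clX d.
  have AA e : collapsed A A e -> clX (trivial_i e) = clX e.
    by move=> h; apply: cls_collapsed => //; exact: collapsed_set_coord.
  have off j : j != i -> (trivial_i d).2 j = d.2 j.
    by move=> /negPf ji; rewrite /trivial_i /set_coord /= ji.
  move=> c; case: (c) => [[j + fj]|[j + gj]]; rewrite !inE => /orP[/eqP ji|jA].
  - apply: cls_rel; right; split=> // l _; have [->|li] := eqVneq l i.
      by left; rewrite -ji.
    by right; exact: off.
  - by apply: AA; left; exists j.
  - apply: cls_rel; right; split=> // l _; right; have [->|li] := eqVneq l i.
      by rewrite /trivial_i /set_coord /= eqxx -ji gj.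
    exact: off.
  - by apply: AA; right; exists j.
have [f cf fE] : exists2 f : B -> X, continuous f & forall d, f (clB d) = clX (trivial_i d).
  apply: (@cls_lift A A E X (fun d => clX (trivial_i d))).
    exact: (cts_comp (@cts_cls _ _ _) ct).
  move=> d d' [[c c']|[xx gg]].
    by apply: cls_collapsed; apply: collapsed_set_coord.
  apply: cls_rel; right; split=> //= j.
  rewrite !inE /set_coord; have [//|ji] := eqVneq j i; first by right.
  exact: gg.
have [r cr rE] : exists2 r : X -> B, continuous r & forall d, r (clX d) = clB d.
  apply: (@cls_lift A A (i |: E)%SET B clB); first exact: cts_cls.
  move=> d d' [[c c']|[xx gg]]; first exact: cls_collapsed.
  by apply: cls_rel; right; split=> // j jE; apply: gg; rewrite !inE jE orbT.
have [q cq qE] : exists2 q : X -> Q, continuous q & forall d, q (clX d) = clQ d.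
  apply: (@cls_lift A A (i |: E)%SET Q clQ); first exact: cts_cls.
  move=> d d' [[c c']|[xx gg]]; last by apply: cls_rel; right.
  by apply: cls_collapsed; apply: collapsedS c || apply: collapsedS c';
    exact: finset.subsetU1.
have [phi cphi phiE] : exists2 phi : X * R -> X, continuous phi &
    forall d t, phi (clX d, t) = clX (spread (d, t)).
  apply: (@cls_liftR A A (i |: E)%SET X (fun w => clX (spread w))).
    exact: (cts_comp (@cts_cls _ _ _) cts_spread).
  by move=> d d' t h; apply: cls_rel; exact: spread_rel.
have [u cu uE] : exists2 u : X -> R, continuous u &
    forall d, u (clX d) = gauge (i |: A)%SET d.
  apply: (@cls_lift A A (i |: E)%SET R); first exact: cts_gauge.
  move=> d d' h; apply: (@gauge_rel _ (i |: E)%SET); first exact: finset.setUS.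
  have [[c c']|[xx gg]] := h; last by right.
  left; split; [apply: collapsedS c|apply: collapsedS c'];
    exact: finset.subsetU1.
have fr d : f (r (clX d)) = clX (trivial_i d) by rewrite rE fE.
have base : clX (apex, torus1) = clX (trivial_i (apex, torus1)).
  congr (clX (_, _)); apply/funext => j; rewrite /set_coord /torus1.
  by case: ifP.
have Xs (y : X) : exists d, clX d = y by exact: cls_surj.
have Bs (y : B) : exists d, clB d = y by exact: cls_surj.
have pf : ptmap f by split=> //; rewrite [LHS]fE -base.
have pr : ptmap r by split=> //; rewrite [LHS]rE.
have coll_i d : collapsed (i |: A)%SET (i |: A)%SET (trivial_i d).
  by right; exists i; rewrite ?set11 ?inE ?eqxx // /trivial_i /set_coord /= eqxx.
apply: (@suspension_split R X B Q f r q phi u) => //.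
- move=> y; have [[x g] <-] := Bs y; rewrite fE rE; apply: cls_eq => j jE; right.
  by rewrite /set_coord; case: eqP => // ji; have := iE; rewrite -ji jE.
- split=> // [y|Z g cg].
    by have [d <-] := cls_surj y; exists (clX d); rewrite qE.
  have [_ _ h] := gen_quot_map (model_rel (i |: A)%SET (i |: A)%SET (i |: E)%SET).
  apply: h; have -> : (fun d => g (clQ d)) = (fun d => g (q (clX d))).
    by apply/funext => d; rewrite qE.
  exact: (cts_comp cg (@cts_cls A A (i |: E)%SET)).
- move=> y; have [d <-] := Bs y; rewrite fE qE; apply: cls_collapsed => //.
  by right; exists i; rewrite ?inE ?eqxx.
- move=> y y'; have [d <-] := Xs y; have [d' <-] := Xs y'.
  rewrite !qE => /gen_quotP; rewrite !fr.
  elim=> {d d'} [d d' [[c c']|[xx gg]]|d|d d' _ [->|[]]|d d' d'' _ + _].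
  + by right; split; apply: clXi.
  + by left; apply: cls_rel; right.
  + by left.
  + by left.
  + by right.
  + rewrite -!fr; case=> [->|[a b]].
      by case=> [->|[a' b']]; [left|right].
    by case=> [<-|[a' b']]; right.
- by move=> y; have [d <-] := Xs y; rewrite phiE; congr clX; case: d => x g;
    rewrite /spread /= grow0; congr (_, _); apply/funext => j; rewrite cpush0.
- move=> t _; rewrite [LHS]phiE /spread /= grow_apex; congr clX; congr (_, _).
  by apply/funext => j; rewrite cpushz.
- move=> y t _; have [d <-] := Xs y; rewrite !fr => e.
  rewrite -e phiE fr; congr clX; rewrite /trivial_i /spread /=; congr (_, _).
  apply/funext => j; rewrite /set_coord; case: eqP => // _.
  by rewrite cpushz.
- by move=> y; have [d <-] := Xs y; rewrite uE gauge_itv.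
- by move=> y; have [d <-] := Bs y; rewrite fE uE gauge_collapsed.
- by move=> y; have [d <-] := Xs y; rewrite uE phiE fr => /gauge_lt1 /clXi.
Qed.

End split_one_coordinate.

End cubes.

(** * Splitting all coordinates; smashing with circles *)

Lemma hcoprod_eqP (R : realType) (J : Type) (P P' : pred J) (F : J -> ptopologicalType)
    (S : ptopologicalType) (inj : forall j, F j -> S) :
  P =1 P' -> hcoprod R P inj -> hcoprod R P' inj.
Proof. by move=> /funext <-. Qed.

Section torus_decomposition.
Context (R : realType) (T : finType) (K : {set {set T}}) (k : nat).
Context (alpha : 'I_k -> {set T}).
Hypothesis K_complex : simplicial_complex K.
Local Notation V A E := (partial_smash R alpha K_complex A E).

(** Every coordinate in [B] is either dropped or smashed; the subsets [L] between [A]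
    and the union of [A] and [B] record which ones are smashed in the end. *)
Theorem partial_smash_hcoprod (A B : {set 'I_k}) : [disjoint A & B]%B ->
  exists inj : forall L, reduced_susp R (V L L) -> reduced_susp R (V A (A :|: B)%SET),
    hcoprod R (fun L : {set 'I_k} => (A \subset L) && (L \subset A :|: B)%SET) inj.
Proof.
have [n] := ubnP #|B|; elim: n A B => // n IH A B.
have [->|[i iB]] := finset.set_0Vmem B.
  move=> _ _; rewrite finset.setU0.
  have [inj h] := hcoprod_pred1 R (fun L => reduced_susp R (V L L)) A.
  exists inj; apply: hcoprod_eqP h => L /=.
  by rewrite finset.eqEsubset andbC.
rewrite (cardsD1 i) iB add1n ltnS => Bn AB.
have iA : i \notin A by apply/negP => /(disjointFr AB); rewrite iB.
pose B' := (B :\ i)%SET; pose E := (A :|: B')%SET.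
have iE : i \notin E by rewrite !inE negb_or iA eqxx.
have AE : A \subset E by exact: finset.subsetUl.
have ABE : (A :|: B)%SET = (i |: E)%SET.
  by rewrite /E finset.setUCA finset.setD1K.
have AiE : ((i |: A) :|: B')%SET = (i |: E)%SET by rewrite /E finset.setUA.
have dis1 : [disjoint A & B']%B by apply: disjointWr AB; exact: finset.subD1set.
have dis2 : [disjoint (i |: A)%SET & B']%B.
  by rewrite finset.disjoints_subset finset.subUset finset.sub1set !inE eqxx
    -finset.disjoints_subset.
have [inj1 h1] := IH A B' Bn dis1; have [inj2 h2] := IH (i |: A)%SET B' Bn dis2.
rewrite ABE; move: inj2 h2; rewrite AiE => inj2 h2.
have [i1 [i2 h]] := partial_smash_split R alpha K_complex iA iE AE.
have dj (L : {set 'I_k}) : (A \subset L) && (L \subset E) ->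
    ~~ (((i |: A)%SET \subset L) && (L \subset i |: E)%SET).
  case/andP=> _ LE; rewrite negb_and finset.subUset finset.sub1set.
  by have -> : i \in L = false by apply/negP => /(fintype.subsetP LE); rewrite (negPf iE).
have hh := hcoprod_hsum dj h h1 h2.
eexists; apply: hcoprod_eqP hh => L /=.
rewrite finset.subUset finset.sub1set.
have [iL|iL] := boolP (i \in L); rewrite /=.
  have -> : (L \subset E) = false.
    by apply/negP => /fintype.subsetP/(_ _ iL); rewrite (negPf iE).
  by rewrite andbF.
rewrite orbF; congr (_ && _); apply/idP/idP => [|LE].
  by move=> /fintype.subset_trans; apply; exact: finset.subsetU1.
apply/fintype.subsetP => j jL; have := fintype.subsetP LE j jL.
by rewrite finset.in_setU1 => /orP[/eqP ji|//]; rewrite -ji jL in iL.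
Qed.

End torus_decomposition.

Section circle_coordinates_are_suspensions.
Context (R : realType) (T : finType) (K : {set {set T}}) (k : nat).
Context (alpha : 'I_k -> {set T}) (L : {set 'I_k}) (d0 : model R K k).
Hypothesis d0L : collapsed alpha finset.set0 L d0.
Local Notation Y S := (pointed_at (cls alpha S L S d0)).

Lemma collapsedL S : collapsed alpha S L d0.
Proof. by case: d0L => [h|[j]]; [left|rewrite inE]. Qed.

(** Smashing with the circle is suspending, [loop] being the suspension coordinate. The
    faces of the blocks in [L] are collapsed already, so that the coordinate [i] of
    [L] is not forgotten anywhere else. *)
Theorem circle_coordinate_susp (S : {set 'I_k}) (i : 'I_k) : i \in L -> i \notin S ->
  pequiv R (Y (i |: S)%SET) (reduced_susp R (Y S)).
Proof.
move=> iL iS; pose S' := (i |: S)%SET.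
pose c : model R K k -> Y S := cls alpha S L S.
pose c' : model R K k -> Y S' := cls alpha S' L S'.
have cc : continuous c by exact: cts_cls.
have cc' : continuous c' by exact: cts_cls.
pose Sg (p : Y S * R) : reduced_susp R (Y S) := susp_pt p.
have cS : continuous Sg by exact: cts_susp_pt.
have cl := @cts_loop R.
have c0 d : collapsed alpha S L d -> c d = point.
  by move=> h; apply: cls_collapsed => //; exact: collapsedL.
have c0' d : collapsed alpha S' L d -> c' d = (point : Y S').
  by move=> h; apply: cls_collapsed => //; exact: collapsedL.
pose put (w : model R K k * R) : model R K k := (w.1.1, set_coord i (loop w.2) w.1.2).
have cput : continuous put.
  apply: cts_pair; first by cts.
  by apply: cts_set_coord; cts.
have put_coll w : collapsed alpha S L w.1 -> collapsed alpha S' L (put w).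
  case=> [[j jL fj]|[j jS gj]]; [left|right]; exists j => //.
    by rewrite !inE jS orbT.
  by rewrite /put /set_coord /=; case: eqP => // ji; rewrite -ji jS in iS.
have put_end d (t : R) : t <= 0 \/ 1 <= t -> collapsed alpha S' L (put (d, t)).
  move=> h; right; exists i; first by rewrite !inE eqxx.
  by rewrite /put /set_coord /= eqxx loop_end.
have [a ca aE] : exists2 a : Y S * R -> Y S', continuous a &
    forall d t, a (c d, t) = c' (put (d, t)).
  apply: (@cls_liftR _ _ _ _ alpha S L S (Y S') (fun w => c' (put w))); first by cts.
  move=> d d' t [[h h']|[xx gg]]; first by rewrite !c0' //; exact: put_coll.
  apply: cls_rel; right; split=> //= j; rewrite !inE /set_coord.
  by case: eqP => /= _; [right|exact: gg].
have cs d : exists e, c e = d by exact: cls_surj.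
have cs' d : exists e, c' e = d by exact: cls_surj.
have [y|y|t _|A pA AE] := @susp_lift R (Y S) (Y S') a ca.
- by have [d <-] := cs y; rewrite aE c0' //; apply: put_end; left.
- by have [d <-] := cs y; rewrite aE c0' //; apply: put_end; right.
- by rewrite [LHS]aE c0' //; apply: put_coll; exact: collapsedL.
pose h (d : model R K k) : reduced_susp R (Y S) :=
  if - cIm (d.2 i) <= 0 then Sg (c d, (1 - cRe (d.2 i)) / 4)
  else Sg (c d, (3 + cRe (d.2 i)) / 4).
have hE d : h d = Sg (c d, angle (d.2 i)).
  by rewrite /h /angle oppr_le0; case: ifP.
have ch : continuous h.
  have c2 : continuous (fun d : model R K k => d.2 i).
    by apply: (cts_torus (f := fun d : model R K k => d.2)); cts.
  have c3 := cts_cRe c2; have c4 := cts_cIm c2.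
  apply: cts_if; [by cts|by cts|by cts|move=> d /eqP; rewrite oppr_eq0 => /eqP im0].
  have := cReIm (d.2 i); rewrite im0 expr0n addr0 => /eqP; rewrite sqrf_eq1.
  case/orP => /eqP ->; last by congr (Sg (_, _)); lra.
  by rewrite subrr mul0r [LHS]susp_pt0 // [RHS]susp_pt1 //; lra.
have h0 d : collapsed alpha S' L d -> h d = point.
  rewrite hE => -[[j jL fj]|[j]]; first by rewrite c0 ?[LHS]susp_ptp //; left; exists j.
  rewrite !inE => /orP[/eqP ->|jS] gj; first by rewrite gj angle1 [LHS]susp_pt0.
  by rewrite c0 ?[LHS]susp_ptp //; right; exists j.
have [B cB BE] : exists2 B : Y S' -> reduced_susp R (Y S), continuous B &
    forall d, B (c' d) = h d.
  apply: (@cls_lift _ _ _ _ alpha S' L S' _ h) => // d d'.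
  case=> [[e e']|[xx gg]]; first by rewrite !h0.
  have iS' : i \in S' by rewrite !inE eqxx.
  have [fi|gi] := gg i iS'.
    by rewrite !h0 //; left; exists i => //; rewrite -xx.
  rewrite !hE gi; congr (Sg (_, _)); apply: cls_rel; right; split=> // j jS.
  by apply: gg; rewrite !inE jS orbT.
have pB : ptmap B by split=> //; rewrite [LHS]BE h0 //; exact: collapsedL.
have AS y t : A (Sg (y, t)) = a (y, t).
  have [t0|t0] := leP t 0.
    rewrite [Sg _]susp_pt0 // pA.2; have [d <-] := cs y.
    by rewrite aE c0' //; apply: put_end; left.
  have [t1|t1] := leP 1 t.
    rewrite [Sg _]susp_pt1 // pA.2; have [d <-] := cs y.
    by rewrite aE c0' //; apply: put_end; right.
  by apply: AE; rewrite !ltW.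
have AB y : A (B y) = y.
  have [d <-] := cs' y; rewrite BE hE AS aE; congr c'.
  case: d => x g; rewrite /put /=; congr (_, _); apply/funext => j.
  by rewrite /set_coord; case: eqP => [->|//]; rewrite angleK.
have BA z : B (A z) = z.
  move: z; apply: susp_ind => y t /andP[t0 t1]; rewrite [A _]AS.
  have [d <-] := cs y; rewrite aE BE.
  have [->|tn0] := eqVneq t 0.
    by rewrite h0 ?[RHS]susp_pt0 //; apply: put_end; left.
  have [->|tn1] := eqVneq t 1.
    by rewrite h0 ?[RHS]susp_pt1 //; apply: put_end; right.
  have t01 : 0 < t < 1 by rewrite lt_neqAle eq_sym tn0 t0 lt_neqAle tn1 t1.
  rewrite hE /put /set_coord /= eqxx loopK //; congr (Sg (_, _)).
  apply: cls_rel; right; split=> //= j jS; right; case: eqP => // ji.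
  by rewrite -ji jS in iS.
exists B, A; split=> //.
- by apply: phom_ext (phom_refl R (ptmap_id _)) _ _ => y; rewrite ?AB.
- by apply: phom_ext (phom_refl R (ptmap_id _)) _ _ => y; rewrite ?BA.
Qed.

Theorem circle_coordinates_susp (S : {set 'I_k}) : S \subset L ->
  pequiv R (Y S) (iter #|S| (reduced_susp R) (Y finset.set0)).
Proof.
have [n] := ubnP #|S|; elim: n S => // n IH S.
have [->|[i iS]] := finset.set_0Vmem S; first by rewrite cards0 => _ _; exact: pequiv_refl.
rewrite (cardsD1 i) iS add1n ltnS => Sn SL; rewrite iterS.
have := susp_pequiv (IH _ Sn (fintype.subset_trans (finset.subD1set _ _) SL)).
apply: pequiv_trans.
have iSi : i \notin (S :\ i)%SET by rewrite !inE eqxx.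
have := circle_coordinate_susp (fintype.subsetP SL i iS) iSi.
by rewrite finset.setD1K.
Qed.

End circle_coordinates_are_suspensions.

(** * Realizations are well pointed *)

(** Continuity is local; the pieces are given as subspaces to allow for functions
    whose definition needs a proof that the point is in the piece. *)
Lemma cts_open_cover (W Z : topologicalType) (f : W -> Z) :
  (forall w, exists U : set W, [/\ open U, U w &
     continuous (fun x : set_type U => f (\val x))]) -> continuous f.
Proof.
move=> h w N Nf; have [U [oU Uw cU]] := h w.
pose w' : set_type U := SigSub (mem_set Uw).
have := cU w' N Nf; rewrite nbhs_simpl /= nbhsE => -[B [oB Bw BN]].
case: oB => O oO OB.
have OUw : nbhs w (O `&` U).
  apply: open_nbhs_nbhs; split; first exact: openI.
  by split=> //; have : (\val @^-1` O) w' by rewrite OB.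
apply: filterS OUw => x [Ox Ux].
by apply: (BN (SigSub (mem_set Ux))); rewrite -OB.
Qed.

Section contraction.
Context (R : realType) (T : finType) (K : {set {set T}}).
Hypothesis K_closed : forall s t : {set T}, s \in K -> t \subset s -> t \in K.

Definition bary (p : realization R K) : T -> R := \val p.

Lemma baryP p : realization_set R K (bary p).
Proof. by have := valP p; rewrite inE. Qed.

Lemma bary_ge0 p v : 0 <= bary p v. Proof. by have [h _ _] := baryP p. Qed.
Lemma bary_sum p : \sum_v bary p v = 1. Proof. by have [_ h _] := baryP p. Qed.

Lemma bary_ext p q : bary p =1 bary q -> p = q.
Proof. by move=> /funext e; apply: val_inj. Qed.

Lemma realization_sub (p : realization R K) (y : T -> R) :
  (forall v, 0 <= y v) -> \sum_v y v = 1 -> (forall v, bary p v = 0 -> y v = 0) ->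
  realization_set R K y.
Proof.
move=> y0 y1 py; split=> //; have [_ _ pK] := baryP p; apply: (K_closed pK).
by apply/fintype.subsetP => v; rewrite !inE; apply: contraNneq => /py ->.
Qed.

Lemma mkbaryP (y : T -> R) : realization_set R K y ->
  (y : {ptws T -> R}) \in realization_set R K.
Proof. by move=> h; apply/mem_set. Qed.

Definition mkbary (y : T -> R) (h : realization_set R K y) : realization R K :=
  SigSub (mkbaryP h).

Lemma cts_bary (W : topologicalType) (f : W -> realization R K) v :
  continuous f -> continuous (fun w => bary (f w) v).
Proof.
move=> cf; have cv : continuous (fun w => (\val (f w) : {ptws T -> R})).
  exact: cts_val.
exact: (cts_proj (I := T) (Z := R) (i := v) cv).
Qed.

Lemma cts_mkbary (W : topologicalType) (f : W -> realization R K) :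
  (forall v, continuous (fun w => bary (f w) v)) -> continuous f.
Proof. by move=> cf; apply: cts_sub; apply: cts_ptws. Qed.

Variable p0 : realization R K.

(** Nonzero exactly on the open star of [p0], where the segment to [p0] stays in the
    complex; [1] at [p0]. *)
Definition closeness (p : realization R K) : R :=
  \prod_(v | bary p0 v != 0) Num.min 1 (bary p v / bary p0 v).

Lemma closeness_factor p v : 0 <= Num.min 1 (bary p v / bary p0 v) <= 1.
Proof.
by rewrite le_min ler01 divr_ge0 ?bary_ge0 //= ge_min lexx.
Qed.

Lemma closeness_itv p : 0 <= closeness p <= 1.
Proof. by apply: prod_itv01 => v _; exact: closeness_factor. Qed.

Lemma closeness_self : closeness p0 = 1.
Proof. by rewrite /closeness big1 // => v v0; rewrite divff // (min_idPl _). Qed.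

Lemma cts_closeness : continuous closeness.
Proof.
apply: cts_prod => v; apply: cts_min; first exact: cts_cst.
by apply: cts_mul; [apply: cts_bary; cts|exact: cts_cst].
Qed.

Lemma closeness_star p v : closeness p != 0 -> bary p v = 0 -> bary p0 v = 0.
Proof.
move=> c0 pv; apply: contraNeq c0 => v0.
by rewrite /closeness (bigD1 v) //= pv mul0r (min_idPr ler01) mul0r.
Qed.

Definition pull_weight (w : realization R K * R) : R :=
  clamp w.2 * clamp (2 * closeness w.1).

Lemma pull_weight_itv w : 0 <= pull_weight w <= 1.
Proof.
rewrite /pull_weight mulr_ge0 ?clamp_ge0 //=.
by rewrite -[leRHS](mulr1 1) ler_pM ?clamp_ge0 ?clamp_le1.
Qed.

Lemma pullP (w : realization R K * R) : realization_set R K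
  (fun v => (1 - pull_weight w) * bary w.1 v + pull_weight w * bary p0 v).
Proof.
have /andP[l0 l1] := pull_weight_itv w.
apply: (realization_sub (p := w.1)) => [v||v pv].
- by rewrite addr_ge0 // mulr_ge0 ?subr_ge0 ?bary_ge0.
- by rewrite big_split /= -!mulr_sumr !bary_sum !mulr1 subrK.
- rewrite pv mulr0 add0r; have [c0|c0] := eqVneq (closeness w.1) 0.
    by rewrite /pull_weight c0 mulr0 clamp0 mulr0 mul0r.
  by rewrite (closeness_star c0 pv) mulr0.
Qed.

Definition pull w : realization R K := mkbary (pullP w).

Lemma bary_pull p t v : bary (pull (p, t)) v =
  (1 - pull_weight (p, t)) * bary p v + pull_weight (p, t) * bary p0 v.
Proof. by []. Qed.

Lemma cts_pull : continuous pull.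
Proof.
have cw : continuous pull_weight.
  apply: cts_mul; apply: cts_clamp; first by cts.
  by apply: cts_mul; [cts|apply: (cts_comp cts_closeness); cts].
apply: cts_mkbary => v.
have cb : continuous (fun w : realization R K * R => bary w.1 v).
  by apply: cts_bary; cts.
by rewrite /bary /pull /=; cts.
Qed.

Lemma pull0 p : pull (p, 0) = p.
Proof.
apply: bary_ext => v; rewrite bary_pull /pull_weight /= clamp0 !mul0r subr0.
by rewrite mul1r addr0.
Qed.

Lemma pull_self t : pull (p0, t) = p0.
Proof. by apply: bary_ext => v; rewrite bary_pull -mulrDl subrK mul1r. Qed.

Lemma pull1 p : 1 <= 2 * closeness p -> pull (p, 1) = p0.
Proof.
move=> h; apply: bary_ext => v.
by rewrite bary_pull /pull_weight /= clamp1 (clamp_ge1 h) mulr1 subrr mul0r mul1r add0r.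
Qed.

Lemma pull_supp p t v : bary p v = 0 -> bary (pull (p, t)) v = 0.
Proof.
move=> pv; rewrite bary_pull pv mulr0 add0r.
have [c0|c0] := eqVneq (closeness p) 0.
  by rewrite /pull_weight /= c0 mulr0 clamp0 mulr0 mul0r.
by rewrite (closeness_star c0 pv) mulr0.
Qed.

(** Points of the open star of [p0] are pulled to [p0] along segments, all the way if
    they are close enough. *)
Lemma realization_well_pointed : well_pointed R p0.
Proof.
exists pull, (fun p => clamp (2 * (1 - closeness p))); split.
- exact: cts_pull.
- by apply: cts_clamp; have c := cts_closeness; cts.
split=> [||y||y].
- exact: pull0.
- by move=> t _; exact: pull_self.
- by rewrite clamp_ge0 clamp_le1.
- by rewrite closeness_self subrr mulr0 clamp0.
- have [h|h] := leP 1 (2 * closeness y); first by rewrite pull1.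
  by rewrite clamp_ge1 ?ltxx //; lra.
Qed.

End contraction.

(** * The cone modulo the faces of some blocks *)

(** The Weierstrass product inequality. *)
Lemma prod_sub1_ge (R : realType) (I : finType) (P : pred I) (x : I -> R) :
  (forall i, 0 <= x i <= 1) -> 1 - \sum_(i | P i) x i <= \prod_(i | P i) (1 - x i).
Proof.
move=> x01.
suff : 1 - \sum_(i | P i) x i <= \prod_(i | P i) (1 - x i) <= 1 by case/andP.
elim/big_rec2: _ => [|i s p _]; first by rewrite subr0 !lexx.
have := x01 i; nra.
Qed.

Section partition_facts.
Context (T : finType) (K : {set {set T}}) (k : nat) (alpha : 'I_k -> {set T}).
Hypothesis K_complex : simplicial_complex K.
Hypothesis alpha_partition : partition_of_vertices K alpha.

Lemma block_unique v i j : v \in alpha i -> v \in alpha j -> i = j.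
Proof.
move=> vi vj; have [inj /and3P[_ /finset.trivIsetP tr _]] := alpha_partition.
apply: inj; apply: contraTeq vj => ij.
have im l : alpha l \in [set alpha i | i : 'I_k]%SET by apply: imset_f.
by have /disjointFr -> := tr _ _ (im i) (im j) ij.
Qed.

Lemma vertex_block (s : {set T}) v : s \in K -> v \in s -> exists i, v \in alpha i.
Proof.
move=> sK vs; have [_ /and3P[/eqP cov _ _]] := alpha_partition.
have : v \in vertices K.
  by rewrite inE (K_complex.2 _ _ sK) // finset.sub1set.
by rewrite -cov => /finset.bigcupP[A /imsetP[i _ ->] vi]; exists i.
Qed.

Lemma subcomplex_closed L (s t : {set T}) :
  s \in subcomplex K alpha L -> t \subset s -> t \in subcomplex K alpha L.
Proof.
rewrite !inE => /andP[sK sL] ts; rewrite (K_complex.2 _ _ sK ts) /=.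
apply: fintype.subset_trans sL; apply/fintype.subsetP => i; rewrite !inE.
apply: contraNneq => s0; rewrite -finset.subset0 -s0; exact: finset.setSI.
Qed.

Definition block_union (L : {set 'I_k}) : {set T} := (\bigcup_(i in L) alpha i)%SET.

Lemma subcomplexP L (s : {set T}) :
  s \in subcomplex K alpha L = (s \in K) && (s \subset block_union L).
Proof.
rewrite inE; case: (boolP (s \in K)) => //= sK; apply/fintype.subsetP/fintype.subsetP.
  move=> h v vs; have [i vi] := vertex_block sK vs.
  apply/finset.bigcupP; exists i => //; apply: h; rewrite inE.
  by apply/finset.set0Pn; exists v; rewrite inE vs.
move=> h i; rewrite inE => /finset.set0Pn[v]; rewrite inE => /andP[vs vi].
by have /finset.bigcupP[j jL vj] := h v vs; rewrite (block_unique vi vj).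
Qed.

End partition_facts.

Section cone_over_subcomplex.
Context (R : realType) (T : finType) (K : {set {set T}}) (k : nat).
Context (alpha : 'I_k -> {set T}).
Hypothesis K_complex : simplicial_complex K.
Hypothesis alpha_partition : partition_of_vertices K alpha.
Variable L : {set 'I_k}.
Local Notation KL := (subcomplex K alpha L).
Variable b : {v : T | v \in vertices KL}.
Let VL := block_union alpha L.
Local Notation RK := (realization R KL).

Let KL_closed : forall s t : {set T}, s \in KL -> t \subset s -> t \in KL.
Proof. exact: subcomplex_closed. Qed.

Let KLP (s : {set T}) : s \in KL = (s \in K) && (s \subset VL).
Proof. exact: subcomplexP. Qed.

Lemma bary_off (y : RK) v : v \notin VL -> bary y v = 0.
Proof.
move=> vL; have [_ _ ] := baryP y; rewrite KLP => /andP[_ /fintype.subsetP h].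
by apply: contraNeq vL => yv; apply: h; rewrite inE.
Qed.

Lemma in_cubes_b : in_cubes K (fun v => (v == \val b)%:R : R).
Proof.
split=> [v|]; first by case: (_ == _); rewrite /= ?lexx ?ler01.
have -> : [set v | (v == \val b)%:R != 0 :> R]%SET = [set \val b]%SET.
  by apply/setP => v; rewrite !inE; case: (v == \val b); rewrite /= ?oner_eq0 ?eqxx.
by have := valP b; rewrite /= inE KLP => /andP[].
Qed.

Definition base_vertex : cubes R K := mkcubes in_cubes_b.

Lemma b_in_VL : \val b \in VL.
Proof.
have := valP b; rewrite /= inE KLP => /andP[_].
by rewrite finset.sub1set.
Qed.

Lemma base_vertex_coord : ccoord base_vertex (\val b) = 1.
Proof. by rewrite /ccoord /= eqxx. Qed.

Lemma collapsedLP (d : model R K k) :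
  collapsed alpha finset.set0 L d <-> exists2 v, v \in VL & ccoord d.1 v = 1.
Proof.
split=> [[[i iL [v vi xv]]|[j]]|[v /finset.bigcupP[i iL vi] xv]].
- by exists v => //; apply/finset.bigcupP; exists i.
- by rewrite inE.
- by left; exists i => //; exists v.
Qed.

Let n : R := #|T|%:R.

Let n_ge1 : 1 <= n.
Proof. by rewrite /n ler1n; apply/card_gt0P; exists (\val b). Qed.

(** Radial projection from the simplices to the faces of the cubes, up to homotopy: as
    some barycentric coordinate is at least [1 / n], some coordinate is [1]. *)
Definition clip (y : RK) v : R := Num.min 1 (n * bary y v).

Lemma clip_itv y v : 0 <= clip y v <= 1.
Proof.
by rewrite /clip le_min ler01 ge_min lexx mulr_ge0 ?bary_ge0 // /n ler0n.
Qed.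

Lemma clip_eq0 y v : bary y v = 0 -> clip y v = 0.
Proof. by move=> yv; rewrite /clip yv mulr0 (min_idPr ler01). Qed.

Lemma clip_eq1 y : exists2 v, v \in VL & clip y v = 1.
Proof.
have [/existsP[v /andP[vL h]]|no] := boolP [exists v, (v \in VL) && (1 <= n * bary y v)].
  by exists v => //; apply/min_idPl.
suff : n < n by rewrite ltxx.
have small v : n * bary y v < 1.
  have [vL|vL] := boolP (v \in VL); last by rewrite bary_off // mulr0.
  by rewrite ltNge; apply: contraNN no => h; apply/existsP; exists v; rewrite vL.
have : \sum_v n * bary y v < \sum_(v : T) 1.
  by apply: ltr_sum => //; apply/hasP; exists (\val b); rewrite ?mem_index_enum.
by rewrite -mulr_sumr bary_sum mulr1 sumr_const.
Qed.

Lemma clip_sum_ge1 y : 1 <= \sum_v clip y v.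
Proof.
have [v _ h] := clip_eq1 y; rewrite (bigD1 v) //= h lerDl sumr_ge0 // => w _.
by case/andP: (clip_itv y w).
Qed.

Lemma cts_clip (W : topologicalType) (f : W -> RK) v :
  continuous f -> continuous (fun w => clip (f w) v).
Proof.
move=> cf; apply: cts_min; first exact: cts_cst.
by apply: cts_mul; [exact: cts_cst|exact: cts_bary].
Qed.

(** The height [t] of the cylinder over the complex becomes the distance from the
    face, the height [1] becomes the cone point. *)
Lemma cone_ptP (w : RK * R) : in_cubes K (fun v => (1 - clamp w.2) * clip w.1 v).
Proof.
have t0 := clamp_ge0 w.2; have t1 := clamp_le1 w.2; split=> [v|].
  have /andP[c0 c1] := clip_itv w.1 v; nra.
have [_ _ ] := baryP w.1; rewrite KLP => /andP[sK _]; apply: (K_complex.2 _ _ sK).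
apply/fintype.subsetP => v; rewrite !inE; apply: contraNneq => /clip_eq0 ->.
by rewrite mulr0.
Qed.

Definition cone_pt w : cubes R K := mkcubes (cone_ptP w).

Lemma coord_cone y t v : ccoord (cone_pt (y, t)) v = (1 - clamp t) * clip y v.
Proof. by []. Qed.

Lemma cts_cone_pt : continuous cone_pt.
Proof.
apply: cts_mkcubes => v; rewrite /ccoord /=; apply: cts_mul.
  by apply: cts_add; [exact: cts_cst|apply: cts_opp; apply: cts_clamp; cts].
by apply: cts_clip; cts.
Qed.

Definition mass (x : cubes R K) : R := \sum_(v in VL) ccoord x v.
(** The distance from the union of the faces in [L], up to homotopy: zero exactly on it,
    and [1] exactly where all coordinates in [VL] vanish. *)
Definition height (x : cubes R K) : R := \prod_(v in VL) (1 - ccoord x v).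

Lemma cts_mass : continuous mass.
Proof. by apply: cts_sum => v; apply: cts_coord; cts. Qed.

Lemma cts_height : continuous height.
Proof.
apply: cts_prod => v; apply: cts_add; first exact: cts_cst.
by apply: cts_opp; apply: cts_coord; cts.
Qed.

Lemma mass_le x : mass x <= n.
Proof.
rewrite /mass /n -sum1_card natr_sum [leRHS](bigID (mem VL)) /=.
apply: (@le_trans _ _ (\sum_(v in VL) 1)).
  by apply: ler_sum => v _; case/andP: (coord01 x v).
by rewrite lerDl sumr_ge0.
Qed.

Lemma height_mass x : 1 - mass x <= height x.
Proof. by apply: prod_sub1_ge => v; exact: coord01. Qed.

Lemma height0 x v : v \in VL -> ccoord x v = 1 -> height x = 0.
Proof. by move=> vL xv; rewrite /height (bigD1 v) //= xv subrr mul0r. Qed.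

Lemma height1 x : (forall v, v \in VL -> ccoord x v = 0) -> height x = 1.
Proof. by move=> h; rewrite /height big1 // => v vL; rewrite h // subr0. Qed.

Lemma radialP (x : cubes R K) : 0 < mass x -> realization_set R KL
  (fun v => if v \in VL then ccoord x v / mass x else 0).
Proof.
move=> m0; split=> [v||].
- by case: ifP => // _; rewrite divr_ge0 ?(ltW m0) //; case/andP: (coord01 x v).
- rewrite -big_mkcond /= -mulr_suml divff ?lt0r_neq0 //.
- rewrite KLP; apply/andP; split.
    have [_ sK] := coordP x; apply: (K_complex.2 _ _ sK).
    apply/fintype.subsetP => v; rewrite !inE; case: ifP => _; last by rewrite eqxx.
    by apply: contraNneq => ->; rewrite mul0r.
  by apply/fintype.subsetP => v; rewrite !inE; case: ifP; rewrite ?eqxx.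
Qed.

Definition b_pt : RK := vertex_point R b.

(** Where the mass vanishes there is no direction to project along; [cone_height] is [1]
    there, which makes the point a pole of the suspension. *)
Definition radial (x : cubes R K) : RK :=
  if pselect (0 < mass x) is left h then mkbary (radialP h) else b_pt.

Lemma bary_radial x v : 0 < mass x ->
  bary (radial x) v = if v \in VL then ccoord x v / mass x else 0.
Proof. by rewrite /radial; case: pselect. Qed.

(** Doubled so that it is [1] already near the points without radial projection. *)
Definition cone_height x : R := clamp (2 * height x).

Lemma cts_cone_height : continuous cone_height.
Proof. by apply: cts_clamp; have c := cts_height; cts. Qed.

Definition unroll (x : cubes R K) : ususp R RK := ususp_pt (radial x, cone_height x).

Lemma cts_unroll : continuous unroll.
Proof.
have cU := @cts_ususp_pt R RK; have ch := cts_cone_height; have cm := cts_mass.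
apply: cts_open_cover => x.
have op (c : R) : open [set y | c < mass y].
  rewrite openE => y /= my; exact: (near_lt (@cts_cst _ _ c) cm).
have op' (c : R) : open [set y | mass y < c].
  rewrite openE => y /= my; exact: (near_lt cm (@cts_cst _ _ c)).
have [m0|m0] := ltP 0 (mass x).
  exists [set y | 0 < mass y]; split=> //.
  have cv : continuous (fun y : set_type [set y | 0 < mass y] => \val y).
    by apply: cts_val; exact: cts_id.
  have pos (y : set_type [set y | 0 < mass y]) : 0 < mass (\val y).
    by have := valP y; rewrite inE.
  have cp : continuous (fun y : set_type [set y | 0 < mass y] => radial (\val y)).
    apply: cts_mkbary => v.
    have -> : (fun y : set_type [set y | 0 < mass y] => bary (radial (\val y)) v) =
       (fun y => if v \in VL then ccoord (\val y) v / mass (\val y) else 0).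
      by apply/funext => y; rewrite bary_radial.
    case: (v \in VL); last exact: cts_cst.
    apply: cts_mul; first exact: cts_coord.
    by apply: cts_inv => [|y]; [exact: (cts_comp cm cv)|rewrite lt0r_neq0].
  rewrite /unroll; apply: (cts_comp cU); apply: cts_pair => //.
  exact: (cts_comp ch cv).
exists [set y | mass y < 1 / 2]; split=> //=; first by lra.
have -> : (fun y : set_type [set y | mass y < 1 / 2] => unroll (\val y)) =
    (fun=> ususp_pt (b_pt, 1)).
  apply/funext => y; have : mass (\val y) < 1 / 2 by have := valP y; rewrite inE.
  move=> my; apply: ususp_pt1 => //; rewrite /cone_height clamp_ge1 //.
  by have := height_mass (\val y); lra.
exact: cts_cst.
Qed.

(** The composite of [unroll] and [cone_pt] (see [thin_coneE]), in a form that is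
    continuous where [radial] is not: for [mass x <= 1 / 2], where the maximum has an
    effect, [cone_height x = 1]. *)
Definition thin_cone (x : cubes R K) (v : T) : R :=
  if v \in VL then (1 - cone_height x) * Num.min 1 (n * (ccoord x v / Num.max (mass x) 2^-1))
  else 0.

Lemma cone_height_itv x : 0 <= cone_height x <= 1.
Proof. by rewrite /cone_height clamp_ge0 clamp_le1. Qed.

Lemma thin_cone_itv x v : 0 <= thin_cone x v <= 1.
Proof.
rewrite /thin_cone; case: ifP => _; last by rewrite lexx ler01.
have /andP[h0 h1] := cone_height_itv x; have /andP[x0 _] := coord01 x v.
have : 0 <= Num.min 1 (n * (ccoord x v / Num.max (mass x) 2^-1)) <= 1.
  rewrite le_min ler01 ge_min lexx /= andbT; apply: mulr_ge0.
    by rewrite /n ler0n.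
  by rewrite divr_ge0 // le_max invr_ge0 ler0n orbT.
by move=> /andP[m0 m1]; nra.
Qed.

Lemma cts_thin_cone v : continuous (thin_cone^~ v).
Proof.
rewrite /thin_cone; case: (v \in VL); last exact: cts_cst.
have ch := cts_cone_height; have cm := cts_mass.
have cv : continuous (fun x : cubes R K => ccoord x v) by apply: cts_coord; cts.
have ci : continuous (fun x : cubes R K => (Num.max (mass x) 2^-1)^-1).
  apply: cts_inv; first by cts.
  by move=> x; rewrite lt0r_neq0 // lt_max invr_gt0 ltr0n orbT.
by cts.
Qed.

Lemma thin_coneE x v : thin_cone x v = ccoord (cone_pt (radial x, cone_height x)) v.
Proof.
rewrite coord_cone /thin_cone (clamp_id (cone_height_itv x)).
have [h1|h1] := leP 1 (2 * height x).
  by rewrite /cone_height (clamp_ge1 h1) subrr !mul0r if_same.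
have m2 : 2^-1 < mass x by have := height_mass x; lra.
have m0 : 0 < mass x by lra.
rewrite /clip bary_radial //; case: ifP => _.
  by rewrite (max_idPl _) // ltW.
by rewrite mulr0 (min_idPr ler01) mulr0.
Qed.

Lemma thin_cone_face x v : v \in VL -> ccoord x v = 1 -> thin_cone x v = 1.
Proof.
move=> vL xv; rewrite /thin_cone vL xv /cone_height (height0 vL xv) mulr0 clamp0.
rewrite subr0 mul1r mul1r; apply/min_idPl.
have m0 : 0 < Num.max (mass x) 2^-1 by rewrite lt_max invr_gt0 ltr0n orbT.
rewrite ler_pdivlMr // mul1r ge_max mass_le /=.
by apply: le_trans n_ge1; lra.
Qed.

Lemma thinP (w : cubes R K * R) : in_cubes K (fun v =>
  (1 - clamp w.2) * thin_cone w.1 v + clamp w.2 * ccoord w.1 v).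
Proof.
have t0 := clamp_ge0 w.2; have t1 := clamp_le1 w.2.
apply: (in_cubes_sub K_complex (x := w.1)) => v.
  have /andP[a0 a1] := thin_cone_itv w.1 v; have /andP[x0 x1] := coord01 w.1 v; nra.
move=> xv; rewrite xv mulr0 addr0 /thin_cone xv mul0r mulr0 (min_idPr ler01) mulr0.
by rewrite if_same mulr0.
Qed.

Definition thin w : cubes R K := mkcubes (thinP w).

Lemma coord_thin x t v : ccoord (thin (x, t)) v =
  (1 - clamp t) * thin_cone x v + clamp t * ccoord x v.
Proof. by []. Qed.

Lemma cts_thin : continuous thin.
Proof.
apply: cts_mkcubes => v; rewrite /ccoord /=.
have c1 : continuous (fun w : cubes R K * R => clamp w.2) by apply: cts_clamp; cts.
have c2 : continuous (fun w : cubes R K * R => ccoord w.1 v) by apply: cts_coord; cts.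
by have c3 := cts_thin_cone (v := v); cts.
Qed.

Lemma thin_face x t v : v \in VL -> ccoord x v = 1 -> ccoord (thin (x, t)) v = 1.
Proof. by move=> vL xv; rewrite coord_thin thin_cone_face // xv !mulr1 subrK. Qed.

Lemma mass_cone y t : mass (cone_pt (y, t)) = (1 - clamp t) * \sum_v clip y v.
Proof.
have off : \sum_(v | v \notin VL) clip y v = 0.
  by apply: big1 => v vL; rewrite clip_eq0 // bary_off.
by rewrite [in RHS](bigID (mem VL)) /= off addr0 mulr_sumr.
Qed.

Lemma normalP (w : RK * R) : realization_set R KL (fun v =>
  (1 - clamp w.2) * (clip w.1 v / \sum_u clip w.1 u) + clamp w.2 * bary w.1 v).
Proof.
have t0 := clamp_ge0 w.2; have t1 := clamp_le1 w.2.
have s1 := clip_sum_ge1 w.1; have s0 : 0 < \sum_u clip w.1 u by lra.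
apply: (realization_sub KL_closed (p := w.1)) => [v||v yv].
- have /andP[c0 _] := clip_itv w.1 v; rewrite addr_ge0 // mulr_ge0 ?bary_ge0 ?subr_ge0 //.
  by rewrite divr_ge0 // ltW.
- rewrite big_split /= -!mulr_sumr -mulr_suml divff ?lt0r_neq0 // bary_sum.
  by rewrite !mulr1 subrK.
- by rewrite yv clip_eq0 // mul0r !mulr0 addr0.
Qed.

(** From the other composite (see [radial_cone]) to the identity, within a simplex. *)
Definition normal w : RK := mkbary (normalP w).

Lemma bary_normal y t v : bary (normal (y, t)) v =
  (1 - clamp t) * (clip y v / \sum_u clip y u) + clamp t * bary y v.
Proof. by []. Qed.

Lemma cts_normal : continuous normal.
Proof.
apply: cts_mkbary => v; rewrite /bary /=.
have c1 : continuous (fun w : RK * R => clamp w.2) by apply: cts_clamp; cts.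
have c2 : continuous (fun w : RK * R => bary w.1 v) by apply: cts_bary; cts.
have c3 u : continuous (fun w : RK * R => clip w.1 u) by apply: cts_clip; cts.
have c4 : continuous (fun w : RK * R => (\sum_u clip w.1 u)^-1).
  apply: cts_inv => [|w]; first exact: cts_sum.
  by rewrite lt0r_neq0 //; have := clip_sum_ge1 w.1; lra.
have c5 := c3 v; by cts.
Qed.

Lemma radial_cone y t : clamp t < 1 -> radial (cone_pt (y, t)) = normal (y, 0).
Proof.
move=> t1; have s1 := clip_sum_ge1 y.
have m0 : 0 < mass (cone_pt (y, t)) by rewrite mass_cone mulr_gt0 //; lra.
apply: bary_ext => v; rewrite bary_radial // bary_normal clamp0 subr0 mul1r mul0r addr0.
case: ifPn => vL; last by rewrite clip_eq0 ?mul0r // bary_off.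
rewrite mass_cone coord_cone -mulf_div divff ?mul1r //.
by rewrite lt0r_neq0 //; lra.
Qed.

(** The cone modulo the faces of the blocks in [L] is a suspension of the subcomplex
    spanned by [L]: coordinates outside of [VL] can be shrunk to zero, which leaves
    the cone on that subcomplex modulo its base. *)
Theorem cone_quotient_is_suspension :
  pequiv R (pointed_at (pole R b_pt))
    (pointed_at (cls alpha finset.set0 L finset.set0 (base_vertex, @torus1 R k))).
Proof.
pose Y := pointed_at (cls alpha finset.set0 L finset.set0 (base_vertex, @torus1 R k)).
pose U := pointed_at (pole R b_pt).
pose c : model R K k -> Y := cls alpha finset.set0 L finset.set0.
have cc : continuous c by exact: cts_cls.
have cU := @cts_ususp_pt R RK.
have ccone := cts_cone_pt.
have c0 (d : model R K k) v : v \in VL -> ccoord d.1 v = 1 -> c d = point.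
  move=> vL dv; apply: cls_collapsed; apply/collapsedLP; first by exists v.
  by exists (\val b); [exact: b_in_VL|exact: base_vertex_coord].
have cE x g g' : c (x, g) = c (x, g') by apply: cls_eq => i; rewrite inE.
pose f0 (w : RK * R) : Y := c (cone_pt w, @torus1 R k).
have cf0 : continuous f0 by rewrite /f0; cts.
have f00 y : f0 (y, 0) = point.
  have [v vL yv] := clip_eq1 y; apply: (c0 _ v vL).
  by rewrite coord_cone clamp0 subr0 mul1r.
have f01 y y' : f0 (y, 1) = f0 (y', 1).
  congr (c (_, _)); apply: cubes_ext => v.
  by rewrite !coord_cone clamp1 subrr !mul0r.
have [|f cf fE] := ususp_lift cf0 _ f01; first by move=> y y'; rewrite !f00.
have fE' y (t : R) : f (ususp_pt (y, t)) = f0 (y, t).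
  rewrite /ususp_pt -cyl_clamp [LHS]fE ?clamp_ge0 ?clamp_le1 //; congr (c (_, _)).
  by apply: cubes_ext => v; rewrite !coord_cone (clamp_id (_ : 0 <= clamp t <= 1)) // clamp_ge0 clamp_le1.
have pf : @ptmap U Y f by split=> //; rewrite [LHS]fE' f00.
have unroll0 x v : v \in VL -> ccoord x v = 1 -> unroll x = (point : U).
  move=> vL xv; rewrite /unroll; apply: ususp_pt0 => //.
  by rewrite /cone_height (height0 vL xv) mulr0 clamp0.
have [g cg gE] : exists2 g : Y -> U, continuous g & forall d, g (c d) = unroll d.1.
  apply: (@cls_lift _ _ _ _ alpha finset.set0 L finset.set0 U (fun d => unroll d.1)).
    by apply: (cts_comp cts_unroll); cts.
  move=> d d' [[/collapsedLP[v vL dv] /collapsedLP[v' vL' dv']]|[-> //]].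
  by rewrite (unroll0 _ v) // (unroll0 _ v').
have pg : @ptmap Y U g.
  split=> //; rewrite [LHS]gE; apply: (unroll0 _ (\val b)); first exact: b_in_VL.
  exact: base_vertex_coord.
have cs (y : Y) : exists d, c d = y by exact: cls_surj.
exists f, g; split=> //.
- have ch := cts_cone_height; have cn := cts_normal.
  apply: (@ususp_phom R RK U b_pt _ _ (fun w => ususp_pt (normal (w.1.1, w.2),
    (1 - w.2) * cone_height (cone_pt w.1) + w.2 * w.1.2))).
  + have h : continuous (fun w : RK * R * R => cone_height (cone_pt w.1)).
      by apply: (cts_comp ch); apply: (cts_comp ccone); cts.
    by cts.
  + move=> y s s01; apply: ususp_pt0 => //=; have [v vL yv] := clip_eq1 y.
    rewrite /cone_height (@height0 _ v vL) ?mulr0 ?clamp0 ?mulr0 ?addr0 //.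
    by rewrite coord_cone clamp0 subr0 mul1r.
  + have h1 y : cone_height (cone_pt (y, 1)) = 1.
      rewrite /cone_height height1 ?mulr1 ?clamp_ge1 ?ler1n // => v vL.
      by rewrite coord_cone clamp1 subrr mul0r.
    move=> y y' s s01; apply: ususp_pt1; rewrite /= h1; lra.
  + move=> y t t01; rewrite fE' gE /= /unroll subr0 mul1r mul0r addr0.
    have [t1|t1] := leP 1 (clamp t); last by rewrite radial_cone.
    have h1 : cone_height (cone_pt (y, t)) = 1.
      rewrite /cone_height height1 ?mulr1 ?clamp_ge1 ?ler1n // => v vL.
      by rewrite coord_cone; have := clamp_le1 t => t2; rewrite (_ : clamp t = 1) ?subrr ?mul0r //; apply: le_anti; rewrite t2.
    by rewrite h1; apply: ususp_pt1.
  + move=> y t t01; rewrite /= subrr mul0r add0r mul1r; congr (ususp_pt (_, _)).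
    by apply: bary_ext => v; rewrite bary_normal clamp1 subrr mul0r add0r mul1r.
- have ct := cts_thin.
  have [||H cH HE] := @cls_liftR _ _ _ _ alpha finset.set0 L finset.set0 Y
      (fun w => c (thin (w.1.1, w.2), w.1.2)).
  + by cts.
  + move=> d d' t [[/collapsedLP[v vL dv] /collapsedLP[v' vL' dv']]|[-> _]]; last exact: cE.
    by rewrite (c0 _ v) ?(c0 _ v') //= thin_face.
  exists H => //; split=> [y|y|t].
  + have [[x h] <-] := cs y; rewrite [LHS]HE gE /unroll fE' /f0 (cE _ _ (@torus1 R k)).
    congr (c (_, _)); apply: cubes_ext => v.
    by rewrite coord_thin clamp0 subr0 mul1r mul0r addr0 thin_coneE.
  + have [[x h] <-] := cs y; rewrite [LHS]HE /=; congr (c (_, _)).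
    apply: cubes_ext => v.
    by rewrite coord_thin clamp1 subrr mul1r mul0r add0r.
  + rewrite [LHS]HE; apply: (c0 _ (\val b)); first exact: b_in_VL.
    by rewrite thin_face //; [exact: b_in_VL|exact: base_vertex_coord].
Qed.

End cone_over_subcomplex.

(** * The summands *)

Lemma pequiv_point (R : realType) (Y : topologicalType) (y y' : Y) :
  y = y' -> pequiv R (pointed_at y) (pointed_at y').
Proof. by move=> ->; exact: pequiv_refl. Qed.

Lemma pequiv_contractible (R : realType) (Y : ptopologicalType) :
  phom R (fun _ : Y => (point : Y)) id -> pequiv R Y one_point.
Proof.
move=> h; exists (fun=> point), (fun=> point); split=> //; try exact: ptmap_cst.
by apply: phom_ext (phom_refl R (ptmap_cst one_point one_point)) _ _ => // -[].
Qed.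

Section summands.
Context (R : realType) (T : finType) (K : {set {set T}}) (k : nat).
Context (alpha : 'I_k -> {set T}).
Hypothesis K_complex : simplicial_complex K.
Hypothesis alpha_partition : partition_of_vertices K alpha.
Local Notation V A E := (partial_smash R alpha K_complex A E).

Lemma in_cubes_scale (w : cubes R K * R) :
  in_cubes K (fun v => clamp w.2 * ccoord w.1 v).
Proof.
apply: (in_cubes_sub K_complex (x := w.1)) => v; last by move=> ->; rewrite mulr0.
have := clamp_ge0 w.2; have := clamp_le1 w.2; have := coord01 w.1 v; nra.
Qed.

Lemma partial_smash_cone_contractible : pequiv R (V finset.set0 finset.set0) one_point.
Proof.
pose scale w : cubes R K := mkcubes (in_cubes_scale w).
have scaleE x t v : ccoord (scale (x, t)) v = clamp t * ccoord x v by [].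
have cs : continuous scale.
  apply: cts_mkcubes => v; rewrite /ccoord /=; apply: cts_mul.
    by apply: cts_clamp; cts.
  by apply: cts_coord; cts.
pose c : model R K k -> V finset.set0 finset.set0 :=
  cls alpha finset.set0 finset.set0 finset.set0.
have cc : continuous c by exact: cts_cls.
have cE x g g' : c (x, g) = c (x, g') by apply: cls_eq => i; rewrite inE.
have no (d : model R K k) : ~ collapsed alpha finset.set0 finset.set0 d.
  by case=> -[j]; rewrite inE.
apply: pequiv_contractible.
have [||H cH HE] := @cls_liftR _ _ _ _ alpha finset.set0 finset.set0 finset.set0
    (V finset.set0 finset.set0) (fun w => c (scale (w.1.1, w.2), w.1.2)).
- by cts.
- move=> [x g] [x' g'] t [[/no //]|[/= -> _]]; exact: cE.
have cl (y : V finset.set0 finset.set0) : exists d, c d = y by exact: cls_surj.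
exists H => //; split=> [y|y|t].
- have [[x g] <-] := cl y; rewrite [LHS]HE (cE _ _ (@torus1 R k)); congr (c (_, _)).
  by apply: cubes_ext => v; rewrite scaleE clamp0 mul0r.
- have [[x g] <-] := cl y; rewrite [LHS]HE; congr (c (_, _)).
  by apply: cubes_ext => v; rewrite scaleE clamp1 mul1r.
- rewrite [LHS]HE; congr (c (_, _)).
  by apply: cubes_ext => v; rewrite scaleE mulr0.
Qed.

Lemma susp_one_point : pequiv R (reduced_susp R one_point) one_point.
Proof.
apply: pequiv_contractible.
apply: phom_ext (phom_refl R (ptmap_id _)) _ _ => // z.
by move: z; apply: susp_ind => -[] t _; rewrite susp_ptp.
Qed.

(** For [L] not empty, the smash piece of [L] is the [#|L|]-fold suspension of the cone
    modulo the faces of [L], hence of one more suspension of the subcomplex; the last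
    suspension is the outer one. For [L] empty it is the cone itself. *)
Theorem summand_pequiv (b : forall L : {set 'I_k}, L != finset.set0 ->
    {v : T | v \in vertices (subcomplex K alpha L)}) (L : {set 'I_k}) :
  pequiv R (reduced_susp R (V L L)) (summand R b L).
Proof.
rewrite /summand; case: {-}_ / idP => [nzL|/negP/negPn/eqP ->]; last first.
  exact: pequiv_trans (susp_pequiv partial_smash_cone_contractible) susp_one_point.
pose d0 : model R K k := (base_vertex R K_complex alpha_partition (b L nzL), @torus1 R k).
have d0L : collapsed alpha finset.set0 L d0.
  apply/collapsedLP; exists (\val (b L nzL)); first exact: b_in_VL.
  exact: base_vertex_coord.
rewrite addn2 iterS; apply: susp_pequiv; rewrite iterSr.
have e1 : pequiv R (V L L) (pointed_at (cls alpha L L L d0)).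
  apply: pequiv_point; apply: cls_collapsed; last exact: collapsedL.
  by right; have /finset.set0Pn[i iL] := nzL; exists i.
apply: pequiv_trans e1 _.
apply: pequiv_trans (circle_coordinates_susp d0L (fintype.subxx L)) _.
apply: susp_iter_pequiv.
apply: pequiv_trans (pequiv_sym (cone_quotient_is_suspension R K_complex alpha_partition (b L nzL))) _.
apply: pequiv_sym; apply: susp_ususp; apply: realization_well_pointed.
exact: subcomplex_closed.
Qed.

End summands.

(** * The cone on the barycentric subdivision as a union of cubes *)

Section big_bounds.
Context (R : realType) (I : finType).
Implicit Types (P : pred I) (x : I -> R).

Lemma cts_bigmin (W : topologicalType) P (F : I -> W -> R) (c : R) :
  (forall i, continuous (F i)) ->
  continuous (fun w => \big[Num.min/c]_(i | P i) F i w).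
Proof.
move=> cF; elim: (index_enum I) => [|i r IH].
  by under eq_fun do rewrite big_nil; exact: cts_cst.
under eq_fun do rewrite big_cons.
by case: (P i) => //; apply: cts_min.
Qed.

Lemma cts_bigmax (W : topologicalType) P (F : I -> W -> R) (c : R) :
  (forall i, continuous (F i)) ->
  continuous (fun w => \big[Num.max/c]_(i | P i) F i w).
Proof.
move=> cF; elim: (index_enum I) => [|i r IH].
  by under eq_fun do rewrite big_nil; exact: cts_cst.
under eq_fun do rewrite big_cons.
by case: (P i) => //; apply: cts_max.
Qed.

End big_bounds.

Section chains.
Context (T : finType) (K : {set {set T}}).

Lemma order_complexP (c : {set {set T}}) : reflect
  ((forall s, s \in c -> s \in K) /\
   (forall s t, s \in c -> t \in c -> (s \subset t) || (t \subset s)))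
  (c \in order_complex K).
Proof.
rewrite inE; apply: (iffP andP) => -[h1 h2]; split.
- by move=> s; exact: (fintype.subsetP h1).
- by move=> s t sc tc; have /forall_inP/(_ s sc)/forall_inP/(_ t tc) := h2.
- exact/fintype.subsetP.
- by apply/forall_inP => s sc; apply/forall_inP => t tc; exact: h2.
Qed.

Lemma order_complex_closed (c d : {set {set T}}) :
  c \in order_complex K -> d \subset c -> d \in order_complex K.
Proof.
move=> /order_complexP[h1 h2] /fintype.subsetP dc; apply/order_complexP.
by split=> [s /dc /h1 //|s t /dc sc /dc tc]; exact: h2.
Qed.

Lemma chain_max (D : {set {set T}}) : D != finset.set0 ->
  (forall s t, s \in D -> t \in D -> (s \subset t) || (t \subset s)) ->
  exists2 m, m \in D & forall s, s \in D -> s \subset m.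
Proof.
move=> /finset.set0Pn[s0 s0D] ch.
case: (@arg_maxnP _ s0 (mem D) (fun s : {set T} => #|s|) s0D) => m mD mmax.
exists m => // s sD; have /orP[//|ms] := ch s m sD mD.
suff -> : m = s by [].
by apply/eqP; rewrite finset.eqEcard ms; exact: mmax.
Qed.

Lemma chain_min (D : {set {set T}}) : D != finset.set0 ->
  (forall s t, s \in D -> t \in D -> (s \subset t) || (t \subset s)) ->
  exists2 m, m \in D & forall s, s \in D -> m \subset s.
Proof.
move=> /finset.set0Pn[s0 s0D] ch.
case: (@arg_minnP _ s0 (mem D) (fun s : {set T} => #|s|) s0D) => m mD mmin.
exists m => // s sD; have /orP[sm|//] := ch s m sD mD.
suff -> : s = m by [].
by apply/eqP; rewrite finset.eqEcard sm; exact: mmin.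
Qed.

End chains.

Section cone_as_cubes.
Context (R : realType) (T : finType) (K : {set {set T}}).
Hypothesis K_complex : simplicial_complex K.
Local Notation P := (P_space R K).
Local Notation OC := (order_complex K).
Implicit Types (p : P) (x : cubes R K) (s t : {set T}).

Definition wt (p : P) : {set T} -> R := bary p.

Lemma wt_chain p s t : wt p s != 0 -> wt p t != 0 -> (s \subset t) || (t \subset s).
Proof.
by have [_ _ /order_complexP[_ h]] := baryP p => ps pt; apply: h; rewrite inE.
Qed.

Lemma wt_simplex p s : wt p s != 0 -> s \in K.
Proof. by have [_ _ /order_complexP[h _]] := baryP p => ps; apply: h; rewrite inE. Qed.

Lemma wt_supp_neq0 p : [set s | wt p s != 0]%SET != finset.set0.
Proof.
apply/eqP => p0; have := bary_sum p; rewrite big1 => [/esym/eqP|s _].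
  by rewrite oner_eq0.
by apply/eqP/negPn/negP => ps; have := finset.in_set0 s; rewrite -p0 inE ps.
Qed.

Lemma faceP s p : s \in K -> face s p <-> (forall t, wt p t != 0 -> s \subset t).
Proof.
move=> sK; have [p0 p1 /order_complexP[pK pch]] := baryP p; split.
  move=> [_ _ /order_complexP[h _]] t pt.
  have : t \in up_set K s by apply: h; rewrite inE.
  by rewrite inE => /andP[].
move=> h; split=> //; apply/order_complexP; split=> // t; rewrite inE => pt.
by rewrite inE h // andbT; apply: wt_simplex pt.
Qed.

Lemma to_cubesP p : in_cubes K (fun v => \sum_(s : {set T} | v \in s) wt p s).
Proof.
split=> [v|].
  rewrite sumr_ge0 /=; last by move=> s _; exact: bary_ge0.
  rewrite -[leRHS](bary_sum p) [leRHS](bigID (fun s : {set T} => v \in s)) /=.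
  by rewrite lerDl sumr_ge0 // => s _; exact: bary_ge0.
have [|m mD mmax] := chain_max (wt_supp_neq0 p).
  by move=> s t; rewrite !inE; exact: wt_chain.
rewrite inE in mD; apply: (K_complex.2 _ _ (wt_simplex mD)).
apply/fintype.subsetP => v; rewrite inE; apply: contraNT => vm.
apply/eqP; apply: big1 => s vs; apply/eqP; apply: contraNT vm => ps.
by apply: (fintype.subsetP (mmax s _)); rewrite ?inE.
Qed.

(** Piecewise linear, sending the vertex [s] to the indicator function of [s]. *)
Definition to_cubes p : cubes R K := mkcubes (to_cubesP p).

Lemma coord_to_cubes p v : ccoord (to_cubes p) v = \sum_(s : {set T} | v \in s) wt p s.
Proof. by []. Qed.

Lemma cts_to_cubes : continuous to_cubes.
Proof.
apply: cts_mkcubes => v; rewrite /ccoord /=; apply: cts_sum => s.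
by apply: cts_bary; cts.
Qed.

(** The length of the range of thresholds [c] in [0, 1] for which [s] is the set of
    the [v] with [x v > c]. These sets are the barycentric chain of [x], and the
    lengths are its coordinates. The empty set has the range from the maximum of [x]
    to [1], which the default values of the big operators account for. *)
Definition level x s : R := Num.max 0
  (\big[Num.min/1]_(v in s) ccoord x v - \big[Num.max/0]_(v | v \notin s) ccoord x v).

Lemma level_ge0 x s : 0 <= level x s.
Proof. by rewrite /level le_max lexx. Qed.

Lemma cts_level s : continuous (level^~ s).
Proof.
apply: cts_max; first exact: cts_cst.
by apply: cts_add; [apply: cts_bigmin|apply: cts_opp; apply: cts_bigmax] => v;
  apply: cts_coord; cts.
Qed.

Lemma level_neq0 x s : level x s != 0 ->
  [/\ forall v w, v \in s -> w \notin s -> ccoord x w < ccoord x v,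
      forall v, v \in s -> 0 < ccoord x v
    & forall w, w \notin s -> ccoord x w < 1].
Proof.
move=> l0; have : 0 < level x s by rewrite lt_neqAle eq_sym l0 level_ge0.
rewrite /level lt_max ltxx /= subr_gt0.
set m := \big[Num.min/1]_(v in s) _; set M := \big[Num.max/0]_(v | _) _ => mM.
have hm v : v \in s -> m <= ccoord x v by move=> vs; apply: bigmin_le_cond.
have hM w : w \notin s -> ccoord x w <= M by move=> ws; apply: le_bigmax_cond.
have m1 : m <= 1 by apply: bigmin_le_id.
have M0 : 0 <= M by apply: bigmax_ge_id.
split=> [v w vs ws|v vs|w ws].
- exact: le_lt_trans (hM w ws) (lt_le_trans mM (hm v vs)).
- exact: le_lt_trans M0 (lt_le_trans mM (hm v vs)).
- exact: le_lt_trans (hM w ws) (lt_le_trans mM m1).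
Qed.

Lemma level_sum_gt0 x : 0 < \sum_s level x s.
Proof.
pose s := [set v | ccoord x v == 1]%SET.
rewrite (bigD1 s) //= ltr_pwDl ?sumr_ge0 // => [|t _]; last exact: level_ge0.
rewrite /level lt_max ltxx /= subr_gt0.
apply: lt_le_trans (_ : 1 <= _).
  apply/bigmax_ltP; split=> // v; rewrite inE => xv.
  by rewrite lt_neqAle xv /=; case/andP: (coord01 x v).
apply/bigmin_geP; split=> // v; rewrite inE => /eqP ->.
exact: lexx.
Qed.

Lemma of_cubesP x : realization_set R OC (fun s => level x s / \sum_t level x t).
Proof.
have s0 := level_sum_gt0 x; split=> [s||].
- by rewrite divr_ge0 ?level_ge0 // ltW.
- by rewrite -mulr_suml divff // lt0r_neq0.
have nz s : level x s / \sum_t level x t != 0 -> level x s != 0.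
  by apply: contraNneq => ->; rewrite mul0r.
apply/order_complexP; split=> [s|s t]; rewrite !inE.
  move=> /nz /level_neq0[_ h _]; have [_ xK] := coordP x.
  apply: (K_complex.2 _ _ xK); apply/fintype.subsetP => v vs.
  by rewrite inE lt0r_neq0 // h.
move=> /nz /level_neq0[hs _ _] /nz /level_neq0[ht _ _].
have [//|/fintype.subsetPn[v vs vt]] := boolP (s \subset t).
apply/fintype.subsetP => w wt'; apply: contraT => ws.
by have := lt_trans (hs v w vs ws) (ht w v wt' vt); rewrite ltxx.
Qed.

(** Divided by the sum of the lengths, so that the result is a point of the realization by
    construction. *)
Definition of_cubes x : P := mkbary (of_cubesP x).

Lemma wt_of_cubes x s : wt (of_cubes x) s = level x s / \sum_t level x t.
Proof. by []. Qed.

Lemma cts_of_cubes : continuous of_cubes.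
Proof.
apply: cts_mkbary => s; rewrite /bary /=; apply: cts_mul; first exact: cts_level.
apply: cts_inv => [|x]; last by rewrite lt0r_neq0 ?level_sum_gt0.
by apply: cts_sum => t; exact: cts_level.
Qed.

Lemma wt_of_cubes_neq0 x s : wt (of_cubes x) s != 0 -> level x s != 0.
Proof. by apply: contraNneq => h; rewrite wt_of_cubes h mul0r. Qed.

Lemma of_cubes_face x s v : ccoord x v = 1 -> wt (of_cubes x) s != 0 -> v \in s.
Proof.
move=> xv /wt_of_cubes_neq0 /level_neq0[_ _ h]; apply: contraT => vs.
by have := h v vs; rewrite xv ltxx.
Qed.

Lemma to_of_cubes_eq0 x v : ccoord x v = 0 -> ccoord (to_cubes (of_cubes x)) v = 0.
Proof.
move=> xv; rewrite coord_to_cubes big1 // => s vs; apply/eqP.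
apply: contraT => /wt_of_cubes_neq0 /level_neq0[_ h _].
by have := h v vs; rewrite xv ltxx.
Qed.

Lemma to_cubes_eq1 p v : (forall s, wt p s != 0 -> v \in s) -> ccoord (to_cubes p) v = 1.
Proof.
move=> h; rewrite coord_to_cubes -(bary_sum p) [RHS](bigID (fun s : {set T} => v \in s)) /=.
rewrite [X in _ = _ + X]big1 ?addr0 // => s vs.
by apply/eqP; apply: contraNT vs; exact: h.
Qed.

(** A nonzero level [s] of [to_cubes p] is a member of the chain that supports [p].
    Otherwise compare [s] with the smallest member [t0] of the chain above it and the
    largest member [t1] not above it: a point of [t0] outside of [s] has at least the
    coordinate of a point of [s] outside of [t1], so no threshold separates them. *)
Lemma of_to_cubes_eq0 p s : wt p s = 0 -> wt (of_cubes (to_cubes p)) s = 0.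
Proof.
move=> ps; apply/eqP; apply: contraT => /wt_of_cubes_neq0 /level_neq0[h1 h2 h3].
pose D0 := [set t | (wt p t != 0) && (s \subset t)]%SET.
pose D1 := [set t | (wt p t != 0) && ~~ (s \subset t)]%SET.
have ch (D : {set {set T}}) : (forall t, t \in D -> wt p t != 0) ->
    forall t t', t \in D -> t' \in D -> (t \subset t') || (t' \subset t).
  by move=> hD t t' /hD + /hD; exact: wt_chain.
have [D00|D0n] := eqVneq D0 finset.set0.
  have [|m] := chain_max (wt_supp_neq0 p); first by apply: ch => t; rewrite inE.
  rewrite inE => pm mmax.
  have : ~~ (s \subset m).
    by apply/negP => sm; have := finset.in_set0 m; rewrite -D00 inE pm sm.
  case/fintype.subsetPn => v vs vm; have := h2 v vs.
  rewrite coord_to_cubes big1 ?ltxx // => t vt; apply/eqP; apply: contraT => pt.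
  by case/negP: vm; apply: (fintype.subsetP (mmax t _)); rewrite ?inE.
have [|t0] := chain_min D0n; first by apply: ch => t; rewrite inE => /andP[].
rewrite inE => /andP[pt0 st0] t0min.
have /fintype.subsetPn[w wt0 ws] : ~~ (t0 \subset s).
  apply/negP => t0s; move: pt0; suff -> : t0 = s by rewrite ps eqxx.
  by apply/eqP; rewrite finset.eqEsubset t0s st0.
have wD0 t : wt p t != 0 -> s \subset t -> w \in t.
  by move=> pt st; apply: (fintype.subsetP (t0min t _)); rewrite ?inE ?pt.
have [D10|D1n] := eqVneq D1 finset.set0.
  have := h3 w ws; rewrite to_cubes_eq1 ?ltxx // => t pt; apply: wD0 => //.
  by apply: contraT => st; have := finset.in_set0 t; rewrite -D10 inE pt st.
have [|t1] := chain_max D1n; first by apply: ch => t; rewrite inE => /andP[].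
rewrite inE => /andP[pt1 /fintype.subsetPn[v vs vt1]] t1max.
have := h1 v w vs ws; rewrite ltNge => /negP[]; rewrite !coord_to_cubes.
rewrite [leRHS](bigID (fun t : {set T} => v \in t)) /=.
rewrite [leLHS](bigID (fun t : {set T} => w \in t)) /=.
rewrite [X in _ + X <= _]big1 ?addr0.
  rewrite (eq_bigl (fun t : {set T} => (w \in t) && (v \in t))) => [|t]; last by rewrite andbC.
  by rewrite lerDl sumr_ge0 // => t _; exact: bary_ge0.
move=> t /andP[vt wt']; apply/eqP; apply: contraT => pt; case/negP: wt'.
apply: wD0 => //; apply: contraT => st; case/negP: vt1.
by apply: (fintype.subsetP (t1max t _)); rewrite ?inE ?pt.
Qed.

Lemma to_cubes_faces p s : (forall t, wt p t != 0 -> s \subset t) ->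
  forall v, v \in s -> ccoord (to_cubes p) v = 1.
Proof. by move=> h v vs; apply: to_cubes_eq1 => t /h /fintype.subsetP; apply. Qed.

Lemma cubes_linearP (w : cubes R K * R) : in_cubes K (fun v =>
  (1 - clamp w.2) * ccoord (to_cubes (of_cubes w.1)) v + clamp w.2 * ccoord w.1 v).
Proof.
apply: (in_cubes_sub K_complex (x := w.1)) => v.
  have := clamp_ge0 w.2; have := clamp_le1 w.2.
  have := coord01 w.1 v; have := coord01 (to_cubes (of_cubes w.1)) v; nra.
by move=> xv; rewrite to_of_cubes_eq0 // xv !mulr0 addr0.
Qed.

Definition cubes_linear w : cubes R K := mkcubes (cubes_linearP w).

Lemma coord_linear x r v : ccoord (cubes_linear (x, r)) v =
  (1 - clamp r) * ccoord (to_cubes (of_cubes x)) v + clamp r * ccoord x v.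
Proof. by []. Qed.

Lemma cts_cubes_linear : continuous cubes_linear.
Proof.
apply: cts_mkcubes => v; rewrite /ccoord /=.
have c1 : continuous (fun w : cubes R K * R => clamp w.2) by apply: cts_clamp; cts.
have c2 : continuous (fun w : cubes R K * R => ccoord w.1 v) by apply: cts_coord; cts.
have c3 : continuous (fun w : cubes R K * R => ccoord (to_cubes (of_cubes w.1)) v).
  apply: cts_coord; apply: (cts_comp cts_to_cubes).
  by apply: (cts_comp cts_of_cubes); cts.
by cts.
Qed.

Lemma cubes_linear_face x r v : ccoord x v = 1 -> ccoord (cubes_linear (x, r)) v = 1.
Proof.
move=> xv; rewrite coord_linear xv (to_cubes_eq1 (p := of_cubes x)); first by rewrite !mulr1 subrK.
by move=> s; exact: of_cubes_face.
Qed.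

Lemma P_linearP (w : P * R) : realization_set R OC (fun s =>
  (1 - clamp w.2) * wt (of_cubes (to_cubes w.1)) s + clamp w.2 * wt w.1 s).
Proof.
have t0 := clamp_ge0 w.2; have t1 := clamp_le1 w.2.
apply: (realization_sub (@order_complex_closed _ K) (p := w.1)) => [s||s ps].
- by rewrite addr_ge0 // mulr_ge0 ?subr_ge0 // bary_ge0.
- by rewrite big_split /= -!mulr_sumr !bary_sum !mulr1 subrK.
- by rewrite of_to_cubes_eq0 // /wt ps !mulr0 addr0.
Qed.

Definition P_linear w : P := mkbary (P_linearP w).

Lemma wt_linear p r s : wt (P_linear (p, r)) s =
  (1 - clamp r) * wt (of_cubes (to_cubes p)) s + clamp r * wt p s.
Proof. by []. Qed.

Lemma cts_P_linear : continuous P_linear.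
Proof.
apply: cts_mkbary => s; rewrite /bary /=.
have c1 : continuous (fun w : P * R => clamp w.2) by apply: cts_clamp; cts.
have c2 : continuous (fun w : P * R => wt w.1 s) by apply: cts_bary; cts.
have c3 : continuous (fun w : P * R => wt (of_cubes (to_cubes w.1)) s).
  apply: cts_bary; apply: (cts_comp cts_of_cubes).
  by apply: (cts_comp cts_to_cubes); cts.
by cts.
Qed.

Lemma wt_linear_eq0 p r s : wt p s = 0 -> wt (P_linear (p, r)) s = 0.
Proof. by move=> ps; rewrite wt_linear of_to_cubes_eq0 // ps !mulr0 addr0. Qed.

End cone_as_cubes.

(** * Automorphisms of the torus *)

Section monomial_maps.
Variable F : fieldType.

Lemma prod_exprz (I : finType) (P : pred I) (x : I -> F) (m : int) :
  (\prod_(i | P i) x i) ^ m = \prod_(i | P i) x i ^ m.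
Proof.
by elim/big_rec2: _ => [|i y z _ <-]; rewrite ?exp1rz ?expfzMl.
Qed.

Lemma exprz_sum (I : finType) (P : pred I) (x : F) (m : I -> int) : x != 0 ->
  x ^ (\sum_(i | P i) m i) = \prod_(i | P i) x ^ m i.
Proof.
by move=> x0; elim/big_rec2: _ => [|i y z _ <-]; rewrite ?expr0z ?expfzDr.
Qed.

Definition monomials k (e : 'M[int]_k) (x : 'I_k -> F) (j : 'I_k) : F :=
  \prod_i x i ^ e i j.

Lemma monomials_comp k (e f : 'M[int]_k) (x : 'I_k -> F) j : (forall i, x i != 0) ->
  monomials f (monomials e x) j = monomials (e *m f) x j.
Proof.
move=> x0; rewrite /monomials.
under eq_bigr do rewrite prod_exprz.
rewrite exchange_big /=; apply: eq_bigr => i _.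
rewrite mxE exprz_sum //; apply: eq_bigr => l _.
by rewrite exprz_exp.
Qed.

Lemma monomials1 k (x : 'I_k -> F) j : monomials 1%:M x j = x j.
Proof.
rewrite /monomials (bigD1 j) //= mxE eqxx expr1z big1 ?mulr1 // => i ij.
by rewrite mxE (negPf ij) expr0z.
Qed.

Lemma monomialsM k (e : 'M[int]_k) (x y : 'I_k -> F) j :
  monomials e (fun i => x i * y i) j = monomials e x j * monomials e y j.
Proof. by rewrite /monomials -big_split; apply: eq_bigr => i _; rewrite expfzMl. Qed.

(** The inverse matrix gives the inverse monomial map. *)
Lemma monomials_inj k (e : 'M[int]_k) (x y : 'I_k -> F) : e \in unitmx ->
  (forall i, x i != 0) -> (forall i, y i != 0) ->
  monomials e x =1 monomials e y -> x =1 y.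
Proof.
move=> eU x0 y0 exy j.
have inv z : (forall i, z i != 0) -> monomials (invmx e) (monomials e z) j = z j.
  by move=> z0; rewrite monomials_comp // mulmxV // monomials1.
by rewrite -(inv x x0) -(inv y y0); congr (monomials _ _ _); apply/funext.
Qed.

End monomial_maps.

Section torus_automorphisms.
Context (R : realType) (k : nat).
Implicit Types (e f : 'M[int]_k) (g h : torus R k).

Definition tval g (i : 'I_k) : R[i] := \val (g i).

Lemma tval_neq0 g i : tval g i != 0. Proof. exact: circle_neq0. Qed.

Lemma norm_exprz (z : R[i]) (m : int) : `|z| = 1 -> `|z ^ m| = 1.
Proof.
by move=> z1; case: m => m; rewrite ?NegzE -?exprnN ?exprnP ?normfV normrX z1 expr1n ?invr1.
Qed.

Lemma tpowP e g j : `|monomials e (tval g) j| = 1.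
Proof.
rewrite /monomials normr_prod big1 // => i _.
by apply: norm_exprz; exact: circle_norm.
Qed.

Definition tpow e g : torus R k := fun j => mkcircle (tpowP e g j).

Lemma tval_tpow e g j : tval (tpow e g) j = monomials e (tval g) j.
Proof. by []. Qed.

Lemma torus_ext g h : tval g =1 tval h -> g = h.
Proof. by move=> gh; apply/funext => i; apply: val_inj; exact: gh. Qed.

Lemma tpow_comp e f g : tpow f (tpow e g) = tpow (e *m f) g.
Proof.
apply: torus_ext => j; rewrite !tval_tpow -monomials_comp //.
by move=> i; exact: tval_neq0.
Qed.

Lemma tpow1 g : tpow 1%:M g = g.
Proof. by apply: torus_ext => j; rewrite tval_tpow monomials1. Qed.

Lemma cts_exprz (W : topologicalType) (f : W -> R[i]^o) (m : int) : continuous f ->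
  (forall w, f w != 0) -> continuous (fun w => (f w : R[i]) ^ m : R[i]^o).
Proof.
move=> cf f0.
have cn n : continuous (fun w => (f w : R[i]) ^+ n : R[i]^o).
  elim: n => [|n IH]; first exact: cts_cst.
  under eq_fun do rewrite exprS.
  by move=> w; exact: (@continuousM R[i] W (f : W -> R[i]) _ w (cf w) (IH w)).
case: m => n; first exact: cn.
move=> w; apply: (@continuousV R[i] W _ w _ (cn n.+1 w)).
by rewrite expf_neq0.
Qed.

Lemma cts_tpow (W : topologicalType) e (g : W -> torus R k) :
  continuous g -> continuous (fun w => tpow e (g w)).
Proof.
move=> cg; apply: cts_ptws => j; apply: cts_sub => /=.
have ce i : continuous (fun w => tval (g w) i ^ e i j : R[i]^o).
  apply: cts_exprz => [|w]; last exact: tval_neq0.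
  by apply: cts_val; exact: (cts_torus (f := g)).
rewrite /monomials; elim: (index_enum _) => [|i r IH].
  by under eq_fun do rewrite big_nil; exact: cts_cst.
under eq_fun do rewrite big_cons.
by move=> w; exact: (@continuousM R[i] W _ _ w (ce i w) (IH w)).
Qed.

End torus_automorphisms.

Section characteristic_torus.
Context (R : realType) (T : finType) (K : {set {set T}}) (k : nat).
Context (alpha : 'I_k -> {set T}) (e : 'M[int]_k).
Hypothesis alpha_partition : partition_of_vertices K alpha.
Hypothesis e_basis : e \in unitmx.

Lemma lambda_monomials (z : T -> circle R) (s : {set T}) (j : 'I_k) :
  \prod_(v in s) (\val (z v) : R[i]) ^ lambda_alpha alpha e v 0 j =
  monomials e (fun i => \prod_(v in s :&: alpha i) (\val (z v) : R[i])) j.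
Proof.
rewrite /monomials.
under eq_bigr => v _.
  rewrite /lambda_alpha summxE exprz_sum; last exact: circle_neq0.
  over.
rewrite (exchange_big_dep predT) //=; apply: eq_bigr => i _.
rewrite prod_exprz; apply: eq_big => [v|v _]; first by rewrite inE.
by rewrite mxE.
Qed.

(** In the torus coordinates given by the basis [e], the subtorus of a simplex is the
    product of the coordinate circles of the blocks that it meets. *)
Lemma subtorusP (s : {set T}) (h h' : torus R k) :
  subtorus R (lambda_alpha alpha e) s (torus_div (tpow e h') (tpow e h)) <->
  forall i, i \notin blocks alpha s -> h' i = h i.
Proof.
have hn : forall i, tval h i != 0 by move=> i; exact: tval_neq0.
have hn' : forall i, tval h' i != 0 by move=> i; exact: tval_neq0.
have divE j : torus_div (tpow e h') (tpow e h) j =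
    monomials e (fun i => tval h' i / tval h i) j.
  rewrite /torus_div -/(tval _ j) -/(tval (tpow e h) j) !tval_tpow monomialsM.
  congr (_ * _); rewrite /monomials -prodfV; apply: eq_bigr => i _.
  by rewrite expfV.
split=> [[z zE] i iN|hh].
  have zn l : \prod_(v in s :&: alpha l) (\val (z v) : R[i]) != 0.
    by apply/prodf_neq0 => v _; exact: circle_neq0.
  have qn l : tval h' l / tval h l != 0 by rewrite mulf_neq0 ?invr_eq0.
  have eq : (fun l => tval h' l / tval h l) =1
      (fun l => \prod_(v in s :&: alpha l) (\val (z v) : R[i])).
    by apply: (monomials_inj e_basis) => // j; rewrite -divE zE lambda_monomials.
  apply: val_inj; have := eq i; rewrite big_pred0; first by move=> /divr1_eq.
  move=> v; apply/negP => vi; case/negP: iN; rewrite inE.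
  by apply/finset.set0Pn; exists v.
have qP i : `|tval h' i / tval h i| = 1.
  by rewrite normf_div !circle_norm divr1.
pose q i := mkcircle (qP i).
(* put the quotient at a single vertex of each block, [1] at all others *)
pose rep i := [pick v in s :&: alpha i].
pose z v := if [pick i | rep i == Some v] is Some i then q i else circ1 R.
have repP i v : rep i = Some v -> v \in s /\ v \in alpha i.
  by rewrite /rep; case: pickP => // u; rewrite inE => /andP[us ui] [<-].
exists z => j; rewrite divE lambda_monomials /monomials; apply: eq_bigr => i _.
congr (_ ^ _).
have [iB|iB] := boolP (i \in blocks alpha s); last first.
  rewrite big_pred0 => [|v]; first by rewrite /tval (hh i iB) divff //; exact: hn.
  apply/negP => vi; case/negP: iB; rewrite inE.
  by apply/finset.set0Pn; exists v.
have [v0 rv0] : exists v0, rep i = Some v0.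
  rewrite /rep; case: pickP => [v _|no]; first by exists v.
  by move: iB; rewrite inE => /finset.set0Pn[v vi]; have := no v; rewrite vi.
have [v0s v0i] := repP _ _ rv0.
have zrep v l : v \in alpha i -> rep l = Some v -> l = i.
  by move=> vi /repP[_ vl]; exact: (block_unique alpha_partition vl vi).
rewrite (bigD1 v0) /=; last by rewrite inE v0s.
rewrite big1 ?mulr1 => [|v /andP[]].
  rewrite /z; case: pickP => [l /eqP/(zrep _ _ v0i) ->//|no].
  by have := no i; rewrite rv0 eqxx.
rewrite inE => /andP[vs vi] vv0; rewrite /z; case: pickP => // l /eqP rl.
by have := rl; rewrite (zrep v l vi rl) rv0 => -[vE]; rewrite vE eqxx in vv0.
Qed.

End characteristic_torus.

(** * The space X and its stable splitting *)

Section model_of_X.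
Context (R : realType) (T : finType) (K : {set {set T}}) (k : nat).
Context (alpha : 'I_k -> {set T}) (e : 'M[int]_k).
Hypothesis K_complex : simplicial_complex K.
Hypothesis alpha_partition : partition_of_vertices K alpha.
Hypothesis e_basis : e \in unitmx.
Local Notation P := (P_space R K).
Local Notation X := (X_space R K (lambda_alpha alpha e)).
Local Notation V := (partial_smash R alpha K_complex finset.set0 [set: 'I_k]%SET).
Let e' := invmx e.

Let tK : cancel (@tpow R k e') (tpow e).
Proof. by move=> g; rewrite tpow_comp /e' mulVmx // tpow1. Qed.

Let tVK : cancel (@tpow R k e) (tpow e').
Proof. by move=> g; rewrite tpow_comp /e' mulmxV // tpow1. Qed.

Definition xcls (a : P * torus R k) : X := (\pi_(gen_quot (X_rel (lambda_alpha alpha e))) a)%qT.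

Lemma cts_xcls : continuous xcls.
Proof. by have [] := gen_quot_map (X_rel (R := R) (K := K) (lambda_alpha alpha e)). Qed.

Lemma xcls_surj (y : X) : exists a, xcls a = y.
Proof.
have [_ h _] := gen_quot_map (X_rel (R := R) (K := K) (lambda_alpha alpha e)).
exact: h.
Qed.

(** The relation defining [X], in the torus coordinates given by the basis. *)
Definition glued (p : P) (h h' : torus R k) : Prop :=
  exists s : {set T}, [/\ s \in K, forall t, wt p t != 0 -> s \subset t
    & forall i, i \notin blocks alpha s -> h' i = h i].

Lemma X_relP (a b : P * torus R k) : X_rel (lambda_alpha alpha e) a b <->
  a.1 = b.1 /\ glued a.1 (tpow e' a.2) (tpow e' b.2).
Proof.
split=> [[s [sK ab fs ts]]|[ab [s [sK fs hh]]]].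
  split=> //; exists s; split=> //; first exact/(faceP _ sK).
  by apply/(subtorusP alpha_partition e_basis); rewrite !tK.
exists s; split=> //; first exact/(faceP _ sK).
by rewrite -[b.2]tK -[a.2]tK; apply/(subtorusP alpha_partition e_basis).
Qed.

Lemma xcls_glued p h h' : glued p h h' -> xcls (p, tpow e h) = xcls (p, tpow e h').
Proof. by move=> g; apply: gen_quot_rel; apply/X_relP; rewrite /= !tVK. Qed.

Lemma xcls_lift (Z : topologicalType) (f : P * torus R k -> Z) : continuous f ->
  (forall p h h', glued p h h' -> f (p, h) = f (p, h')) ->
  exists2 g : X -> Z, continuous g & forall p h, g (xcls (p, tpow e h)) = f (p, h).
Proof.
move=> cf fr.
have ct : continuous (fun a : P * torus R k => tpow e' a.2) by apply: cts_tpow; cts.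
have [||g cg gE] := @gen_quot_lift _ Z (X_rel (lambda_alpha alpha e))
    (fun a : P * torus R k => f (a.1, tpow e' a.2)).
- by cts.
- by move=> a b /X_relP[<- h]; exact: fr.
by exists g => // p h; rewrite [LHS]gE /= tVK.
Qed.

Lemma xcls_liftR (Z : topologicalType) (f : P * torus R k * R -> Z) : continuous f ->
  (forall p h h' t, glued p h h' -> f (p, h, t) = f (p, h', t)) ->
  exists2 g : X * R -> Z, continuous g &
    forall p h t, g (xcls (p, tpow e h), t) = f (p, h, t).
Proof.
move=> cf fr.
have ct : continuous (fun a : P * torus R k * R => tpow e' a.1.2) by apply: cts_tpow; cts.
have [||g cg gE] := quot_lift (f := fun a : P * torus R k * R => f (a.1.1, tpow e' a.1.2, a.2))
    (quot_mapR R (gen_quot_map (X_rel (R := R) (K := K) (lambda_alpha alpha e)))).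
- by cts.
- move=> [a t] [b t'] /= [ab <-]; move: a b ab; apply: gen_quot_ind => a b.
  by move=> /X_relP[<- h]; exact: fr.
by exists g => // p h t; rewrite (gE (p, tpow e h, t)) /= tVK.
Qed.

Lemma xcls_ex (y : X) : exists p h, xcls (p, tpow e h) = y.
Proof. by have [[p g] <-] := xcls_surj y; exists p, (tpow e' g); rewrite tK. Qed.

(** A point of the open star of [p0] lies on faces through [p0] only, so pulling it
    to [p0] respects the identifications; the torus coordinates not forgotten at
    [p0] are pushed to those of [x0]. *)
Theorem X_well_pointed (x0 : X) : well_pointed R x0.
Proof.
have [p0 [h0 <-]] := xcls_ex x0.
have [|s0 s0D s0min] := chain_min (wt_supp_neq0 p0).
  by move=> s t; rewrite !inE; exact: wt_chain.
have ps0 : wt p0 s0 != 0 by rewrite inE in s0D.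
have s0K : s0 \in K by exact: wt_simplex ps0.
have s0sub t : wt p0 t != 0 -> s0 \subset t by move=> pt; apply: s0min; rewrite inE.
have OCc := @order_complex_closed _ K.
pose push (w : torus R k * R) : torus R k := fun i => cpush (h0 i) (w.1 i, w.2).
have cpushall : continuous push.
  apply: cts_ptws => i; apply: (cts_comp (cts_cpush (z0 := h0 i))).
  by apply: cts_pair; [apply: (cts_torus (f := fun w : torus R k * R => w.1))|]; cts.
have cpl : continuous (pull OCc p0) by exact: cts_pull.
have cx := cts_xcls.
have ct : continuous (fun g => tpow e g : torus R k) by apply: cts_tpow; exact: cts_id.
have [||phi cphi phiE] := @xcls_liftR X
    (fun w => xcls (pull OCc p0 (w.1.1, w.2), tpow e (push (w.1.2, w.2)))).
- by cts.
- move=> p h h' t [s [sK fs hh]]; apply: xcls_glued; exists s; split=> // [u|i /hh].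
    by move=> pu; apply: fs; apply: contraNneq pu => pu; rewrite /wt pull_supp.
  by rewrite /push /= => ->.
pose I0 := blocks alpha s0.
pose W (a : P * torus R k) : R := closeness p0 a.1 *
  \prod_(i | i \notin I0) clamp (2 * cdot (h0 i) (a.2 i) - 1).
have cW : continuous W.
  apply: cts_mul; first by apply: (cts_comp (cts_closeness (p0 := p0))); cts.
  apply: cts_prod => i; apply: cts_clamp; apply: cts_add; last exact: cts_cst.
  apply: cts_mul; first exact: cts_cst.
  by apply: cts_cdot; apply: (cts_torus (f := fun a : P * torus R k => a.2)); cts.
have prod01 (a : P * torus R k) :
    0 <= \prod_(i | i \notin I0) clamp (2 * cdot (h0 i) (a.2 i) - 1) <= 1.
  by apply: prod_itv01 => i _; rewrite clamp_ge0 clamp_le1.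
have [||u cu uE] := @xcls_lift R (fun a => clamp (2 * (1 - W a))).
- by apply: cts_clamp; cts.
- move=> p h h' [s [sK fs hh]]; congr (clamp (2 * (1 - _))); rewrite /W /=.
  have [->|c0] := eqVneq (closeness p0 p) 0; first by rewrite !mul0r.
  have ss0 : s \subset s0.
    by apply: fs; apply: contraNneq ps0 => ps; rewrite /wt (closeness_star c0).
  congr (_ * _); apply: eq_bigr => i iI; rewrite hh //.
  apply: contraNN iI; rewrite !inE => /finset.set0Pn[v]; rewrite inE => /andP[vs vi].
  by apply/finset.set0Pn; exists v; rewrite inE vi (fintype.subsetP ss0).
exists phi, u; split=> //; split=> [y|t t01|y||y].
- have [p [h <-]] := xcls_ex y; rewrite phiE pull0; congr (xcls (_, tpow e _)).
  by apply/funext => i; rewrite /push cpush0.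
- rewrite phiE pull_self; congr (xcls (_, tpow e _)).
  by apply/funext => i; rewrite /push cpushz.
- by have [p [h <-]] := xcls_ex y; rewrite uE clamp_ge0 clamp_le1.
- rewrite uE /W closeness_self big1 => [|i _]; first by rewrite mulr1 subrr mulr0 clamp0.
  by rewrite cdotxx mulr1 clamp_ge1 //; lra.
have [p [h <-]] := xcls_ex y; rewrite uE phiE => u1.
have W2 : 2^-1 < W (p, h).
  rewrite ltNge; apply/negP => W2; move: u1; rewrite clamp_ge1 ?ltxx //; lra.
have /andP[b0 b1] := prod01 (p, h); have /andP[c0 c1] := closeness_itv p0 p.
have cp : 1 <= 2 * closeness p0 p by rewrite /W /= in W2; nra.
rewrite pull1 //; apply: xcls_glued; exists s0; split=> // i iI.
rewrite /push /= cpush1 //; rewrite leNgt; apply/negP => hi.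
move: W2; rewrite /W /= (bigD1 i) //= clamp_le0 ?mul0r ?mulr0; first by rewrite ltNge invr_ge0 ler0n.
lra.
Qed.

Let c : model R K k -> V := cls alpha finset.set0 finset.set0 [set: 'I_k]%SET.
Let cc : continuous c. Proof. exact: cts_cls. Qed.
Let not_collapsed (d : model R K k) : ~ collapsed alpha finset.set0 finset.set0 d.
Proof. by case=> -[j]; rewrite inE. Qed.

(** The cone and the cubes are homotopy equivalent by linear homotopies within simplices
    and cubes, which keep all faces and hence extend over the torus coordinates. *)
Theorem X_pequiv : exists x1 : X, pequiv R (pointed_at x1) V.
Proof.
have cto : continuous (@to_cubes R T K K_complex) by exact: cts_to_cubes.
have cof : continuous (@of_cubes R T K K_complex) by exact: cts_of_cubes.
have cx := cts_xcls; have ccc := cc.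
have ct : continuous (fun g => tpow e g : torus R k) by apply: cts_tpow; exact: cts_id.
have glued_face p h h' : glued p h h' -> forall i, on_face alpha i (to_cubes K_complex p) \/ h i = h' i.
  move=> [s [sK fs hh]] i; have [iB|iB] := boolP (i \in blocks alpha s); last first.
    by right; rewrite hh.
  left; move: iB; rewrite inE => /finset.set0Pn[v]; rewrite inE => /andP[vs vi].
  by exists v => //; exact: to_cubes_faces vs.
have face_glued x h h' : (forall i, on_face alpha i x \/ h i = h' i) ->
    glued (of_cubes K_complex x) h h'.
  move=> hh; exists [set v | ccoord x v == 1]%SET; split.
  - have [_ xK] := coordP x; apply: (K_complex.2 _ _ xK).
    by apply/fintype.subsetP => v; rewrite !inE => /eqP ->; exact: oner_neq0.
  - move=> s ps; apply/fintype.subsetP => v; rewrite inE => /eqP xv.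
    exact: of_cubes_face ps.
  - move=> i iB; have [[v vi xv]|//] := hh i; case/negP: iB; rewrite inE.
    by apply/finset.set0Pn; exists v; rewrite !inE xv eqxx.
have cls_face x h h' : (forall i, on_face alpha i x \/ h i = h' i) -> c (x, h) = c (x, h').
  by move=> hh; apply: cls_eq => i _; exact: hh.
have [||F cF FE] := @xcls_lift V (fun a => c (to_cubes K_complex a.1, a.2)).
- by cts.
- by move=> p h h' /glued_face; exact: cls_face.
have [G cG GcE] : exists2 G : V -> X, continuous G &
    forall x h, G (c (x, h)) = xcls (of_cubes K_complex x, tpow e h).
  have [||G cG GE] := @cls_lift _ _ _ _ alpha finset.set0 finset.set0 [set: 'I_k]%SET X
    (fun d => xcls (of_cubes K_complex d.1, tpow e d.2)).
  - by cts.
  - move=> [x h] [x' h'] [[/not_collapsed //]|[/= <- hh]].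
    by apply: xcls_glued; apply: face_glued => i; apply: hh; rewrite inE.
  by exists G => // x h; exact: GE.
have to_of_apex : to_cubes K_complex (of_cubes K_complex (apex R K_complex)) = apex R K_complex.
  by apply: cubes_ext => v; rewrite to_of_cubes_eq0.
exists (G point); have Gp : G point = xcls (of_cubes K_complex (apex R K_complex), tpow e (@torus1 R k)).
  exact: GcE.
have cs (y : V) : exists d, c d = y by exact: cls_surj.
exists F, G; split.
- by split=> //; rewrite [LHS](_ : _ = F (G point)) // Gp FE to_of_apex.
- by split.
- have cl : continuous (@P_linear R T K K_complex) by exact: cts_P_linear.
  have [||H cH HE] := @xcls_liftR X
      (fun w => xcls (P_linear K_complex (w.1.1, w.2), tpow e w.1.2)).
  + by cts.
  + move=> p h h' t [s [sK fs hh]]; apply: xcls_glued; exists s; split=> // u pu.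
    by apply: fs; apply: contraNneq pu => pu; rewrite wt_linear_eq0.
  exists H => //; split=> [y|y|t].
  + have [p [h <-]] := xcls_ex y; rewrite [LHS]HE FE GcE; congr (xcls (_, _)).
    apply: bary_ext => s; rewrite -/(wt _ s) wt_linear clamp0 subr0 mul1r mul0r addr0 //.
  + have [p [h <-]] := xcls_ex y; rewrite [LHS]HE; congr (xcls (_, _)).
    by apply: bary_ext => s; rewrite -/(wt _ s) wt_linear clamp1 subrr mul1r mul0r add0r.
  + change (H (G point, t) = G point); rewrite Gp HE; congr (xcls (_, _)).
    apply: bary_ext => s; rewrite -/(wt _ s) wt_linear to_of_apex /= -mulrDl subrK mul1r //.
- have cl : continuous (@cubes_linear R T K K_complex) by exact: cts_cubes_linear.
  have [||H cH HE] := @cls_liftR _ _ _ _ alpha finset.set0 finset.set0 [set: 'I_k]%SET V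
      (fun w => c (cubes_linear K_complex (w.1.1, w.2), w.1.2)).
  + by cts.
  + move=> [x h] [x' h'] t [[/not_collapsed //]|[/= <- hh]].
    apply: cls_face => i; have [|[v vi xv]|] := hh i; [by rewrite inE| |by right].
    by left; exists v => //; exact: cubes_linear_face.
  exists H => //; split=> [y|y|t].
  + have [[x h] <-] := cs y; rewrite [LHS]HE GcE FE; congr (c (_, _)).
    by apply: cubes_ext => v; rewrite coord_linear clamp0 subr0 mul1r mul0r addr0.
  + have [[x h] <-] := cs y; rewrite [LHS]HE; congr (c (_, _)).
    by apply: cubes_ext => v; rewrite coord_linear clamp1 subrr mul1r mul0r add0r.
  + rewrite [LHS]HE; congr (c (_, _)); apply: cubes_ext => v.
    by rewrite coord_linear to_of_apex /= -mulrDl subrK mul1r.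
Qed.

End model_of_X.

Theorem theorem1p3 (R : realType) (T : finType) (K : {set {set T}}) (k : nat)
  (alpha : 'I_k -> {set T}) (e : 'M[int]_k)
  (K_complex : simplicial_complex K)
  (alpha_partition : partition_of_vertices K alpha)
  (e_basis : e \in unitmx)
  (x0 : X_space R K (lambda_alpha alpha e))
  (b : forall L : {set 'I_k}, L != finset.set0 ->
         {v : T | v \in vertices (subcomplex K alpha L)}) :
  homotopy_equivalent R
    (reduced_susp R (pointed_at x0))
    (wedge (fun L : {set 'I_k} => (point : summand R b L))).
Proof.
have [x1 Xx1] := X_pequiv R K_complex alpha_partition e_basis.
have XV : pequiv R (reduced_susp R (pointed_at x0))
    (reduced_susp R (partial_smash R alpha K_complex finset.set0 [set: 'I_k]%SET)).
  refine (pequiv_trans _ (susp_pequiv Xx1)).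
  refine (pequiv_trans (susp_ususp (X_well_pointed alpha_partition e_basis x0)) _).
  refine (pequiv_trans _ (pequiv_sym (susp_ususp (X_well_pointed alpha_partition e_basis x1)))).
  by apply: pequiv_point; apply: ususp_pt0.
have dis : [disjoint (finset.set0 : {set 'I_k}) & [set: 'I_k]%SET]%B.
  by rewrite -finset.setI_eq0 finset.set0I.
have := partial_smash_hcoprod R alpha K_complex dis; rewrite finset.set0U => -[inj h].
have {}h : hcoprod R predT inj.
  by apply: hcoprod_eqP h => L; rewrite finset.sub0set finset.subsetT.
have [inj' h'] := hcoprod_pequiv h
  (fun L _ => summand_pequiv R K_complex alpha_partition b L).
have := hcoprod_unique h' (hcoprod_wedge R (fun L => summand R b L) finset.set0).
by move=> /(pequiv_trans XV) /pequiv_homotopy_equivalent.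
Qed.
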